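(* Let $d\ge2$, let $Q:\mathbb R^{d+1}\to\mathbb R$ be a nonsingular quadratic form with integer coefficients such that $\mathbb P^d_{\mathbb Q}\cap M_Q\ne\emptyset$, where $M_Q=\{[\mathbf x]\in\mathbb P^d_{\mathbb R}:Q(\mathbf x)=0\}$. Then the Hausdorff dimension of $\mathrm{BA}_{M_Q}(\psi_1)$ equals the Hausdorff dimension of $M_Q$. In particular, $\psi_1$ is an optimal Dirichlet function for intrinsic approximation on $M_Q$.
   Context: $\mathbb P^d_{\mathbb R}$ is real projective space, $\mathbb P^d_{\mathbb Q}$ its rational points, $\mathrm{dist}$ a fixed Riemannian metric on it, $H_{\mathrm{std}}([\mathbf p])=\|\mathbf p\|_\infty$ for $\mathbf p$ a primitive integer representative, $\psi_c(q)=q^{-c}$. $Q$ is nonsingular if its associated symmetric bilinear form is nondegenerate. $\mathrm{BA}_{M}(\psi)$ is the set of $[\mathbf x]\in M$ for which there is $\varepsilon>0$ with $\mathrm{dist}([\mathbf r],[\mathbf x])\ge\varepsilon\psi(H_{\mathrm{std}}([\mathbf r]))$ for all $[\mathbf r]\in\mathbb P^d_{\mathbb Q}\cap M$. A function $\psi$ is Dirichlet for intrinsic approximation on $M$ if for every $[\mathbf x]\in M$ there are $C_{[\mathbf x]}>0$ and $[\mathbf r_n]\in\mathbb P^d_{\mathbb Q}\cap M$, $[\mathbf r_n]\to[\mathbf x]$, with $\mathrm{dist}([\mathbf r_n],[\mathbf x])\le C_{[\mathbf x]}\psi(H_{\mathrm{std}}([\mathbf r_n]))$; a Dirichlet function $\psi$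 is optimal if there is no Dirichlet function $\phi$ with $\phi(x)/\psi(x)\to0$ as $x\to\infty$. *)

(* Defs.v *)
From mathcomp Require Import all_boot all_order all_algebra.
From mathcomp Require Import all_classical all_reals all_analysis.

Set Implicit Arguments.
Unset Strict Implicit.
Unset Printing Implicit Defensive.

Import Order.TTheory GRing.Theory Num.Theory.
Import numFieldNormedType.Exports.

Local Open Scope classical_set_scope.
Local Open Scope ring_scope.

(* P^d_R, as the type of lines through the origin of R^(d+1); the point [x] is
   the line <[x]>%VS. *)
Record projective_space (R : realType) (d : nat) := ProjPoint {
  line :> {vspace 'rV[R]_d.+1};
  dim_line : \dim line == 1%N }.

(* x is a vector of homogeneous coordinates of p, i.e. p = [x]. *)
Definition homog (R : realType) (d : nat)
    (p : projective_space R d) (x : 'rV[R]_d.+1) :=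
  x != 0 /\ line p = <[x]>%VS.

Definition rational_points (R : realType) (d : nat) : set (projective_space R d) :=
  [set p | exists v : 'rV[rat]_d.+1, homog p (map_mx ratr v)].

Definition primitive_vec (d : nat) (v : 'rV[int]_d.+1) :=
  (\big[gcdn/0%N]_(i < d.+1) `|v 0%R i|%N == 1%N).

(* On real row vectors `|_| is the sup norm.  A rational point has exactly two
   primitive representatives, v and - v, hence a single value h; the height of
   an irrational point is the junk value 0. *)
Definition Hstd (R : realType) (d : nat) (p : projective_space R d) : R :=
  xget 0 [set h | exists v : 'rV[int]_d.+1,
    [/\ primitive_vec v, homog p (map_mx intr v) &
        h = `|map_mx intr v : 'rV[R]_d.+1| ] ].

Definition psi_ (R : realType) (c : R) : R -> R := fun q => q `^ (- c).

Section QuadraticForms.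
Context {R : realType} {d : nat}.
Implicit Types Q : 'rV[R]_d.+1 -> R.

Definition integral_quadratic_form Q :=
  exists a : 'M[int]_d.+1, forall x,
    Q x = \sum_(i < d.+1) \sum_(j < d.+1 | (i <= j)%N)
      (a i j)%:~R * x 0 i * x 0 j.

Definition polar_form Q (x y : 'rV[R]_d.+1) : R := (Q (x + y) - Q x - Q y) / 2.

Definition nonsingular Q :=
  forall x, (forall y, polar_form Q x y = 0) -> x = 0.

Definition quadric Q : set (projective_space R d) :=
  [set p | exists2 x, homog p x & Q x = 0].

End QuadraticForms.

Section RiemannianDistance.
Context {R : realType} {d : nat}.
Notation V := 'rV[R]_d.+1.

(* f is of class C^k on the open set U. *)
Fixpoint Cn (k : nat) (U : set V) (f : V -> R) : Prop :=
  if k is k'.+1 then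
    (forall x, U x -> differentiable f x) /\
    (forall v, Cn k' U (fun x => 'D_v f x))
  else forall x, U x -> {for x, continuous f}.

Definition smooth_on (U : set V) (f : V -> R) := forall k, Cn k U f.

(* Riemannian metrics on P^d_R are described by their pullbacks along the
   submersion pi : x |-> [x] from R^(d+1) \ {0}.  The kernel of d(pi)_x is the
   line R x, and pi (a x) = pi x gives d(pi)_(a x) (a u) = d(pi)_x u.  So the
   pullbacks are the smooth fields g of symmetric positive semidefinite forms
   on R^(d+1) \ {0} with g_x of kernel R x and g_(a x)(a u, a v) = g_x(u, v). *)
Definition mxform (G : 'M[R]_d.+1) (u v : V) : R := (u *m G *m v^T) 0 0.

Record riemannian_metric (g : V -> 'M[R]_d.+1) : Prop := RiemannianMetric {
  rmetric_smooth : forall i j, smooth_on [set x | x != 0] (fun x => g x i j);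
  rmetric_sym : forall x, x != 0 ->
    forall u v, mxform (g x) u v = mxform (g x) v u;
  rmetric_vert : forall x, x != 0 -> forall v, mxform (g x) x v = 0;
  rmetric_pos : forall x, x != 0 ->
    forall u, u \notin <[x]>%VS -> 0 < mxform (g x) u u;
  rmetric_homog : forall (a : R) x, a != 0 -> x != 0 ->
    forall u v, mxform (g (a *: x)) (a *: u) (a *: v) = mxform (g x) u v }.

(* C^1 arcs [0, 1] -> P^d_R, given by a lift to R^(d+1) \ {0} extended to a C^1
   map on R; only the values on [0, 1] matter. *)
Definition C1_arc (c : R -> V) :=
  [/\ forall t, derivable c t 1, continuous (derive1 c) &
      forall t, t \in `[0, 1] -> c t != 0].

Definition arc_length (g : V -> 'M[R]_d.+1) (c : R -> V) : R :=
  \int[lebesgue_measure]_(t in `[0, 1])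
    Num.sqrt (mxform (g (c t)) (derive1 c t) (derive1 c t)).

(* cs is a piecewise C^1 curve from p to q: the arcs of cs are joined end to
   end in P^d_R (the lifts of successive arcs need not agree). *)
Fixpoint pw_C1_curve (p : projective_space R d) (cs : seq (R -> V))
    (q : projective_space R d) : Prop :=
  if cs is c :: cs' then
    [/\ C1_arc c, homog p (c 0) &
        exists2 r, homog r (c 1) & pw_C1_curve r cs' q]
  else p = q.

Definition riemannian_dist (g : V -> 'M[R]_d.+1) (p q : projective_space R d) : R :=
  inf [set \sum_(c <- cs) arc_length g c | cs in [set cs | pw_C1_curve p cs q]].

End RiemannianDistance.

Section HausdorffDimension.
Context {R : realType} {X : Type}.
Variable dist : X -> X -> R.
Local Open Scope ereal_scope.

Definition diam (A : set X) : \bar R :=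
  ereal_sup [set (dist z.1 z.2)%:E | z in A `*` A].

Definition diam_pow (s : R) (A : set X) : \bar R :=
  if pselect (A = set0) then 0 else diam A `^ s.

Definition hausdorff_premeasure (s delta : R) (A : set X) : \bar R :=
  ereal_inf [set \sum_(0 <= k <oo) diam_pow s (U k) | U in
    [set U : nat -> set X |
      A `<=` \bigcup_k U k /\ forall k, diam (U k) <= delta%:E]].

Definition hausdorff_measure (s : R) (A : set X) : \bar R :=
  ereal_sup [set hausdorff_premeasure s delta A | delta in
    [set delta | (0 < delta)%R]].

Definition hausdorff_dim (A : set X) : \bar R :=
  ereal_inf [set s%:E | s in
    [set s | (0 <= s)%R /\ hausdorff_measure s A = 0]].

End HausdorffDimension.

Section IntrinsicApproximation.
Context {R : realType} {d : nat}.
Variables (dist : projective_space R d -> projective_space R d -> R)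
  (M : set (projective_space R d)).

Definition BA (psi : R -> R) : set (projective_space R d) :=
  [set x | M x /\ exists2 e : R, 0 < e &
    forall r, (@rational_points R d `&` M) r -> e * psi (Hstd r) <= dist r x].

Definition dirichlet (psi : R -> R) :=
  forall x, M x -> exists2 C : R, 0 < C &
    exists r : nat -> projective_space R d,
      [/\ forall n, (@rational_points R d `&` M) (r n),
          (fun n => dist (r n) x) @ \oo --> (0 : R) &
          forall n, dist (r n) x <= C * psi (Hstd (r n))].

Definition optimal_dirichlet (psi : R -> R) :=
  dirichlet psi /\
  ~ exists2 phi : R -> R, dirichlet phi &
      phi t / psi t @[t --> +oo] --> (0 : R).

End IntrinsicApproximation.

(* Main.v *)
(* Let b be the polar form of Q.  The Riemannian distance is comparable with the angular one, so for an integer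
   vector v representing r, dist(r, [x]) H(r) is comparable with the distance from v to the line R x.

   Dirichlet property.  Isotropic integer vectors must be found at bounded distance from R x, arbitrarily far out.
   For g in O(Q) either g Z^n contains a vector so short that integrality of b makes it isotropic, or, by Hermite
   reduction, it has a bounded basis; there are then finitely many Gram matrices, each with an isotropic integer
   vector.  Apply this to the one-parameter group contracting x.  If a rational isotropic e is orthogonal to x,
   pass to the quadratic space e^perp / e, by induction on the dimension.

   Dimension.  In a stereographic chart, the rational points relevant at one scale near one small cube are
   pairwise orthogonal, because |b(v, v')| < 1, and lie on a hyperplane.  Removing a neighbourhood of it at every
   scale leaves a Cantor set of badly approximable points whose dimension tends to dim M_Q as the subdivision gets
   finer.  In particular a badly approximable point exists, and it contradicts any better Dirichlet function. *)
Require Import Defs.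
From mathcomp Require Import all_boot all_order all_algebra.
From mathcomp Require Import all_classical all_reals all_analysis.
From mathcomp Require Import ring lra zify.
Import Order.TTheory GRing.Theory Num.Theory.
Import numFieldNormedType.Exports.
Local Open Scope classical_set_scope.
Local Open Scope ring_scope.

Set Implicit Arguments.
Unset Strict Implicit.
Unset Printing Implicit Defensive.

(** * Sup norm and bilinear forms *)

(** Exponent: if u and u' are at distance N^-n, isotropic vectors near a x(u) and a' x(u') have a
    pairing of order a a' N^-2n, because b(x(u), x(u')) is quadratic in u - u'. So integrality
    controls on cubes of side N^-n exactly the sizes a of order N^n; each size belongs to one level,
    and one hyperplane per cube is enough. Obstacle: a bounded isotropic vector exists at every time
    of the flow, but it can be the same integer vector at all times if it is orthogonal to x. This
    forces the passage to e^perp / e. That quotient may have no rational isotropic vector although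
    it contains the real isotropic image of x, and then the induction has nothing to start from; in
    that case the integer vectors are built directly from a bounded basis of the flowed lattice.
    Counting: no measure is put on the Cantor set. A cover of small total diam^s turns into bad
    nodes of a regular tree whose expected number along a random descent is below 1, so some branch
    avoids them all. *)

Section SupNorm.
Context {R : realType}.

Lemma mx_coord_le m n (x : 'M[R]_(m, n)) i j : `|x i j| <= `|x|.
Proof.
by rewrite [leRHS]/Num.norm /= mx_normrE; apply: (le_bigmax _ (fun ij => `|x ij.1 ij.2|) (i, j)).
Qed.

Lemma mx_norm_le m n (x : 'M[R]_(m, n)) (c : R) : 0 <= c ->
  (forall i j, `|x i j| <= c) -> `|x| <= c.
Proof.
move=> c0 h; rewrite [leLHS]/Num.norm /= mx_normrE.
by apply/bigmax_leP; split => // -[i j] _ /=.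
Qed.

Lemma mulmx_norm_le m n p (x : 'M[R]_(m, n)) (A : 'M[R]_(n, p)) :
  `|x *m A| <= n%:R * `|x| * `|A|.
Proof.
apply: mx_norm_le => [|i j]; first by rewrite !mulr_ge0.
rewrite mxE (le_trans (ler_norm_sum _ _ _))//.
rewrite (@le_trans _ _ (\sum_(k < n) `|x| * `|A|))//; last first.
  by rewrite sumr_const card_ord -mulrA mulr_natl.
by apply: ler_sum => k _; rewrite normrM ler_pM// mx_coord_le.
Qed.

Lemma trmx_norm m n (x : 'M[R]_(m, n)) : `|x^T| = `|x|.
Proof.
apply/le_anti/andP; split; apply: mx_norm_le => // i j.
  by rewrite mxE mx_coord_le.
by have := mx_coord_le x^T j i; rewrite mxE.
Qed.

Lemma mx11_norm (x : 'M[R]_1) : `|x 0 0| = `|x|.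
Proof.
apply/le_anti/andP; split; first exact: mx_coord_le.
by apply: mx_norm_le => // i j; rewrite !ord1.
Qed.

End SupNorm.

Section BilinearForm.
Context {F : comNzRingType} {n : nat}.
Implicit Types (S : 'M[F]_n) (x y z : 'rV[F]_n).

(** Over a commutative ring, because Gram matrices over the integers, the rationals and the reals
    all occur. *)
Definition bform S x y : F := (x *m S *m y^T) 0 0.

Lemma bformDl S x y z : bform S (x + y) z = bform S x z + bform S y z.
Proof. by rewrite /bform !mulmxDl mxE. Qed.

Lemma bformDr S x y z : bform S x (y + z) = bform S x y + bform S x z.
Proof. by rewrite /bform linearD /= mulmxDr mxE. Qed.

Lemma bformZl S a x y : bform S (a *: x) y = a * bform S x y.
Proof. by rewrite /bform -!scalemxAl mxE. Qed.

Lemma bformZr S a x y : bform S x (a *: y) = a * bform S x y.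
Proof. by rewrite /bform linearZ /= -scalemxAr mxE. Qed.

Lemma bformNl S x y : bform S (- x) y = - bform S x y.
Proof. by rewrite -scaleN1r bformZl mulN1r. Qed.

Lemma bformNr S x y : bform S x (- y) = - bform S x y.
Proof. by rewrite -scaleN1r bformZr mulN1r. Qed.

Lemma bform0l S x : bform S 0 x = 0.
Proof. by rewrite /bform !mul0mx mxE. Qed.

Lemma bform0r S x : bform S x 0 = 0.
Proof. by rewrite /bform trmx0 mulmx0 mxE. Qed.

Lemma bformC S x y : S^T = S -> bform S x y = bform S y x.
Proof.
move=> sS; rewrite /bform -[LHS]mulr1.
have -> : x *m S *m y^T = (y *m S *m x^T)^T by rewrite !trmx_mul trmxK sS mulmxA.
by rewrite mxE mulr1.
Qed.

Definition bformE := (bformDl, bformDr, bformZl, bformZr, bformNl, bformNr).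

Lemma bform_sum S x y :
  bform S x y = \sum_i \sum_j x 0 i * S i j * y 0 j.
Proof.
rewrite /bform -mulmxA mxE; apply: eq_bigr => i _; rewrite mxE big_distrr /=.
by apply: eq_bigr => j _; rewrite mxE mulrA.
Qed.

Lemma bform_mulmx m S (A : 'M[F]_(m, n)) (u v : 'rV[F]_m) :
  bform S (u *m A) (v *m A) = (u *m (A *m S *m A^T) *m v^T) 0 0.
Proof. by rewrite /bform trmx_mul !mulmxA. Qed.

Lemma bform_row m S (A : 'M[F]_(m, n)) i j :
  bform S (row i A) (row j A) = (A *m S *m A^T) i j.
Proof. by rewrite !rowE bform_mulmx -rowE trmx_delta -colE !mxE. Qed.

Lemma bform_nondeg S : (forall x y, bform S x y = 0) -> S = 0.
Proof.
move=> h; apply/matrixP => i j; have := h (delta_mx 0 i) (delta_mx 0 j).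
by rewrite /bform -rowE trmx_delta -colE !mxE.
Qed.

End BilinearForm.

Lemma bform_norm (R : realType) n (S : 'M[R]_n) (x y : 'rV[R]_n) :
  `|bform S x y| <= n%:R ^+ 2 * `|S| * `|x| * `|y|.
Proof.
rewrite mx11_norm (le_trans (mulmx_norm_le _ _))// trmx_norm ler_wpM2r//.
have -> : n%:R ^+ 2 * `|S| * `|x| = n%:R * (n%:R * `|x| * `|S|) by ring.
by rewrite ler_wpM2l// mulmx_norm_le.
Qed.

(** * The Riemannian distance on projective space *)

Section Dot.
Context {R : realType} {n : nat}.
Implicit Types x y : 'rV[R]_n.

(** Serves to pick a complement of R x: the lifted metric is degenerate along x, so a lower bound
    can hold only for vectors transverse to x. *)
Definition dot x y : R := \sum_i x 0 i * y 0 i.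

Lemma dotC x y : dot x y = dot y x.
Proof. by apply: eq_bigr => i _; rewrite mulrC. Qed.

Lemma dotDl x y z : dot (x + y) z = dot x z + dot y z.
Proof. by rewrite /dot -big_split; apply: eq_bigr => i _; rewrite mxE mulrDl. Qed.

Lemma dotZl a x y : dot (a *: x) y = a * dot x y.
Proof. by rewrite /dot mulr_sumr; apply: eq_bigr => i _; rewrite mxE mulrA. Qed.

Lemma dot_norm_ge x : `|x| ^+ 2 <= dot x x.
Proof.
have x0 i : 0 <= x 0 i * x 0 i by rewrite -expr2 sqr_ge0.
rewrite -ler_sqrt ?sumr_ge0// sqrtr_sqr ger0_norm//.
apply: mx_norm_le => [|i j]; first exact: sqrtr_ge0.
rewrite ord1 -sqrtr_sqr ler_sqrt ?sumr_ge0// /dot (bigD1 j)//= expr2.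
by rewrite lerDl sumr_ge0.
Qed.

Lemma dot_gt0 x : x != 0 -> 0 < dot x x.
Proof.
by move=> x0; rewrite (lt_le_trans _ (dot_norm_ge x))// exprn_gt0// normr_gt0.
Qed.

End Dot.

Lemma continuous_sum (R : realType) (T : topologicalType) (I : finType)
    (f : I -> T -> R) (x : T) :
  (forall i, {for x, continuous (f i)}) ->
  {for x, continuous (fun y => \sum_i f i y)}.
Proof.
move=> h; suff H s : (\sum_(i <- s) f i y) @[y --> x] --> \sum_(i <- s) f i x.
  exact: H.
elim: s => [|i s ih].
  by rewrite big_nil; under eq_fun do rewrite big_nil; exact: cvg_cst.
by rewrite big_cons; under eq_fun do rewrite big_cons; apply: cvgD => //; exact: h.
Qed.

Section RiemannianMetric.
Context {R : realType} {d : nat} {g : 'rV[R]_d.+1 -> 'M[R]_d.+1}.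
Hypothesis hg : riemannian_metric g.
Local Notation V := 'rV[R]_d.+1.
Local Notation gq x u := (mxform (g x) u u).

Lemma mxform_sum (G : 'M[R]_d.+1) (u v : V) :
  mxform G u v = \sum_i \sum_j u 0 i * G i j * v 0 j.
Proof. exact: bform_sum. Qed.

Lemma metric_continuous i j x : x != 0 -> {for x, continuous (fun y => g y i j)}.
Proof. by move=> x0; have := rmetric_smooth hg i j 0%N x x0. Qed.

(** Homogeneity allows only a common factor; with bilinearity the two factors separate, which
    reduces all bounds to unit vectors. *)
Lemma metric_scale x u a b : a != 0 -> x != 0 ->
  gq (a *: x) (b *: u) = (b / a) ^+ 2 * gq x u.
Proof.
move=> a0 x0; have -> : b *: u = a *: ((b / a) *: u).
  by rewrite scalerA mulrC divfK.
by rewrite (rmetric_homog hg)// /mxform -!/(bform _ _ _) !bformE; ring.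
Qed.

Lemma metric_vert x u b : x != 0 -> gq x (u + b *: x) = gq x u.
Proof.
move=> x0; rewrite /mxform -!/(bform _ _ _) !bformE.
have h v : bform (g x) x v = 0 by apply: (rmetric_vert hg).
have h' v : bform (g x) v x = 0 by rewrite -(h v); apply: (rmetric_sym hg).
by rewrite !h !h'; ring.
Qed.

Lemma metric_ge0 x u : x != 0 -> 0 <= gq x u.
Proof.
move=> x0; have [/vlineP[k ->]|] := boolP (u \in <[x]>%VS).
  by rewrite /mxform -/(bform _ _ _) bformE [bform _ _ _](rmetric_vert hg)// mulr0.
by move=> /(rmetric_pos hg x0)/ltW.
Qed.

Lemma gq_continuous (x u : V) : x != 0 ->
  {for (x, u), continuous (fun z : V * V => gq z.1 z.2)}.
Proof.
move=> x0.
rewrite (_ : (fun z : V * V => _) = fun z : V * V => \sum_i \sum_j z.2 0 i * g z.1 i j * z.2 0 j); last first.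
  by apply/funext => z; rewrite mxform_sum.
have c2 i : {for (x, u), continuous (fun z : V * V => z.2 0 i)}.
  apply: (@continuous_comp _ _ _ snd (fun y : V => y 0 i)); last exact: coord_continuous.
  exact: cvg_snd.
apply: (@continuous_sum R (V * V)%type 'I_d.+1 (fun i z => \sum_j z.2 0 i * g z.1 i j * z.2 0 j)) => i.
apply: (@continuous_sum R (V * V)%type 'I_d.+1 (fun j z => z.2 0 i * g z.1 i j * z.2 0 j)) => j.
have c1 : {for (x, u), continuous (fun z : V * V => g z.1 i j)}.
  apply: (@continuous_comp _ _ _ fst (fun y : V => g y i j)); last exact: metric_continuous.
  exact: cvg_fst.
exact: cvgM (cvgM (c2 i) c1) (c2 j).
Qed.

Lemma compact_sphere : compact [set x : V | `|x| = 1].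
Proof.
apply: bounded_closed_compact.
  exists 1; split => // y y1 x /= ->; exact: ltW.
rewrite (_ : [set _ | _] = (fun x : V => `|x|) @^-1` [set 1])//.
apply: preimage_closed; last exact: closed_eq.
by move=> x _; exact: norm_continuous.
Qed.

Lemma metric_upper : exists2 C, 0 < C &
  forall x u, x != 0 -> gq x u <= (C * `|u| / `|x|) ^+ 2.
Proof.
pose h (x : V) := \sum_i \sum_j `|g x i j|.
have ch x : x != 0 -> {for x, continuous h}.
  move=> x0.
  apply: continuous_sum => i; apply: continuous_sum => j.
  apply: (@continuous_comp _ _ _ (fun y => g y i j) (fun a : R => `|a|)).
    exact: metric_continuous.
  exact: norm_continuous.
have [x0 _ hx0] : exists2 x0, x0 \in [set x : V | `|x| = 1] &
    forall x, x \in [set x : V | `|x| = 1] -> h x <= h x0.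
  apply: EVT_max_rV; last 1 first.
  - apply: continuous_in_subspaceT => x; rewrite inE /= => x1; apply: ch.
    by rewrite -normr_gt0 x1.
  - exists (const_mx 1); rewrite /=; apply/le_anti/andP; split.
      by apply: mx_norm_le => // i j; rewrite mxE normr1.
    by rewrite (le_trans _ (mx_coord_le _ 0 0))// mxE normr1.
  - exact: compact_sphere.
have H0 x : 0 <= h x by apply: sumr_ge0 => i _; apply: sumr_ge0.
(* Adding 1 gives C >= 1, hence C <= C^2: the bound is stated with C squared. *)
pose C := h x0 + 1; have C1 : 1 <= C by rewrite lerDr.
exists C; first exact: lt_le_trans C1.
move=> x u x_neq0; have nx : 0 < `|x| by rewrite normr_gt0.
have -> : x = `|x| *: (`|x|^-1 *: x) by rewrite scalerA divff ?gt_eqF// scale1r.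
have x1 : `|(`|x|^-1 *: x)| = 1.
  by rewrite normrZ normfV normr_id mulVf// gt_eqF.
set y := _ *: x in x1 *; have y0 : y != 0 by rewrite -normr_gt0 x1.
rewrite -[u in gq _ u]scale1r metric_scale ?gt_eqF// normrZ x1 normr_id mulr1 div1r.
rewrite -mulrA [leRHS]exprMn exprMn mulrC mulrA ler_wpM2r ?sqr_ge0//.
rewrite mxform_sum (le_trans (ler_norm _))//.
apply: (@le_trans _ _ (h y * `|u| ^+ 2)).
  rewrite mulr_suml (le_trans (ler_norm_sum _ _ _))// ler_sum// => i _.
  rewrite mulr_suml (le_trans (ler_norm_sum _ _ _))// ler_sum// => j _.
  by rewrite !normrM mulrC mulrA expr2 [leRHS]mulrC ler_wpM2r// ler_pM// mx_coord_le.
rewrite ler_wpM2r ?sqr_ge0//; apply: (@le_trans _ _ C).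
  by rewrite (le_trans (hx0 _ _)) ?inE//= lerDl.
by rewrite expr2 ler_peMr// (le_trans _ C1).
Qed.

(** Compactness of the pairs of orthogonal unit vectors, on which the form is positive because such
    a u is not a multiple of x. *)
Lemma metric_lower : exists2 C, 0 < C &
  forall x u, x != 0 -> dot x u = 0 -> (`|u| / `|x|) ^+ 2 <= C ^+ 2 * gq x u.
Proof.
pose K := [set z : V * V | (`|z.1| = 1 /\ `|z.2| = 1) /\ dot z.1 z.2 = 0].
have cK : compact K.
  rewrite (_ : K = ([set x : V | `|x| = 1] `*` [set x : V | `|x| = 1]) `&`
    (fun z : V * V => dot z.1 z.2) @^-1` [set 0])//.
  apply: compact_closedI; first by apply: compact_setX; exact: compact_sphere.
  apply: preimage_closed; last exact: closed_eq.
  move=> [x u] _.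
  apply: (@continuous_sum R (V * V)%type 'I_d.+1 (fun i z => z.1 0 i * z.2 0 i)) => i.
  apply: cvgM.
    apply: (@continuous_comp _ _ _ fst (fun y : V => y 0 i)); last exact: coord_continuous.
    exact: cvg_fst.
  apply: (@continuous_comp _ _ _ snd (fun y : V => y 0 i)); last exact: coord_continuous.
  exact: cvg_snd.
have [c c0 hc] : exists2 c, 0 < c & forall z, K z -> c <= gq z.1 z.2.
  (* For d = 0 there are no orthogonal unit vectors and no minimum to take. *)
  have [K0|/set0P[z0 Kz0]] := eqVneq K set0; first by exists 1 => // z; rewrite K0.
  have [z1 Kz1 h] : exists2 c, c \in K & forall t, t \in K -> gq c.1 c.2 <= gq t.1 t.2.
    apply: compact_EVT_min => //.
      by exists z0.
    apply: continuous_in_subspaceT => -[x u]; rewrite inE => -[[/= x1 _] _].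
    by apply: gq_continuous; rewrite -normr_gt0 x1.
  exists (gq z1.1 z1.2); last by move=> z Kz; apply: h; rewrite inE.
  move: Kz1; rewrite inE => -[[x1 u1] xu].
  have x0 : z1.1 != 0 by rewrite -normr_gt0 x1.
  apply: (rmetric_pos hg) => //; apply/negP => /vlineP[k uk].
  move: xu; rewrite uk dotC dotZl => /eqP; rewrite mulf_eq0 (gt_eqF (dot_gt0 x0)) orbF.
  by move=> /eqP k0; move: u1; rewrite uk k0 scale0r normr0 => /eqP; rewrite eq_sym oner_eq0.
exists (Num.sqrt c)^-1; first by rewrite invr_gt0 sqrtr_gt0.
move=> x u x0 xu; rewrite exprVn sqr_sqrtr ?(ltW c0)// ler_pdivlMl//.
have [->|u0] := eqVneq u 0; first by rewrite normr0 mul0r expr0n mulr0 metric_ge0.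
have nx : 0 < `|x| by rewrite normr_gt0.
have nu : 0 < `|u| by rewrite normr_gt0.
have := hc (`|x|^-1 *: x, `|u|^-1 *: u); rewrite /= metric_scale ?invr_eq0 ?gt_eqF//.
have -> : `|u|^-1 / `|x|^-1 = (`|u| / `|x|)^-1 by rewrite invfM.
rewrite exprVn ler_pdivlMl ?exprn_gt0 ?divr_gt0// mulrC; apply.
rewrite /K /= !normrZ !normfV !normr_id !mulVf ?gt_eqF//; split => //.
by rewrite dotZl dotC dotZl dotC xu !mulr0.
Qed.

Definition proj_entry (i j : 'I_d.+1) (x : V) : R := x 0 i * x 0 j / dot x x.

Definition dproj_entry (i j : 'I_d.+1) (x u : V) : R :=
  (u 0 i * x 0 j + x 0 i * u 0 j) / dot x x
  - x 0 i * x 0 j * (2 * dot x u) / dot x x ^+ 2.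

(** The differential of a scale invariant function kills the direction x, and so does the metric; u
    may therefore be replaced by its part w orthogonal to x, where [metric_lower] applies. *)
Lemma dproj_entry_le : exists2 C, 0 < C &
  forall i j x u, x != 0 -> `|dproj_entry i j x u| <= C * Num.sqrt (gq x u).
Proof.
have [C C0 hC] := metric_lower; exists (2 * C); first by rewrite mulr_gt0.
move=> i j x u x0; have xx := dot_gt0 x0.
pose w := u - (dot x u / dot x x) *: x.
have uw : u = w + (dot x u / dot x x) *: x by rewrite subrK.
have xw : dot x w = 0.
  rewrite /w dotC dotDl -scaleNr dotZl mulNr divfK ?gt_eqF// dotC; ring.
have -> : dproj_entry i j x u = (w 0 i * x 0 j + x 0 i * w 0 j) / dot x x.
  rewrite /dproj_entry /w !mxE; field; exact: lt0r_neq0.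
have nx : 0 < `|x| by rewrite normr_gt0.
have h1 : `|w| / `|x| <= C * Num.sqrt (gq x u).
  rewrite -(ger0_norm (divr_ge0 (normr_ge0 w) (normr_ge0 x))) -sqrtr_sqr.
  rewrite -(ger0_norm (ltW C0)) -sqrtr_sqr -sqrtrM ?sqr_ge0// ler_wsqrtr//.
  by rewrite uw metric_vert//; exact: hC.
apply: (@le_trans _ _ (2 * (`|w| / `|x|))); last by rewrite -mulrA ler_wpM2l.
rewrite normrM normfV (gtr0_norm xx) ler_pdivrMr//.
have := dot_norm_ge x; set D := dot x x => hD.
apply: (@le_trans _ _ (2 * (`|w| / `|x|) * `|x| ^+ 2)); last first.
  by rewrite ler_wpM2l// mulr_ge0// divr_ge0.
rewrite (le_trans (ler_normD _ _))// !normrM.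
have -> : 2 * (`|w| / `|x|) * `|x| ^+ 2 = `|w| * `|x| + `|x| * `|w|.
  by field; exact: lt0r_neq0.
by apply: lerD; apply: ler_pM => //; exact: mx_coord_le.
Qed.

Lemma is_derive_coord (c : R -> V) (t : R) i : derivable c t 1 ->
  is_derive t 1 (fun s => c s 0 i) (derive1 c t 0 i).
Proof.
move=> dc; have /derivable_mxP/(_ 0 i) h := dc.
by apply: DeriveDef => //; rewrite derive1E derive_mx// mxE.
Qed.

Lemma is_derive_dot (c : R -> V) (t : R) : derivable c t 1 ->
  is_derive t 1 (fun s => dot (c s) (c s)) (2 * dot (c t) (derive1 c t)).
Proof.
move=> dc; rewrite (_ : (fun s => _) = \sum_i ((fun s => c s 0 i) * (fun s => c s 0 i))); last first.
  by apply/funext => s; rewrite fct_sumE.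
apply: is_derive_eq.
  apply: is_derive_sum => i; apply: is_deriveM; exact: is_derive_coord.
by rewrite /dot mulr_sumr; apply: eq_bigr => i _; rewrite /GRing.scale /=; ring.
Qed.

Lemma is_derive_proj i j (c : R -> V) (t : R) : derivable c t 1 -> c t != 0 ->
  is_derive t 1 (fun s => proj_entry i j (c s)) (dproj_entry i j (c t) (derive1 c t)).
Proof.
move=> dc ct0; have cc := dot_gt0 ct0.
apply: is_derive_eq.
  apply: is_deriveM; first by apply: is_deriveM; exact: is_derive_coord.
  apply: is_deriveV; first by rewrite gt_eqF.
  exact: is_derive_dot.
rewrite /dproj_entry /GRing.scale /=; field; exact: lt0r_neq0.
Qed.

Lemma C1_arc_continuous (c : R -> V) t : C1_arc c -> {for t, continuous c}.
Proof.
by move=> [dc _ _]; apply: differentiable_continuous; apply/derivable1_diffP.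
Qed.

Lemma speed_continuous (c : R -> V) t : C1_arc c -> t \in `[0, 1] ->
  {for t, continuous (fun t => Num.sqrt (gq (c t) (derive1 c t)))}.
Proof.
move=> hc t01; have [dc cc c0] := hc.
apply: (@continuous_comp _ _ _ (fun t => gq (c t) (derive1 c t)) (@Num.sqrt R)); last first.
  exact: sqrt_continuous.
apply: (@continuous_comp _ _ _ (fun t => (c t, derive1 c t)) (fun z : V * V => gq z.1 z.2)).
  exact: cvg_pair (C1_arc_continuous hc) (cc t).
by apply: gq_continuous => //; exact: c0.
Qed.

Lemma dproj_continuous (c : R -> V) t i j : C1_arc c -> t \in `[0, 1] ->
  {for t, continuous (fun t => dproj_entry i j (c t) (derive1 c t))}.
Proof.
move=> hc t01; have [dc cc c0] := hc.
have C k : {for t, continuous (fun t => c t 0 k)}.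
  apply: (@continuous_comp _ _ _ c (fun y : V => y 0 k)); last exact: coord_continuous.
  exact: C1_arc_continuous.
have C' k : {for t, continuous (fun t => derive1 c t 0 k)}.
  apply: (@continuous_comp _ _ _ (derive1 c) (fun y : V => y 0 k)); last exact: coord_continuous.
  exact: cc.
have D : {for t, continuous (fun t => dot (c t) (c t))}.
  apply: continuous_sum => k.  exact: cvgM (C k) (C k).
have D' : {for t, continuous (fun t => dot (c t) (derive1 c t))}.
  by apply: continuous_sum => k; exact: cvgM (C k) (C' k).
have cc0 : dot (c t) (c t) != 0 by rewrite gt_eqF// dot_gt0// c0.
have DV : {for t, continuous (fun t => (dot (c t) (c t))^-1)} by exact: cvgV cc0 D.
have D2V : {for t, continuous (fun t => (dot (c t) (c t) ^+ 2)^-1)}.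
  exact: cvgV (expf_neq0 2 cc0) (cvgM D D).
have F0 : {for t, continuous (fun t => derive1 c t 0 i * c t 0 j + c t 0 i * derive1 c t 0 j)}.
  exact: cvgD (cvgM (C' i) (C j)) (cvgM (C i) (C' j)).
have F1 : {for t, continuous (fun t => (derive1 c t 0 i * c t 0 j + c t 0 i * derive1 c t 0 j) / dot (c t) (c t))}.
  exact: cvgM F0 DV.
have F2 : {for t, continuous (fun t => 2 * dot (c t) (derive1 c t))}.
  exact: cvgMl_tmp D'.
have F3 : {for t, continuous (fun t => c t 0 i * c t 0 j * (2 * dot (c t) (derive1 c t)) / dot (c t) (c t) ^+ 2)}.
  exact: cvgM (cvgM (cvgM (C i) (C j)) F2) D2V.
exact: cvgB F1 F3.
Qed.

Lemma integrable_itv01 (f : R -> R) :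
  (forall t, t \in `[0, 1] -> {for t, continuous f}) ->
  (@lebesgue_measure R).-integrable `[0, 1] (EFin \o f).
Proof.
move=> cf; apply: continuous_compact_integrable; first exact: segment_compact.
by apply: continuous_in_subspaceT => t; rewrite inE; exact: cf.
Qed.

Lemma arc_length_ge0 (c : R -> V) : 0 <= arc_length g c.
Proof. by apply: Rintegral_ge0 => t _; exact: sqrtr_ge0. Qed.

(* The entries of the orthogonal projection onto the line of x are functions on projective space whose derivatives are bounded by the metric. *)
Lemma arc_length_ge : exists2 C, 0 < C & forall c i j, C1_arc c ->
  `|proj_entry i j (c 1) - proj_entry i j (c 0)| <= C * arc_length g c.
Proof.
have [C C0 hC] := dproj_entry_le; exists C => // c i j hc.
have [dc cc c0] := hc.
pose phi t := proj_entry i j (c t); pose psi t := dproj_entry i j (c t) (derive1 c t).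
have cpsi (t : R) : t \in `[0, 1] -> {for t, continuous psi} by exact: dproj_continuous.
have dphi (t : R) : t \in `[0, 1] -> is_derive t 1 phi (psi t).
  by move=> t01; apply: is_derive_proj; [exact: dc|exact: c0].
have cphi (t : R) : t \in `[0, 1] -> {for t, continuous phi}.
  move=> t01; apply: differentiable_continuous; apply/derivable1_diffP.
  by have [] := dphi t t01.
have -> : phi 1 - phi 0 = \int[lebesgue_measure]_(t in `[0, 1]) psi t.
  rewrite /Rintegral (@continuous_FTC2 _ _ phi)//.
  - by apply: continuous_in_subspaceT => t; rewrite inE; exact: cpsi.
  - split.
    + by move=> t /subset_itv_oo_cc/dphi[].
    + by apply: cvg_at_right_filter; apply: cphi; rewrite in_itv /= lexx ler01.
    + by apply: cvg_at_left_filter; apply: cphi; rewrite in_itv /= lexx ler01.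
  - by move=> t /subset_itv_oo_cc/dphi[_ <-]; rewrite derive1E.
apply: le_trans (le_normr_Rintegral _ _) _ => //; first exact: integrable_itv01.
rewrite /arc_length -RintegralZl//; last first.
  by apply: integrable_itv01 => t t01; exact: speed_continuous.
apply: le_Rintegral => //.
- apply: integrable_itv01 => t t01.
  apply: (@continuous_comp _ _ _ psi (fun a : R => `|a|)); first exact: cpsi.
  exact: norm_continuous.
- apply: integrable_itv01 => t t01.
  exact: cvgMl_tmp (speed_continuous hc t01).
- by move=> t t01; apply: hC; apply: c0.
Qed.

Lemma C1_arc_segment (x y : V) : (forall t : R, t \in `[0, 1] -> x + t *: (y - x) != 0) ->
  C1_arc (fun t : R => x + t *: (y - x)) /\ derive1 (fun t : R => x + t *: (y - x)) = cst (y - x).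
Proof.
move=> h0.
have D (t : R) : is_derive t 1 (fun t : R => x + t *: (y - x)) (y - x).
  have E : (h : R)^-1 *: ((x + (h *: 1 + t) *: (y - x)) - (x + t *: (y - x)))
      @[h --> 0^'] --> y - x.
    apply: cvg_near_cst; near=> h.
    have h0' : h != 0 by near: h; exact: nbhs_dnbhs_neq.
    rewrite scalerDl opprD addrACA subrr add0r addrK.
    rewrite [h *: 1](mulr1 h).
    by rewrite scalerA mulVf// scale1r.
  by apply: DeriveDef; [apply/cvg_ex; exists (y - x)|exact/cvg_lim].
have E : derive1 (fun t : R => x + t *: (y - x)) = cst (y - x).
  by apply/funext => t; rewrite derive1E; have [_ ->] := D t.
split; last exact: E.
split; last exact: h0.
  by move=> t; have [] := D t.
by rewrite E => z; exact: cvg_cst.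
Unshelve. all: by end_near.
Qed.

(** The bound by half the norm of x keeps the segment at norm at least |x| / 2, away from the
    singularity at 0; this costs the factor 2. *)
Lemma arc_length_segment : exists2 C, 0 < C & forall (x y : V), x != 0 ->
  `|y - x| <= `|x| / 2 ->
  C1_arc (fun t : R => x + t *: (y - x)) /\
  arc_length g (fun t : R => x + t *: (y - x)) <= C * `|y - x| / `|x|.
Proof.
have [C C0 hC] := metric_upper; exists (2 * C); first by rewrite mulr_gt0.
move=> x y x0 xy; have nx : 0 < `|x| by rewrite normr_gt0.
have ct (t : R) : t \in `[0, 1] -> `|x| / 2 <= `|x + t *: (y - x)|.
  rewrite in_itv /= => /andP[t0 t1].
  have := lerB_normD x (t *: (y - x)); rewrite normrZ ger0_norm//.
  have : t * `|y - x| <= `|y - x| by rewrite ler_piMl.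
  lra.
have ct0 (t : R) : t \in `[0, 1] -> x + t *: (y - x) != 0.
  by move=> /ct h; rewrite -normr_gt0 (lt_le_trans _ h)// divr_gt0.
have [hc E] := C1_arc_segment ct0; split => //.
rewrite /arc_length E.
apply: (@le_trans _ _ (\int[lebesgue_measure]_(t in `[0, 1]) (2 * C * `|y - x| / `|x|))).
  apply: le_Rintegral => //.
  - by apply: integrable_itv01 => t t01; have := speed_continuous hc t01; rewrite E.
  - by apply: integrable_itv01 => t t01; exact: cvg_cst.
  move=> t /= t01; rewrite -[leRHS]ger0_norm; last by rewrite !mulr_ge0// ?invr_ge0// ltW.
  rewrite -sqrtr_sqr ler_wsqrtr// (le_trans (hC _ _ (ct0 _ t01)))//.
  rewrite ler_sqr ?nnegrE; last 2 first.
  - by rewrite !mulr_ge0// ?invr_ge0// ltW.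
  - by rewrite !mulr_ge0// ?invr_ge0// ltW.
  have -> : 2 * C * `|y - x| / `|x| = C * `|y - x| / (`|x| / 2) by field; exact: lt0r_neq0.
  rewrite ler_wpM2l ?mulr_ge0 ?(ltW C0)// lef_pV2 ?posrE ?ct ?divr_gt0//.
  by rewrite normr_gt0 ct0.
rewrite Rintegral_cst//; have := lebesgue_measure_itv `[(0 : R), 1].
by rewrite /= lte_fin ltr01 oppr0 adde0 => ->; rewrite /= mulr1.
Qed.

End RiemannianMetric.

Section ProjectivePoints.
Context {R : realType} {d : nat}.
Local Notation V := 'rV[R]_d.+1.
Implicit Types (p q : projective_space R d) (x y : V).

Lemma homog_inj p x y : homog p x -> homog p y -> exists2 k : R, k != 0 & y = k *: x.
Proof.
move=> [x0 px] [y0 py]; have : y \in line p by rewrite py memv_line.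
rewrite px => /vlineP[k yk]; exists k => //.
by apply: contraNneq y0; rewrite yk => ->; rewrite scale0r.
Qed.

Lemma homog_scale p x (k : R) : k != 0 -> homog p x -> homog p (k *: x).
Proof.
move=> k0 [x0 px]; rewrite /homog px; split; first by rewrite scaler_eq0 negb_or k0.
apply/eqP; rewrite eqEsubv; apply/andP; split; last first.
  by rewrite -memvE memvZ// memv_line.
by rewrite -memvE -[x in x \in _](scalerK k0) memvZ// memv_line.
Qed.

Lemma homog_uniq p q x : homog p x -> homog q x -> p = q.
Proof.
case: p q => [l dl] [l' dl'] [_ /= e] [_ /= e'].
by move: dl dl'; rewrite e e' => dl dl'; congr ProjPoint; exact: bool_irrelevance.
Qed.

Lemma dim_line_vec x : x != 0 -> \dim <[x]>%VS == 1%N.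
Proof. by move=> x0; rewrite dim_vline x0. Qed.

Definition proj_point x (x0 : x != 0) : projective_space R d := ProjPoint (dim_line_vec x0).

Lemma homog_point x (x0 : x != 0) : homog (proj_point x0) x.
Proof. by []. Qed.

Lemma homog_ex p : exists x, homog p x.
Proof.
case: p => l dl; have l0 : l != 0%VS by rewrite -dimv_eq0 (eqP dl).
exists (vpick l); split; first by rewrite vpick0.
apply/eqP; rewrite eq_sym eqEdim /= (eqP dl) dim_vline vpick0 l0 leqnn andbT.
by rewrite -memvE memv_pick.
Qed.

End ProjectivePoints.

(** * Comparison of the Riemannian distance with the angular one *)

Section RiemannianDist.
Context {R : realType} {d : nat} {g : 'rV[R]_d.+1 -> 'M[R]_d.+1}.
Hypothesis hg : riemannian_metric g.
Local Notation V := 'rV[R]_d.+1.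
Local Notation rd := (riemannian_dist g).

Lemma proj_entryZ i j (k : R) (x : V) : k != 0 -> x != 0 ->
  proj_entry i j (k *: x) = proj_entry i j x.
Proof.
move=> k0 x0; rewrite /proj_entry dotZl dotC dotZl !mxE.
have := lt0r_neq0 (dot_gt0 x0) => ?; field; exact/andP.
Qed.

Lemma homog_proj_entry i j (p : projective_space R d) (x y : V) :
  homog p x -> homog p y -> proj_entry i j x = proj_entry i j y.
Proof.
by move=> px py; have [k k0 ->] := homog_inj px py; rewrite proj_entryZ//; case: px.
Qed.

Lemma length_ge0 (cs : seq (R -> V)) : 0 <= \sum_(c <- cs) arc_length g c.
Proof. by apply: sumr_ge0 => c _; exact: arc_length_ge0. Qed.

Lemma riemannian_dist_ge0 p q : 0 <= rd p q.
Proof.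
rewrite /riemannian_dist; set A := [set _ | _ in _].
have [->|/set0P A0] := eqVneq A set0; first by rewrite inf0.
by apply: lb_le_inf => // _ [cs _ <-]; exact: length_ge0.
Qed.

Lemma riemannian_dist_le p q cs : pw_C1_curve p cs q ->
  rd p q <= \sum_(c <- cs) arc_length g c.
Proof.
move=> h; apply: ge_inf; last by exists cs.
by exists 0 => _ [cs' _ <-]; exact: length_ge0.
Qed.

(** Keeps the infimum in the distance from being taken over the empty set, where [inf] is 0 and a
    lower bound on lengths would say nothing. *)
Lemma pw_C1_curve_ex (p q : projective_space R d) : exists cs, pw_C1_curve p cs q.
Proof.
have [x px] := homog_ex p; have [y qy] := homog_ex q.
have [/vlineP[k yk]|yx] := boolP (y \in <[x]>%VS).
  exists [::] => /=; apply: (@homog_uniq _ _ _ _ y) => //; rewrite yk; apply: homog_scale => //.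
  by case: qy => + _; apply: contraNneq => k0; rewrite yk k0 scale0r.
have h0 (t : R) : t \in `[0, 1] -> x + t *: (y - x) != 0.
  move=> _; have [->|t0] := eqVneq t 0; first by rewrite scale0r addr0; case: px.
  apply: contraNneq yx => h; apply/vlineP; exists (1 - t^-1).
  rewrite scalerBl scale1r.
  have : t *: y = t *: x - x.
    by apply/eqP; rewrite -subr_eq0 -h scalerBr opprB addrCA addrA [x + _]addrC.
  move=> /(congr1 (fun z => t^-1 *: z)); rewrite scalerBr !scalerA mulVf// !scale1r.
  by [].
have [hc _] := C1_arc_segment h0.
exists [:: fun t : R => x + t *: (y - x)]; split => //.
  by rewrite scale0r addr0.
by exists q => //=; rewrite scale1r subrKC.
Qed.

Lemma riemannian_dist_upper : exists2 C, 0 < C & forall p q x y,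
  homog p x -> homog q y -> `|y - x| <= `|x| / 2 -> rd p q <= C * `|y - x| / `|x|.
Proof.
have [C C0 hC] := arc_length_segment hg; exists C => // p q x y px qy xy.
have [hc hl] := hC x y (proj1 px) xy.
apply: le_trans hl.
have -> : arc_length g (fun t : R => x + t *: (y - x)) =
    \sum_(c <- [:: fun t : R => x + t *: (y - x)]) arc_length g c.
  by rewrite big_seq1.
apply: riemannian_dist_le; split => //.
  by rewrite scale0r addr0.
by exists q => //=; rewrite scale1r subrKC.
Qed.

(** The lifts of successive arcs may disagree at a joint, but [proj_entry] takes the same value
    there, so the differences telescope. *)
Lemma length_ge : exists2 C, 0 < C & forall cs p q x y i j,
  homog p x -> homog q y -> pw_C1_curve p cs q ->
  `|proj_entry i j y - proj_entry i j x| <= C * \sum_(c <- cs) arc_length g c.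
Proof.
have [C C0 hC] := arc_length_ge hg; exists C => //.
elim=> [|c cs ih] p q x y i j px qy /=.
  by move=> pq; subst q; rewrite big_nil mulr0 (homog_proj_entry i j px qy) subrr normr0.
move=> [hc pc0 [r rc1 hr]]; rewrite big_cons mulrDr.
rewrite (homog_proj_entry i j px pc0).
rewrite -(subrKA (proj_entry i j (c 1))) addrC (le_trans (ler_normD _ _))//.
by rewrite lerD ?hC// (ih r q).
Qed.

(** With P_x, P_y the orthogonal projections onto the two lines, x - P_y x = (P_x - P_y) x, and the
    entries of P_x - P_y are bounded by the distance. *)
Lemma riemannian_dist_lower : exists2 C, 0 < C & forall p q x y,
  homog p x -> homog q y -> exists a : R, `|x - a *: y| <= C * rd p q * `|x|.
Proof.
have [C C0 hC] := length_ge; exists (d.+1%:R * C); first by rewrite mulr_gt0.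
move=> p q x y px qy.
have H i j : `|proj_entry i j x - proj_entry i j y| <= C * rd p q.
  rewrite distrC -ler_pdivrMl//; apply: lb_le_inf.
    have [cs hcs] := pw_C1_curve_ex p q.
    by exists (\sum_(c <- cs) arc_length g c); exists cs.
  by move=> _ [cs hcs <-]; rewrite ler_pdivrMl//; exact: (hC cs p q x y).
have pe i (w z : V) : \sum_j w 0 j * proj_entry j i z = dot w z / dot z z * z 0 i.
  rewrite /dot !mulr_suml; apply: eq_bigr => j _; rewrite /proj_entry /dot; ring.
exists (dot x y / dot y y); apply: mx_norm_le => [|k i].
  by rewrite !mulr_ge0// ?riemannian_dist_ge0// ltW.
rewrite ord1 !mxE -(pe i x y).
have -> : x 0 i = \sum_j x 0 j * proj_entry j i x.
  by rewrite pe divff ?mul1r// lt0r_neq0// dot_gt0//; case: px.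
rewrite -sumrB (le_trans (ler_norm_sum _ _ _))//.
rewrite (@le_trans _ _ (\sum_(j < d.+1) `|x| * (C * rd p q)))//; last first.
  by rewrite sumr_const card_ord -mulr_natl; lra.
by apply: ler_sum => j _; rewrite -mulrBr normrM ler_pM// mx_coord_le.
Qed.

End RiemannianDist.

(** * Lattice reduction *)

Notation intmx := (map_mx (intr : int -> _)).

(** Finiteness as an enumeration by a [finType], over which minima and sums can be taken; [phi] may
    also have values outside the ball. *)
Lemma int_mx_finite (R : realType) m n (r : R) :
  exists (T : finType) (phi : T -> 'M[int]_(m, n)),
    forall v, `|intmx v : 'M[R]_(m, n)| <= r -> exists t, phi t = v.
Proof.
pose B := Num.bound r.
exists ('M['I_(B.*2.+1)]_(m, n)), (map_mx (fun k : 'I_(B.*2.+1) => (k : nat)%:Z - B%:Z)).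
move=> v hv; exists (\matrix_(i, j) inord (absz (v i j + B%:Z))).
apply/matrixP => i j; rewrite !mxE.
have h : (`|v i j| <= B%:Z)%R.
  rewrite -(ler_int R) intr_norm; have := mx_coord_le (intmx v : 'M[R]_(m, n)) i j.
  rewrite mxE => h; rewrite (le_trans h)// (le_trans hv)// ltW//.
  by rewrite archi_boundP// (le_trans _ hv).
rewrite inordK; lia.
Qed.

Lemma intr_lt1_eq0 (R : realType) (z : int) : `|z%:~R : R| < 1 -> z = 0.
Proof. by rewrite -intr_norm -[1]/(1%:~R) ltr_int => h; lia. Qed.

Lemma int_mx_neq0 (R : numDomainType) m n (v : 'M[int]_(m, n)) :
  (intmx v == 0 :> 'M[R]_(m, n)) = (v == 0).
Proof.
apply/eqP/eqP => [/matrixP h|->]; last by rewrite raddf0.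
by apply/matrixP => i j; have /eqP := h i j; rewrite !mxE intr_eq0 => /eqP.
Qed.

Section Hermite.
Context {R : realType}.

(** Positive definiteness with an explicit constant, which makes the set of integer vectors of
    bounded value finite. *)
Definition coercive n (P : 'M[R]_n) :=
  exists2 c : R, 0 < c & forall z, c * `|z| ^+ 2 <= bform P z z.

Lemma coercive_congr n (P g : 'M[R]_n) : g \in unitmx -> coercive P ->
  coercive (g *m P *m g^T).
Proof.
move=> ug [c c0 hc]; pose k : R := 1 + n%:R * `|invmx g|.
have k0 : 0 < k by rewrite ltr_pwDl// mulr_ge0.
exists (c / k ^+ 2) => [|z]; first by rewrite divr_gt0// exprn_gt0.
rewrite [leRHS]/bform -bform_mulmx mulrAC ler_pdivrMr ?exprn_gt0//.
have := mulmx_norm_le (z *m g) (invmx g); rewrite mulmxK// => h.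
have {}h : `|z| <= `|z *m g| * k.
  by rewrite (le_trans h)// mulrAC mulrC ler_wpM2l// /k lerDr.
apply: (@le_trans _ _ (c * (`|z *m g| * k) ^+ 2)).
  by rewrite ler_wpM2l ?(ltW c0)// lerXn2r ?nnegrE ?mulr_ge0 ?(ltW k0).
by rewrite exprMn mulrA ler_wpM2r ?sqr_ge0.
Qed.

Lemma bform1 n (z : 'rV[R]_n) : `|z| ^+ 2 <= bform 1%:M z z <= n%:R * `|z| ^+ 2.
Proof.
have E : bform 1%:M z z = \sum_i z 0 i ^+ 2.
  by rewrite /bform mulmx1 mxE; apply: eq_bigr => i _; rewrite mxE.
apply/andP; split; last first.
  rewrite E mulr_natl -[X in _ *+ X]card_ord -sumr_const ler_sum// => i _.
  by rewrite -real_normK ?num_real// lerXn2r ?nnegrE// mx_coord_le.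
rewrite E -ler_sqrt ?sumr_ge0// => [|i _]; last exact: sqr_ge0.
rewrite sqrtr_sqr normr_id; apply: mx_norm_le => [|i j]; first exact: sqrtr_ge0.
rewrite ord1 -sqrtr_sqr ler_sqrt ?sumr_ge0// => [|k _]; last exact: sqr_ge0.
by rewrite (bigD1 j)//= lerDl sumr_ge0// => k _; exact: sqr_ge0.
Qed.

Lemma coercive1 n : coercive (1%:M : 'M[R]_n).
Proof. by exists 1 => // z; rewrite mul1r; have /andP[] := bform1 z. Qed.

Lemma row_neq0 n (b : 'M[int]_n) i : \det b != 0 -> row i b != 0.
Proof.
apply: contraNneq => h; rewrite (expand_det_row _ i) big1// => j _.
by have /rowP/(_ j) := h; rewrite !mxE => ->; rewrite mul0r.
Qed.

Lemma unit_det_neq0 n (b : 'M[int]_n) : b \in unitmx -> \det b != 0.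
Proof. by rewrite unitmxE; apply: contraTneq => ->; rewrite unitr0. Qed.

(** Minimising over first rows of unimodular matrices, rather than over nonzero vectors, provides
    the completion of the minimiser to a basis. Coercivity leaves finitely many rows below the
    starting value K. *)
Lemma coercive_min_row n (P : 'M[R]_n.+1) : coercive P ->
  exists2 b : 'M[int]_n.+1, b \in unitmx &
    forall b' : 'M[int]_n.+1, b' \in unitmx ->
      bform P (intmx (row 0 b)) (intmx (row 0 b))
      <= bform P (intmx (row 0 b')) (intmx (row 0 b')).
Proof.
move=> [c c0 hc]; pose q (v : 'rV[int]_n.+1) := bform P (intmx v) (intmx v).
pose K := q (row 0 1%:M).
have [T [phi hphi]] := @int_mx_finite R 1 n.+1 (Num.sqrt (K / c)).
pose A t := `[< exists2 b : 'M[int]_n.+1, b \in unitmx & row 0 b = phi t >].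
have small v : q v <= K -> exists t, phi t = v.
  move=> qv; apply: hphi; rewrite -ler_sqr ?nnegrE ?sqrtr_ge0// sqr_sqrtr.
    by rewrite ler_pdivlMr// mulrC (le_trans (hc _)).
  by rewrite divr_ge0 ?(ltW c0)// (le_trans _ (hc _))// mulr_ge0 ?sqr_ge0 ?(ltW c0).
have [t0 ht0] := small _ (lexx K).
have At0 : A t0 by apply/asboolP; exists 1%:M => //; exact: unitmx1.
have [t /asboolP[b ub bt] tmin] := Order.TotalTheory.arg_minP (q \o phi) At0.
exists b => // b' ub'; rewrite -!/(q _) bt.
have [h|/ltW h] := leP (q (row 0 b')) K.
  have [t' ht'] := small _ h; rewrite -ht'; apply: tmin.
  by apply/asboolP; exists b'.
by apply: le_trans h; rewrite /K -ht0; exact: tmin.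
Qed.

Lemma det_int_unit n (b : 'M[int]_n) : b \in unitmx ->
  (\det (intmx b : 'M[R]_n)) ^+ 2 = 1.
Proof.
move=> ub; have /(congr1 (fun A => absz (\det A))) := mulmxV ub.
rewrite det_mulmx det1 abszM /= => /eqP; rewrite muln_eq1 => /andP[/eqP h _].
rewrite det_map_mx.
have [->|->] : \det b = 1 \/ \det b = -1 by move: h; set z := \det b; lia.
  by rewrite expr1n.
by rewrite rmorphN1 sqrrN expr1n.
Qed.

Lemma round_half (x : R) : exists k : int, `|k%:~R + x| <= 1 / 2.
Proof.
exists (- Num.floor (x + 1 / 2)).
have /andP[h1 h2] := real_floor_itv (num_real (x + 1 / 2)).
rewrite intrD in h2; rewrite intrN ler_norml; move: h1 h2.
set y := _%:~R; rewrite -[1%:~R]/(1 : R); lra.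
Qed.


(* Write P = p (x_0 + ...)^2 + P' with p the least value of P at the first row of a unimodular matrix; every vector b_i lifting a reduced basis of P' with |x_0-part| <= 1/2 is such a row, so p <= P(b_i) <= P'(b_i) + p / 4. *)
Lemma hermite_reduction n : exists2 K : R, 0 < K &
  forall P : 'M[R]_n, P^T = P -> coercive P ->
  exists2 b : 'M[int]_n, b \in unitmx &
    \prod_i bform P (intmx (row i b)) (intmx (row i b)) <= K * \det P.
Proof.
elim: n => [|n [K K0 IH]].
  exists 1 => // P _ _; exists 1%:M; first exact: unitmx1.
  by rewrite big_ord0 det_mx00 mulr1.
exists ((4 / 3) ^+ n * K); first by rewrite mulr_gt0// exprn_gt0.
move=> P sP cP; have [g ug gmin] := coercive_min_row cP.
pose P0 : 'M[R]_(1 + n) := intmx g *m P *m (intmx g)^T.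
have P0E (x y : 'rV_(1 + n)) : bform P0 x y = bform P (x *m intmx g) (y *m intmx g).
  by rewrite bform_mulmx.
have sP0 : P0^T = P0 by rewrite /P0 !trmx_mul trmxK sP mulmxA.
have dP0 : \det P0 = \det P.
  rewrite /P0 !det_mulmx det_tr mulrAC -expr2 det_int_unit// mul1r.
  by [].
have ugR : (intmx g : 'M[R]_n.+1) \in unitmx.
  by rewrite unitmxE unitfE -sqrf_eq0 det_int_unit// oner_eq0.
have [c c0 hc] : coercive P0 by exact: coercive_congr.
clearbody P0.
pose p := P0 0 0; pose q : 'rV[R]_n := ursubmx P0.
(* The Schur complement of p, that is, the form on the quotient by the first basis vector. *)
pose P' : 'M[R]_n := drsubmx P0 - p^-1 *: (q^T *m q).
have pE : p = bform P0 (delta_mx 0 0) (delta_mx 0 0).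
  by rewrite /bform -rowE trmx_delta -colE !mxE.
have p0 : 0 < p.
  have := hc (delta_mx 0 0); rewrite -pE.
  apply: lt_le_trans; rewrite mulr_gt0// exprn_gt0// normr_gt0.
  by apply/eqP => /matrixP/(_ 0 0)/eqP; rewrite !mxE !eqxx oner_eq0.
have P0block : P0 = block_mx p%:M q q^T (drsubmx P0).
  rewrite -[P0 in LHS]submxK /q; congr block_mx.
    by rewrite [LHS]mx11_scalar !mxE; congr (P0 _ _)%:M; apply/val_inj.
  by rewrite trmx_ursub sP0.
have P0q (a : R) z : bform P0 (row_mx a%:M z) (row_mx a%:M z) =
    p * (a + p^-1 * (z *m q^T) 0 0) ^+ 2 + bform P' z z.
  set t := (z *m q^T) 0 0.
  have zq : z *m q^T = t%:M by rewrite /t -mx11_scalar.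
  have qz : q *m z^T = t%:M.
    by rewrite -[LHS]trmxK trmx_mul trmxK zq tr_scalar_mx.
  rewrite P0block /bform mul_row_block tr_row_mx mul_row_col tr_scalar_mx.
  rewrite !mulmxDl /P' mulmxBr mulmxBl -scalemxAr -scalemxAl -!mulmxA qz.
  rewrite !(mulmxA z q^T) zq -!scalar_mxM !mxE eqxx !mulr1n.
  by field; exact: lt0r_neq0.
have dP' : \det P0 = p * \det P'.
  have -> : P0 = block_mx 1%:M 0 (p^-1 *: q^T) 1%:M *m block_mx p%:M q 0 P'.
    rewrite mulmx_block !mul1mx !mul0mx !addr0 -!scalemxAl mul_mx_scalar.
    by rewrite scalerA mulVf ?lt0r_neq0// scale1r /P' addrC subrK {1}P0block.
  by rewrite det_mulmx det_lblock det_ublock !det1 !mul1r det_scalar1.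
have sP' : P'^T = P'.
  by rewrite /P' linearB /= linearZ /= trmx_mul trmxK trmx_drsub sP0.
have cP' : coercive P'.
  exists c => // z; set a := - (p^-1 * (z *m q^T) 0 0).
  have := hc (row_mx a%:M z); rewrite P0q /a addNr expr0n /= mulr0 add0r.
  apply: le_trans; rewrite ler_wpM2l ?(ltW c0)// lerXn2r ?nnegrE//.
  apply: mx_norm_le => // i j; have := mx_coord_le (row_mx a%:M z) i (rshift 1 j).
  by rewrite row_mxEr.
have [b' ub' hb'] := IH P' sP' cP'.
have /choice[k hk] i := round_half (p^-1 * (intmx (row i b') *m q^T) 0 0).
pose b1 : 'M[int]_(1 + n) := block_mx 1%:M 0 (\col_i k i) b'.
have ub1 : b1 \in unitmx by rewrite unitmxE det_lblock det1 mul1r -unitmxE.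
pose v i : 'rV[int]_(1 + n) := row (rshift 1 i) b1.
have vE i : intmx (v i) = row_mx (k i)%:~R%:M (intmx (row i b')) :> 'rV[R]_(1 + n).
  rewrite /v /b1 /block_mx rowKd row_row_mx map_row_mx; congr row_mx.
  by rewrite [LHS]mx11_scalar !mxE.
have pv i : p <= bform P0 (intmx (v i)) (intmx (v i)).
  (* Swapping row i of b1 to the top gives another unimodular matrix, to which the minimality of g
     applies. *)
  have := gmin (xrow 0 (rshift 1 i) b1 *m g).
  rewrite unitmx_mul xrowE unitmx_mul unitmx_perm ub1 ug => /(_ isT).
  rewrite row_mul map_mxM -P0E -xrowE.
  have -> : row 0 (xrow 0 (rshift 1 i) b1) = v i.
    by apply/rowP => j; rewrite !mxE perm.tpermL.
  by apply: le_trans; rewrite pE P0E -rowE map_row.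
pose F i := bform P0 (intmx (row i b1)) (intmx (row i b1)).
pose F' i := bform P' (intmx (row i b')) (intmx (row i b')).
have F'0 i : 0 <= F' i.
  by have [e e0 he] := cP'; rewrite (le_trans _ (he _))// mulr_ge0 ?sqr_ge0 ?(ltW e0).
(* From p <= p w^2 + F' and w^2 <= 1/4 follows p <= (4/3) F', hence p w^2 + F' <= (4/3) F'. *)
have Fi i : 0 <= F (rshift 1 i) <= 4 / 3 * F' i.
  have := pv i; rewrite vE P0q -/(F' i).
  rewrite /F -/(v i) vE P0q -/(F' i).
  have /ler_normlP[h1 h2] := hk i; move: (F'0 i) p0; set w := _ + _ in h1 h2 *.
  move=> ? ? ?; have : w ^+ 2 <= 1 / 4 by nra.
  move=> hw; have : p * w ^+ 2 <= p * (1 / 4) by rewrite ler_pM2l.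
  have : 0 <= p * w ^+ 2 by rewrite mulr_ge0 ?sqr_ge0// ltW.
  by move=> ? ?; apply/andP; split; lra.
exists (b1 *m g); first by rewrite unitmx_mul ub1.
rewrite (eq_bigr F); last first.
  by move=> i _; rewrite /F P0E row_mul map_mxM.
rewrite (big_ord_recl n) /=.
rewrite -dP0 dP'.
have -> : F ord0 = p.
  rewrite /F; have -> : intmx (row ord0 b1) = row_mx 1%:M 0 :> 'rV[R]_(1 + n).
    rewrite (_ : row ord0 b1 = row (lshift n (0 : 'I_1)) b1); last first.
      by congr row; apply/val_inj.
    rewrite /b1 /block_mx rowKu row_row_mx map_row_mx; congr row_mx.
      by rewrite [LHS]mx11_scalar !mxE.
    by apply/rowP => j; rewrite !mxE.
  by rewrite P0q mul0mx mxE mulr0 addr0 expr1n mulr1 bform0l addr0.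
have -> : (4 / 3) ^+ n * K * (p * \det P') = p * ((4 / 3) ^+ n * (K * \det P')) by ring.
rewrite ler_pM2l//.
apply: (@le_trans _ _ (\prod_(i < n) (4 / 3 * F' i))).
  apply: ler_prod => i _; have := Fi i.
  by rewrite (_ : rshift 1 i = lift ord0 i)//; apply/val_inj.
rewrite big_split /= prodr_const card_ord ler_wpM2l// exprn_ge0//.
Qed.

(** The product of the n values is at most K and each is at least e^2, so each is at most K /
    e^(2(n-1)). *)
Lemma reduced_lattice_basis n (e : R) : 0 < e -> exists2 C : R, 0 < C &
  forall g : 'M[R]_n, \det g ^+ 2 = 1 ->
  (forall v : 'rV[int]_n, v != 0 -> e <= `|intmx v *m g|) ->
  exists2 b : 'M[int]_n, b \in unitmx & forall i, `|intmx (row i b) *m g| <= C.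
Proof.
move=> e0; have [K K0 hK] := hermite_reduction n.
pose C := K / (e ^+ 2) ^+ n.-1; have C0 : 0 < C by rewrite divr_gt0// !exprn_gt0.
exists (Num.sqrt C) => [|g dg hg]; first by rewrite sqrtr_gt0.
have ug : g \in unitmx by rewrite unitmxE unitfE -sqrf_eq0 dg oner_eq0.
pose P := g *m 1%:M *m g^T.
have [||b ub hb] := hK P.
- by rewrite /P mulmx1 trmx_mul trmxK.
- exact/coercive_congr/coercive1.
exists b => // i.
pose F i := bform P (intmx (row i b)) (intmx (row i b)).
have Fge j : `|intmx (row j b) *m g| ^+ 2 <= F j.
  rewrite /F /P [leRHS]/bform -bform_mulmx; by have /andP[] := bform1 (intmx (row j b) *m g).
have Fe j : e ^+ 2 <= F j.
  rewrite (le_trans _ (Fge j))// lerXn2r ?nnegrE ?(ltW e0)//.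
  by apply: hg; apply: row_neq0; exact: unit_det_neq0.
rewrite -(ger0_norm (normr_ge0 _)) -sqrtr_sqr ler_sqrt ?(ltW C0)//.
rewrite (le_trans (Fge i))// /C ler_pdivlMr ?exprn_gt0//.
have dP : \det P = 1 by rewrite /P mulmx1 det_mulmx det_tr -expr2.
move: hb; rewrite dP mulr1.
apply: le_trans; rewrite (bigD1 i)//= -/(F i) ler_wpM2l//.
  by rewrite (le_trans _ (Fe i))// sqr_ge0.
have -> : (e ^+ 2) ^+ n.-1 = \prod_(j < n | j != i) e ^+ 2.
  by rewrite prodr_const cardC1 card_ord.
by apply: ler_prod => j _; rewrite sqr_ge0 Fe.
Qed.

End Hermite.

(** * Isometries of integral forms *)

Section IntegralIsometries.
Context {R : realType} {n : nat} (S : 'M[int]_n).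
Hypothesis dS : \det S != 0.
Local Notation SR := (intmx S : 'M[R]_n).

Lemma bform_intmx (T : 'M[int]_n) (u v : 'rV[int]_n) :
  bform (intmx T : 'M[R]_n) (intmx u) (intmx v) = (bform T u v)%:~R.
Proof. by rewrite /bform map_trmx -!map_mxM mxE. Qed.

Definition isometry (T g : 'M[R]_n) :=
  forall x y, bform T (x *m g) (y *m g) = bform T x y.

Lemma isometry_det g : isometry SR g -> \det g ^+ 2 = 1.
Proof.
move=> hg; have E : g *m SR *m g^T = SR.
  apply/eqP; rewrite -subr_eq0; apply/eqP; apply: bform_nondeg => x y.
  have := hg x y; rewrite bform_mulmx -/(bform _ _ _) => h.
  by rewrite /bform mulmxBr mulmxBl mxE [X in _ + X]mxE -!/(bform _ _ _) h subrr.
have d0 : \det SR != 0 by rewrite det_map_mx intr_eq0.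
apply: (mulIf d0); rewrite mul1r -[in RHS]E !det_mulmx det_tr; ring.
Qed.

Lemma short_isotropic : exists2 e : R, 0 < e & forall g, isometry SR g ->
  forall v : 'rV[int]_n, `|intmx v *m g| < e -> bform S v v = 0.
Proof.
pose k := n%:R ^+ 2 * `|SR|; have k0 : 0 <= k by rewrite mulr_ge0// sqr_ge0.
(* With this e both a < 1 and k a < 1, hence k a^2 < 1. *)
exists (1 + k)^-1 => [|g hg v hv]; first by rewrite invr_gt0; lra.
apply: (@intr_lt1_eq0 R); rewrite -bform_intmx -hg.
apply: le_lt_trans (bform_norm _ _ _) _; rewrite -/k.
set a := `|_| in hv *; have a0 : 0 <= a by exact: normr_ge0.
have : a * (1 + k) < 1 by rewrite -ltr_pdivlMr ?mul1r//; lra.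
have : 0 <= k * a by exact: mulr_ge0.
move=> h1 h2; have a1 : a < 1 by lra.
have : k * a * a <= k * a by rewrite ler_piMr// ltW.
lra.
Qed.

Lemma reduced_isometry : exists e C : R, [/\ 0 < e, 0 < C & forall g, isometry SR g ->
  (exists2 v : 'rV[int]_n, v != 0 & `|intmx v *m g| < e /\ bform S v v = 0) \/
  (exists2 b : 'M[int]_n, b \in unitmx & `|intmx b *m g| <= C)].
Proof.
have [e e0 he] := short_isotropic; have [C C0 hC] := reduced_lattice_basis n e0.
exists e, C; split => // g hg.
have [[v v0 hv]|H] := pselect (exists2 v : 'rV[int]_n, v != 0 & `|intmx v *m g| < e).
  by left; exists v => //; split => //; exact: (he g).
right; have [v v0|b ub hb] := hC g (isometry_det hg).
  by rewrite leNgt; apply/negP => hv; apply: H; exists v.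
exists b => //; apply: mx_norm_le => [|i j]; first exact: ltW.
apply: le_trans (hb i); rewrite map_row -row_mul.
by have := mx_coord_le (row i (intmx b *m g)) 0 j; rewrite mxE.
Qed.

Lemma bounded_isotropic (v0 : 'rV[int]_n) : v0 != 0 -> bform S v0 v0 = 0 ->
  exists C : R, forall g, isometry SR g ->
  exists2 v : 'rV[int]_n, v != 0 & bform S v v = 0 /\ `|intmx v *m g| <= C.
Proof.
move=> v00 v0S; have [e [C [e0 C0 hC]]] := reduced_isometry.
have [T [phi hphi]] := @int_mx_finite R n n (n%:R ^+ 2 * `|SR| * C * C).
(* One isotropic vector is fixed for each Gram matrix on the list; the value 0 stands for matrices
   without one, and these do not occur below, since [v0 *m invmx b] is isotropic for the Gram matrix
   of b. *)
have /choice[z hz] (t : T) : exists z : 'rV[int]_n,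
    (exists2 z : 'rV[int]_n, z != 0 & bform (phi t) z z = 0) ->
    z != 0 /\ bform (phi t) z z = 0.
  have [[z z0 hz]|nz] := pselect (exists2 z : 'rV[int]_n, z != 0 & bform (phi t) z z = 0).
    by exists z.
  by exists 0.
pose Z : R := \sum_t `|intmx (z t)|.
exists (e + n%:R * Z * C) => g hg.
have Z0 : 0 <= Z by exact: sumr_ge0.
have [[v vn0 [hv vS]]|[b ub hb]] := hC g hg.
  by exists v => //; split => //; rewrite (le_trans (ltW hv))// lerDl !mulr_ge0// ltW.
have [|t ht] := hphi (b *m S *m b^T).
  apply: mx_norm_le => [|i j]; first by rewrite !mulr_ge0 ?sqr_ge0// ltW.
  have -> : intmx (b *m S *m b^T) i j =
      bform SR (row i (intmx b *m g)) (row j (intmx b *m g)).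
    by rewrite !row_mul hg -!map_row bform_intmx bform_row mxE.
  have rb k : `|row k (intmx b *m g)| <= C.
    apply: mx_norm_le => [|a l]; first exact: ltW.
    by rewrite mxE (le_trans (mx_coord_le _ _ _)).
  apply: le_trans (bform_norm _ _ _) _; apply: ler_pM; rewrite ?rb//.
  by rewrite ler_wpM2l ?rb// mulr_ge0 ?sqr_ge0.
have [|zt0 zt] := hz t.
  exists (v0 *m invmx b).
    apply: contraNneq v00 => h; rewrite -[v0](mulmxKV ub) h mul0mx.
    by [].
  by rewrite ht -v0S /bform -bform_mulmx mulmxKV.
exists (z t *m b); last split.
- apply: contraNneq zt0 => h; rewrite -[z t](mulmxK ub) h mul0mx.
  by [].
- by rewrite bform_mulmx -/(bform _ _ _) -ht.
rewrite map_mxM -mulmxA (le_trans (mulmx_norm_le _ _))//.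
rewrite (@le_trans _ _ (n%:R * Z * C))//; last by rewrite lerDr ltW.
rewrite ler_pM ?mulr_ge0// ler_wpM2l// /Z (bigD1 t)//= lerDl.
exact: sumr_ge0.
Qed.

End IntegralIsometries.

Section Flow.
Context {R : realType} {n : nat} {S : 'M[R]_n}.
Hypothesis sS : S^T = S.

(** For isotropic x, y with b(x, y) = 1 this is the hyperbolic rotation x -> l^-1 x, y -> l y,
    identity on the orthogonal complement of x and y, written without a basis of that complement. *)
Definition flow (x y : 'rV[R]_n) (l : R) : 'M[R]_n :=
  1%:M + (l^-1 - 1) *: (S *m y^T *m x) + (l - 1) *: (S *m x^T *m y).

Lemma flowE x y l w :
  w *m flow x y l = w + ((l^-1 - 1) * bform S w y) *: x + ((l - 1) * bform S w x) *: y.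
Proof.
rewrite /flow !mulmxDr mulmx1 -!scalemxAr !mulmxA.
rewrite (mx11_scalar (w *m S *m x^T)) (mx11_scalar (w *m S *m y^T)).
by rewrite !mul_scalar_mx !scalerA.
Qed.

Lemma flow_isometry x y l : bform S x x = 0 -> bform S y y = 0 -> bform S x y = 1 ->
  l != 0 -> isometry S (flow x y l).
Proof.
move=> xx yy xy l0 w w'; rewrite !flowE !bformE.
rewrite !(bformC x _ sS) !(bformC y _ sS) !xx !yy ?xy ?(bformC y x sS) ?xy.
by field.
Qed.

End Flow.

(** * Hyperbolic splittings *)

Lemma rat_mx_denom m n (A : 'M[rat]_(m, n)) :
  exists2 D : int, D != 0 & exists B : 'M[int]_(m, n), intmx B = D%:~R *: A.
Proof.
pose D : int := \prod_(ij : 'I_m * 'I_n) denq (A ij.1 ij.2).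
exists D; first by apply/prodf_neq0 => ij _; exact: denq_neq0.
exists (\matrix_(i, j) (numq (A i j) * \prod_(ij | ij != (i, j)) denq (A ij.1 ij.2))).
apply/matrixP => i j; rewrite !mxE.
have -> : D = denq (A i j) * \prod_(ij | ij != (i, j)) denq (A ij.1 ij.2).
  by rewrite /D (bigD1 (i, j)).
set X := \prod_(_ | _) _; by rewrite !intrM numqE; ring.
Qed.

Section IsotropicPartner.
Context {F : idomainType} {n : nat} (S : 'M[F]_n).
Hypothesis sS : S^T = S.
Hypothesis dS : \det S != 0.
Hypothesis F2 : (2 : F) != 0.

(** The adjugate takes the place of the inverse, so that the integers are covered. *)
Lemma bform_det_nondeg (e : 'rV[F]_n) : e != 0 -> exists z, bform S e z != 0.
Proof.
move=> e0; suff /existsP[i hi] : [exists i, (e *m S) 0 i != 0].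
  exists (delta_mx 0 i); rewrite /bform trmx_delta -colE [col _ _ _ _]mxE; exact: hi.
apply: contraNT e0 => /existsPn h; have : e *m S = 0.
  by apply/rowP => i; have := h i; rewrite negbK [RHS]mxE => /eqP.
move=> /(congr1 (fun A => A *m \adj S)) /=; rewrite -mulmxA mul_mx_adj mul0mx.
rewrite mul_mx_scalar => /rowP h'; apply/eqP/rowP => i; have /eqP := h' i.
by rewrite !mxE mulf_eq0 (negPf dS) => /eqP.
Qed.

(** In the plane of e and z, f spans the isotropic line other than that of e; it is scaled to avoid
    divisions, so it is integral when e and z are. *)
Lemma isotropic_partner (e : 'rV[F]_n) : e != 0 -> bform S e e = 0 ->
  exists2 f, bform S f f = 0 & bform S e f != 0.
Proof.
move=> e0 ee; have [z hz] := bform_det_nondeg e0.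
exists ((2 * bform S e z) *: z - bform S z z *: e).
  by rewrite !bformE (bformC z e sS) ee; ring.
rewrite !bformE ee (_ : _ - _ = 2 * bform S e z ^+ 2); last by ring.
by rewrite mulf_neq0// expf_neq0.
Qed.

End IsotropicPartner.

(** Orthogonal splitting into the hyperbolic plane of e and f and a complement: the rows of W are a
    basis of the latter and [x *m M] gives coordinates along it. The value b(e, f) is not normalised
    to 1, which would destroy integrality of e and f. *)
Record witt_split (F : fieldType) n k (S : 'M[F]_n) (e f : 'rV[F]_n)
    (W : 'M[F]_(k, n)) (M : 'M[F]_(n, k)) : Prop := WittSplit {
  ws_e : bform S e e = 0;
  ws_f : bform S f f = 0;
  ws_ef : bform S e f != 0;
  ws_WM : W *m M = 1%:M;
  ws_We : forall u, bform S (u *m W) e = 0;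
  ws_Wf : forall u, bform S (u *m W) f = 0;
  ws_dec : forall x, x = (bform S x f / bform S e f) *: e
    + (bform S x e / bform S e f) *: f + x *m M *m W }.

Section WittSplit.
Context {F : fieldType}.

(** P is b(e, f) times the orthogonal projection onto the complement of e and f. It has rank k, and
    a full rank factorisation of P yields W and, up to the scalar, M. *)
Lemma witt_split_ex k (S : 'M[F]_k.+2) (e f : 'rV[F]_k.+2) :
  S^T = S -> bform S e e = 0 -> bform S f f = 0 -> bform S e f != 0 ->
  exists (W : 'M[F]_(k, k.+2)) (M : 'M[F]_(k.+2, k)), witt_split S e f W M.
Proof.
move=> sS ee ff ef; set N := bform S e f in ef.
pose P := N%:M - S *m f^T *m e - S *m e^T *m f.
have PE x : x *m P = N *: x - bform S x f *: e - bform S x e *: f.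
  rewrite /P !mulmxBr mul_mx_scalar !mulmxA.
  rewrite (mx11_scalar (x *m S *m e^T)) (mx11_scalar (x *m S *m f^T)).
  by rewrite !mul_scalar_mx.
have eP : e *m P = 0 by rewrite PE ee scale0r subr0 subrr.
have fP : f *m P = 0 by rewrite PE ff (bformC f e sS) scale0r subr0 subrr.
have Pe : P *m S *m e^T = 0.
  apply/colP => i; rewrite [RHS]mxE; transitivity (bform S (delta_mx 0 i *m P) e).
    by rewrite /bform -rowE -!row_mul [RHS]mxE.
  by rewrite PE !bformE ee (bformC f e sS) -/N; ring.
have Pf : P *m S *m f^T = 0.
  apply/colP => i; rewrite [RHS]mxE; transitivity (bform S (delta_mx 0 i *m P) f).
    by rewrite /bform -rowE -!row_mul [RHS]mxE.
  by rewrite PE !bformE ff -/N; ring.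
have rk : \rank P = k.
  apply/eqP; rewrite eqn_leq -(leq_add2r 2) -[X in _ && X](leq_add2r 2).
  apply/andP; split; last first.
    have <- : \rank (N%:M : 'M[F]_k.+2) = (k + 2)%N.
      rewrite -scalemx1 mxrank_scale_nz// mxrank1 addn2.
      by [].
    have -> : N%:M = P + (S *m f^T *m e + S *m e^T *m f).
      by rewrite /P -[X in X + _]addrA -opprD subrK.
    apply: leq_trans (mxrank_add _ _) _; rewrite leq_add2l.
    apply: leq_trans (mxrank_add _ _) _; rewrite -[2%N]/(1 + 1)%N.
    by apply: leq_add; apply: leq_trans (mxrankM_maxr _ _) _; exact: rank_leq_row.
  have r2 : (2 <= \rank (col_mx e f))%N.
    have : \rank (N%:M : 'M[F]_(1 + 1)) = 2%N by rewrite -scalemx1 mxrank_scale_nz// mxrank1.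
    move=> <-; have -> : N%:M = col_mx e f *m (S *m row_mx f^T e^T).
      rewrite mulmxA mul_col_mx mul_col_row.
      rewrite (mx11_scalar (e *m S *m e^T)) (mx11_scalar (e *m S *m f^T)).
      rewrite (mx11_scalar (f *m S *m e^T)) (mx11_scalar (f *m S *m f^T)).
      rewrite -!/(bform _ _ _) ee ff (bformC f e sS) -/N.
      by rewrite !scalar_mx_block raddf0.
    exact: mxrankM_maxl.
  have := mulmx0_rank_max (_ : col_mx e f *m P = 0).
  rewrite mul_col_mx eP fP col_mx0 => /(_ erefl) h.
  by move: h r2; set a := \rank (col_mx e f); set b := \rank P; lia.
have [A hA] : exists A, row_base P = A *m P.
  by apply/submxP; rewrite eq_row_base submx_refl.
(* The rank occurs in the types of the two bases, so they are generalised before it is rewritten to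
   k. *)
have := mulmx_base P; have := row_base_free P; move: (row_base P) (col_base P) A hA.
rewrite rk => W M A WA Wfree MW.
have We u : bform S (u *m W) e = 0.
  by rewrite /bform WA -!mulmxA (mulmxA P) Pe !mulmx0 mxE.
have Wf u : bform S (u *m W) f = 0.
  by rewrite /bform WA -!mulmxA (mulmxA P) Pf !mulmx0 mxE.
exists W, (N^-1 *: M); split => //.
  apply: (row_free_inj Wfree); apply/row_matrixP => i.
  rewrite -scalemxAr -scalemxAl -mulmxA MW mul1mx.
  rewrite rowE -scalemxAr mulmxA PE We Wf !scale0r !subr0 scalerA mulVf// scale1r.
  by rewrite -rowE.
move=> x; rewrite -scalemxAr -scalemxAl -mulmxA MW PE.
rewrite !scalerBr !scalerA mulVf// scale1r ![_^-1 * _]mulrC -/N.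
by rewrite addrC -[X in X + _]addrA -opprD subrK.
Qed.

End WittSplit.

Lemma witt_split_nondeg (F : fieldType) n k (S : 'M[F]_n) e f (W : 'M[F]_(k, n)) M :
  S^T = S -> \det S != 0 -> witt_split S e f W M -> \det (W *m S *m W^T) != 0.
Proof.
move=> sS dS [ee ff ef WM We Wf dec].
rewrite -unitfE -unitmxE -row_free_unit; apply: inj_row_free => u hu.
have h x : bform S (u *m W) x = 0.
  rewrite (dec x) !bformE We Wf !mulr0 !add0r bform_mulmx.
  by rewrite hu mul0mx mxE.
rewrite -[u]mulmx1 -WM mulmxA; suff -> : u *m W = 0 by rewrite mul0mx.
apply/eqP; apply: contraTT isT => /(bform_det_nondeg dS)[z].
by rewrite h eqxx.
Qed.

(** Replaces the quantified fields by matrix identities, which a field embedding preserves; this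
    carries a splitting from the rationals to the reals. *)
Lemma witt_splitP (F : fieldType) n k (S : 'M[F]_n) e f (W : 'M[F]_(k, n)) M :
  [/\ bform S e e = 0, bform S f f = 0, bform S e f != 0 & W *m M = 1%:M] ->
  [/\ W *m (S *m e^T) = 0, W *m (S *m f^T) = 0 &
   (bform S e f)^-1 *: (S *m f^T *m e + S *m e^T *m f) + M *m W = 1%:M] <->
  witt_split S e f W M.
Proof.
have D x : x = (bform S x f / bform S e f) *: e + (bform S x e / bform S e f) *: f + x *m M *m W
  <-> x *m ((bform S e f)^-1 *: (S *m f^T *m e + S *m e^T *m f) + M *m W) = x *m 1%:M.
  rewrite mulmx1 !mulmxDr -scalemxAr !mulmxDr !mulmxA.
  rewrite (mx11_scalar (x *m S *m e^T)) (mx11_scalar (x *m S *m f^T)).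
  rewrite !mul_scalar_mx scalerDr !scalerA.
  by rewrite ![_^-1 * _]mulrC; split => /esym.
move=> [ee ff ef WM]; split=> [[We Wf dec]|[_ _ _ _ We Wf dec]].
  split => //.
  - by move=> u; rewrite /bform -!mulmxA We mulmx0 mxE.
  - by move=> u; rewrite /bform -!mulmxA Wf mulmx0 mxE.
  - by move=> x; apply/D; rewrite dec.
split.
- apply/colP => i; have := We (delta_mx 0 i).
  by rewrite /bform -rowE -!row_mul -mulmxA !mxE.
- apply/colP => i; have := Wf (delta_mx 0 i).
  by rewrite /bform -rowE -!row_mul -mulmxA !mxE.
apply/row_matrixP => i; rewrite !rowE; exact/D.
Qed.

(** Denominators are cleared in W and compensated in M. Integrality of W makes the form
    [W *m S *m W^T] on the complement integral, as the induction requires. *)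
Lemma int_witt_split (R : realType) k (S : 'M[int]_k.+2) (e f : 'rV[int]_k.+2) :
  S^T = S -> bform S e e = 0 -> bform S f f = 0 -> bform S e f != 0 ->
  exists (W : 'M[int]_(k, k.+2)) (M : 'M[R]_(k.+2, k)),
    witt_split (intmx S) (intmx e) (intmx f) (intmx W) M.
Proof.
move=> sS ee ff ef.
have bE (F : numFieldType) (u v : 'rV[int]_k.+2) :
    bform (intmx S : 'M[F]_k.+2) (intmx u) (intmx v) = (bform S u v)%:~R.
  by rewrite /bform map_trmx -!map_mxM mxE.
have hyp (F : numFieldType) : [/\ bform (intmx S) (intmx e) (intmx e) = 0 :> F,
    bform (intmx S) (intmx f) (intmx f) = 0 :> F &
    bform (intmx S) (intmx e) (intmx f) != 0 :> F].
  by rewrite !bE ee ff intr_eq0.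
have [ee' ff' ef'] := hyp rat.
have [|W [M wW]] := witt_split_ex _ ee' ff' ef'; first by rewrite map_trmx sS.
have WM := ws_WM wW.
have /witt_splitP[|We Wf dec] := wW; first by split.
have [D D0 [B hB]] := rat_mx_denom W.
have DQ : (D%:~R : rat) != 0 by rewrite intr_eq0.
have ri : (fun x : int => ratr (x%:~R : rat) : R) =1 intr by move=> x; rewrite ratr_int.
have mi p q (A : 'M[int]_(p, q)) : map_mx ratr (intmx A : 'M[rat]_(p, q)) = intmx A :> 'M[R]_(p, q).
  by apply/matrixP => i j; rewrite !mxE ratr_int.
have [ee'' ff'' ef''] := hyp R.
exists B, (map_mx ratr ((D%:~R)^-1 *: M)); rewrite -[intmx B]mi hB; apply/witt_splitP.
  split => //; rewrite -map_mxM -scalemxAl -scalemxAr scalerA divff// scale1r WM.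
  exact: map_mx1.
split.
- by rewrite -!mi map_trmx -!map_mxM -scalemxAl We scaler0 raddf0.
- by rewrite -!mi map_trmx -!map_mxM -scalemxAl Wf scaler0 raddf0.
have -> : (bform (intmx S) (intmx e) (intmx f) : R)^-1 =
    ratr (bform (intmx S) (intmx e) (intmx f))^-1.
  by rewrite !bE fmorphV /= ratr_int.
rewrite -map_mxM -scalemxAl -scalemxAr scalerA mulVf// scale1r.
have := congr1 (map_mx (ratr : rat -> R)) dec.
rewrite map_mxD map_mxZ map_mxD map_mx1.
by rewrite (map_mxM _ M) !map_mxM -!map_trmx !mi.
Qed.

(** * Isotropic integer vectors near an isotropic line *)

Section Dirichlet.
Context {R : realType}.

Lemma finite_pos_min (T : finType) (f : T -> R) :
  exists2 m, 0 < m & forall t, 0 < f t -> m <= f t.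
Proof.
exists (1 + \sum_(t | 0 < f t) (f t)^-1)^-1 => [|t ft].
  by rewrite invr_gt0 ltr_pwDl// sumr_ge0// => t /ltW; rewrite invr_ge0.
rewrite -[leRHS]invrK lef_pV2 ?posrE ?invr_gt0//; last first.
  by rewrite ltr_pwDl// sumr_ge0// => s /ltW; rewrite invr_ge0.
rewrite (bigD1 t)//= addrCA lerDl addr_ge0// sumr_ge0// => s /andP[/ltW + _].
by rewrite invr_ge0.
Qed.

Lemma normalized_partner n (S : 'M[R]_n) (x : 'rV[R]_n) :
  S^T = S -> \det S != 0 -> x != 0 -> bform S x x = 0 ->
  exists2 y, bform S y y = 0 & bform S x y = 1.
Proof.
have F2 : (2 : R) != 0 by rewrite pnatr_eq0.
move=> sS dS x0 xx; have [f ff xf] := isotropic_partner sS dS F2 x0 xx.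
exists ((bform S x f)^-1 *: f); first by rewrite !bformE ff !mulr0.
by rewrite bformE mulVf.
Qed.

Lemma int_det_neq0 n (S : 'M[int]_n) : \det S != 0 -> \det (intmx S : 'M[R]_n) != 0.
Proof. by rewrite det_map_mx intr_eq0. Qed.

(* For rational points r = [v] this is dist(r, [x]) <= C / H(r), infinitely often or with r = [x]. *)
Definition approximable n (S : 'M[int]_n) (x : 'rV[R]_n) :=
  exists K, forall T : R, exists (v : 'rV[int]_n) (a : R),
    [/\ bform S v v = 0, T <= `|a| & `|intmx v - a *: x| <= K].

(* The flow contracting x by l and expanding y by l always has a bounded isotropic vector; as l grows its x-coordinate can stay bounded only for vectors orthogonal to x. *)
Lemma approximable_regular n (S : 'M[int]_n) (v0 : 'rV[int]_n) (x : 'rV[R]_n) :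
  S^T = S -> \det S != 0 -> v0 != 0 -> bform S v0 v0 = 0 ->
  x != 0 -> bform (intmx S) x x = 0 ->
  (forall v : 'rV[int]_n, v != 0 -> bform S v v = 0 -> bform (intmx S) (intmx v) x != 0) ->
  approximable S x.
Proof.
move=> sS dS v00 vv0 x0 xx hx.
have sSR : (intmx S : 'M[R]_n)^T = intmx S by rewrite map_trmx sS.
have [y yy xy] := normalized_partner sSR (int_det_neq0 dS) x0 xx.
have [C hC] := @bounded_isotropic R n S dS v0 v00 vv0.
pose k : R := n%:R ^+ 2 * `|intmx S : 'M[R]_n|.
have k0 : 0 <= k by rewrite mulr_ge0 ?sqr_ge0.
pose K := C + 3 * (k * C * `|x| * `|y|).
exists K => T.
have [F [phi hphi]] := @int_mx_finite R 1 n (K + `|T| * `|x|).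
have [m m0 hm] := finite_pos_min (fun t => `|bform (intmx S) (intmx (phi t)) x|).
(* If |a| < T, then v is one of finitely many vectors and |b(v, x)| >= m, while the flow gives l
   |b(v, x)| <= k C |x|. This l makes l m exceed k C |x|. *)
pose l := 1 + k * `|C| * `|x| / m.
have l1 : 1 <= l by rewrite lerDl divr_ge0 ?(ltW m0)// !mulr_ge0.
have l0 : 0 < l by exact: lt_le_trans l1.
have [v vn0 [vv vC]] := hC _ (flow_isometry sSR xx yy xy (lt0r_neq0 l0)).
set g := flow _ _ _ in vC; set w := intmx v *m g in vC.
have C0 : 0 <= C by exact: le_trans vC.
pose a := bform (intmx S) (intmx v) y; pose b := bform (intmx S) (intmx v) x.
have wE : w = intmx v + ((l^-1 - 1) * a) *: x + ((l - 1) * b) *: y by rewrite /w flowE.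
have yx : bform (intmx S) y x = 1 by rewrite (bformC y x sSR).
have ha : `|l^-1 * a| <= k * C * `|y|.
  have -> : l^-1 * a = bform (intmx S) w y by rewrite wE !bformE yy xy -/a; ring.
  by rewrite (le_trans (bform_norm _ _ _))// ler_wpM2r// ler_wpM2l.
have hb : `|l * b| <= k * C * `|x|.
  have -> : l * b = bform (intmx S) w x by rewrite wE !bformE xx yx -/b; ring.
  by rewrite (le_trans (bform_norm _ _ _))// ler_wpM2r// ler_wpM2l.
have hb' : `|b| <= k * C * `|x|.
  by apply: le_trans hb; rewrite normrM ler_peMl// (gtr0_norm l0).
have hK : `|intmx v - a *: x| <= K.
  have -> : intmx v - a *: x = w - (l^-1 * a) *: x - (l * b) *: y + b *: y.
    rewrite wE; apply/rowP => i; rewrite !mxE; ring.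
  rewrite (le_trans (ler_normD _ _))// (le_trans (lerD (ler_normB _ _) (lexx _)))//.
  rewrite (le_trans (lerD (lerD (ler_normB _ _) (lexx _)) (lexx _)))// !normrZ.
  have h1 : `|l^-1 * a| * `|x| <= k * C * `|x| * `|y|.
    by rewrite [leRHS]mulrAC ler_wpM2r.
  have h2 : `|l * b| * `|y| <= k * C * `|x| * `|y| by rewrite ler_wpM2r.
  have h3 : `|b| * `|y| <= k * C * `|x| * `|y| by rewrite ler_wpM2r.
  by move: h1 h2; rewrite /K !normrM; lra.
exists v, a; split => //; rewrite leNgt; apply/negP => aT.
have [|t ht] := hphi v.
  rewrite -[intmx v](subrK (a *: x)) (le_trans (ler_normD _ _))// lerD// normrZ.
  by rewrite ler_wpM2r// (le_trans (ltW aT))// ler_norm.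
have := hm t; rewrite ht normr_gt0 => /(_ (hx _ vn0 vv)); rewrite -/b => mb.
have : l * m <= k * C * `|x|.
  by rewrite (le_trans _ hb)// normrM (gtr0_norm l0) ler_wpM2l// ltW.
rewrite /l (ger0_norm C0) mulrDl mul1r divfK ?lt0r_neq0//; lra.
Qed.

(** * Points x orthogonal to a rational isotropic vector e *)

Section Degenerate.
Context {k : nat} {S : 'M[int]_k.+2} {e f : 'rV[int]_k.+2}.
Context {W : 'M[int]_(k, k.+2)} {M : 'M[R]_(k.+2, k)}.
Hypothesis sS : S^T = S.
Hypothesis dS : \det S != 0.
Hypothesis wW : witt_split (intmx S) (intmx e) (intmx f) (intmx W) M.
Local Notation SR := (intmx S : 'M[R]_k.+2).
Local Notation eR := (intmx e : 'rV[R]_k.+2).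
Local Notation fR := (intmx f : 'rV[R]_k.+2).
Local Notation WR := (intmx W : 'M[R]_(k, k.+2)).
Local Notation SU := (W *m S *m W^T).
Context {x : 'rV[R]_k.+2}.
Hypothesis xx : bform SR x x = 0.
Hypothesis xe : bform SR x eR = 0.
Local Notation xU := (x *m M).
Local Notation N := (bform SR eR fR).
Local Notation c := (bform SR x fR / N).

Lemma degenerate_dec : x = c *: eR + xU *m WR.
Proof. by rewrite {1}(ws_dec wW x) xe mul0r scale0r addr0. Qed.

Lemma sSR : SR^T = SR :> 'M[R]_k.+2. Proof. by rewrite map_trmx sS. Qed.

Lemma SU_sym : SU^T = SU.
Proof. by rewrite !trmx_mul trmxK sS mulmxA. Qed.

Lemma SU_bform (u v : 'rV[R]_k) : bform (intmx SU) u v = bform SR (u *m WR) (v *m WR).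
Proof. by rewrite bform_mulmx map_trmx -!map_mxM. Qed.

Lemma bform_split (u v : 'rV[R]_k) (p q p' q' : R) :
  bform SR (p *: fR + u *m WR + q *: eR) (p' *: fR + v *m WR + q' *: eR) =
  bform (intmx SU) u v + (p * q' + q * p') * N.
Proof.
have eW (z : 'rV[R]_k) : bform SR eR (z *m WR) = 0 by rewrite (bformC _ _ sSR) (ws_We wW).
have fW (z : 'rV[R]_k) : bform SR fR (z *m WR) = 0 by rewrite (bformC _ _ sSR) (ws_Wf wW).
rewrite !bformE SU_bform !(ws_We wW) !(ws_Wf wW) (ws_e wW) (ws_f wW) !eW !fW.
rewrite (bformC fR eR sSR); ring.
Qed.

Lemma SU_xU : bform (intmx SU) xU xU = 0.
Proof.
have := bform_split xU xU 0 c 0 c.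
rewrite scale0r add0r addrC -degenerate_dec xx => ->; ring.
Qed.

Lemma SU_det : \det SU != 0.
Proof.
have := witt_split_nondeg sSR (int_det_neq0 dS) wW.
by rewrite map_trmx -!map_mxM det_map_mx intr_eq0.
Qed.

(** On e^perp the vector e is orthogonal to everything, so adding j e to a lift keeps it isotropic;
    rounding a c to j leaves an error of at most 1 along e. *)
Lemma approximable_isotropic_quotient : approximable SU xU -> approximable S x.
Proof.
move=> [K hK]; exists (k%:R * K * `|WR : 'M[R]_(k, k.+2)| + `|eR : 'rV[R]_k.+2|) => T.
have [u [a [uu aT ua]]] := hK T.
pose j := Num.floor (a * c).
have E : intmx (u *m W + j *: e) = (0 : R) *: fR + intmx u *m WR + j%:~R *: eR.
  by rewrite scale0r add0r map_mxD map_mxM map_mxZ.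
exists (u *m W + j *: e), a; split => //.
  apply: (intr_inj (R := R)).
  rewrite -bform_intmx E bform_split bform_intmx uu; ring.
rewrite E {1}degenerate_dec.
have -> : 0 *: fR + intmx u *m WR + j%:~R *: eR - a *: (c *: eR + xU *m WR) =
    (intmx u - a *: xU) *m WR + (j%:~R - a * c) *: eR.
  rewrite mulmxBl -scalemxAl; apply/rowP => i; rewrite !mxE; ring.
rewrite (le_trans (ler_normD _ _))// lerD//.
  by rewrite (le_trans (mulmx_norm_le _ _))// ler_wpM2r// ler_wpM2l.
rewrite normrZ ler_piMl//.
have /andP[h1 h2] := real_floor_itv (num_real (a * c)).
move: h1 h2; rewrite -/j intrD -[1%:~R]/(1 : R) ler_norml => ? ?.
by apply/andP; split; lra.
Qed.

(* Every flowed lattice in U = <e, f>^perp now has a bounded basis, so u in 2 N U_Z can be found with prescribed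
   coordinates along xU and y up to O(1).  Take v = f + u + q e with q = - b(u, u) / (2 N); the y-coordinate
   - c N of u makes q close to a c. *)
Lemma approximable_anisotropic_quotient : xU != 0 ->
  bform S f f = 0 -> bform S e f != 0 ->
  (forall u : 'rV[int]_k, bform SU u u = 0 -> u = 0) -> approximable S x.
Proof.
move=> xU0 ff ef aniso.
have SUR : (intmx SU : 'M[R]_k)^T = intmx SU by rewrite map_trmx SU_sym.
have [y yy xy] := normalized_partner SUR (int_det_neq0 SU_det) xU0 SU_xU.
have yx : bform (intmx SU) y xU = 1 by rewrite (bformC y _ SUR).
have [eps [C [_ C0 hC]]] := @reduced_isometry R k SU SU_det.
pose B : R := k%:R ^+ 2 * `|intmx SU : 'M[R]_k|.
have B0 : 0 <= B by rewrite mulr_ge0 ?sqr_ge0.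
(* Taking u in m Z^k makes the coefficient q = - b(u, u) / (2 N) an integer. *)
pose m : int := 2 * bform S e f.
have m0 : (m%:~R : R) != 0 by rewrite intr_eq0 mulf_neq0.
have NE : N = (bform S e f)%:~R by rewrite bform_intmx.
have mN : m%:~R = 2 * N by rewrite NE intrM.
have N0 : N != 0 by exact: ws_ef wW.
pose D := `|m%:~R : R| * (k%:R * C).
have D0 : 0 <= D by rewrite !mulr_ge0// ltW.
(* The target along xU exceeds the rounding error by 1, which gives a >= l below; b is the target
   for b(u, xU). *)
pose P := 1 + B * D * `|y|; pose b := - (c * N).
pose Kw := D + (B * D * `|y|) * `|xU| + (B * D * `|xU|) * `|y|.
pose Ka := P + B * D * `|y|; pose Kb := B * D * `|xU|.
pose Kq := (Ka * Kb + B * Kw * Kw / 2) / `|N|.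
exists (`|fR : 'rV[R]_k.+2| + k%:R * ((`|b| + Kb) * `|y| + Kw) * `|WR : 'M[R]_(k, k.+2)|
   + Kq * `|eR : 'rV[R]_k.+2|) => T.
pose l := 1 + `|T|.
have l1 : 1 <= l by rewrite lerDl.
have l0 : 0 < l by exact: lt_le_trans l1.
have ln0 := lt0r_neq0 l0.
have giso := flow_isometry SUR SU_xU yy xy ln0; set g := flow _ _ _ in giso.
have [[v v0 [_ vv]]|[h uh hh]] := hC g giso.
  by move: v0; rewrite (aniso v vv) eqxx.
have ug : g \in unitmx.
  by rewrite unitmxE unitfE -sqrf_eq0 (isometry_det SU_det giso) oner_eq0.
have uhR : (intmx h : 'M[R]_k) \in unitmx.
  by rewrite unitmxE unitfE int_det_neq0// unit_det_neq0.
(* tau is the flowed image of the wanted vector l P xU + b y; rounding its coordinates in the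
   bounded basis, scaled by m, costs at most D. *)
pose tau := P *: xU + (l * b) *: y.
pose r := (m%:~R)^-1 *: (tau *m invmx g *m invmx (intmx h)).
pose u' := \row_j Num.floor (r 0 j).
pose u : 'rV[int]_k := m *: (u' *m h).
pose eta := intmx u *m g - tau.
have heta : `|eta| <= D.
  have -> : eta = m%:~R *: ((intmx u' - r) *m (intmx h *m g)).
    rewrite /eta /u map_mxZ map_mxM -scalemxAl -mulmxA mulmxBl scalerBr; congr (_ - _).
    by rewrite /r -scalemxAl scalerA divff// scale1r mulmxA mulmxKV// mulmxKV.
  rewrite normrZ ler_wpM2l// (le_trans (mulmx_norm_le _ _))//.
  rewrite ler_pM ?mulr_ge0// -[leRHS]mulr1 ler_wpM2l//.
  apply: mx_norm_le => // i j; rewrite ord1.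
  have -> : (intmx u' - r) 0 j = (Num.floor (r 0 j))%:~R - r 0 j.
    by rewrite mxE [X in _ + X]mxE [intmx _ _ _]mxE /u' [in LHS]mxE.
  have /andP[h1 h2] := real_floor_itv (num_real (r 0 j)).
  move: h1 h2; rewrite intrD -[1%:~R]/(1 : R) ler_norml => ? ?.
  by apply/andP; split; lra.
pose a := bform (intmx SU) (intmx u) y; pose be := bform (intmx SU) (intmx u) xU.
have ugE : intmx u *m g = intmx u + ((l^-1 - 1) * a) *: xU + ((l - 1) * be) *: y.
  by rewrite flowE.
have etaE : eta = intmx u *m g - tau by [].
have ha : l^-1 * a - P = bform (intmx SU) eta y.
  by rewrite etaE /tau ugE !bformE yy xy -/a; ring.
have hb : l * (be - b) = bform (intmx SU) eta xU.
  by rewrite etaE /tau ugE !bformE SU_xU yx -/be; ring.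
have {}ha : `|l^-1 * a - P| <= B * D * `|y|.
  by rewrite ha (le_trans (bform_norm _ _ _))// ler_wpM2r// ler_wpM2l.
have {}hb : `|l * (be - b)| <= Kb.
  by rewrite hb (le_trans (bform_norm _ _ _))// ler_wpM2r// ler_wpM2l.
have hb' : `|be - b| <= Kb / l.
  by rewrite ler_pdivlMr// mulrC -{1}(gtr0_norm l0) -normrM.
have Kb0 : 0 <= Kb by exact: mulr_ge0 (mulr_ge0 B0 D0) (normr_ge0 _).
have hbK : `|be - b| <= Kb.
  by rewrite (le_trans hb')// ler_pdivrMr// ler_peMr.
have al : l <= a.
  move: ha; rewrite ler_norml => /andP[+ _]; rewrite /P => ha.
  have : 1 <= l^-1 * a by lra.
  by rewrite ler_pdivlMl// mulr1.
have aK : `|a| <= Ka * l.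
  rewrite ger0_norm ?(le_trans (ltW l0))//.
  move: ha; rewrite ler_norml => /andP[_ ha].
  by rewrite -ler_pdivrMr// mulrC /Ka; lra.
pose w := intmx u - a *: xU - be *: y.
have wE : w = eta - (l^-1 * a - P) *: xU - (l * (be - b)) *: y.
  rewrite etaE /tau ugE /w; apply/rowP => i; rewrite !mxE; ring.
have hw : `|w| <= Kw.
  rewrite wE (le_trans (ler_normB _ _))// /Kw lerD//; last first.
    by rewrite normrZ ler_wpM2r.
  by rewrite (le_trans (ler_normB _ _))// lerD// normrZ ler_wpM2r.
have Kw0 : 0 <= Kw by exact: le_trans hw.
pose q := - (m * bform SU (u' *m h) (u' *m h)).
have uu : bform (intmx SU) (intmx u) (intmx u) = - 2 * N * q%:~R.
  rewrite bform_intmx /u !bformE /q; set X := bform _ _ _.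
  have -> : ((m * (m * X))%:~R : R) = m%:~R * (m%:~R * X%:~R) by rewrite !intrM.
  have -> : ((- (m * X))%:~R : R) = - (m%:~R * X%:~R) by rewrite intrN intrM.
  by rewrite mN; ring.
have E : intmx (f + u *m W + q *: e) = (1 : R) *: fR + intmx u *m WR + q%:~R *: eR.
  by rewrite scale1r !map_mxD (map_mxM _ u W) (map_mxZ _ q e).
exists (f + u *m W + q *: e), a; split.
- apply: (intr_inj (R := R)); rewrite -bform_intmx E bform_split uu; ring.
- by rewrite ger0_norm ?(le_trans (ltW l0))// (le_trans _ al)// /l; have := ler_norm T; lra.
have wy : bform (intmx SU) w y = 0 by rewrite /w !bformE yy xy -/a; ring.
have wx : bform (intmx SU) w xU = 0 by rewrite /w !bformE SU_xU yx -/be; ring.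
have uE : intmx u = a *: xU + be *: y + w.
  by rewrite /w; apply/rowP => i; rewrite !mxE; ring.
clearbody w.
have uu' : bform (intmx SU) (intmx u) (intmx u) = 2 * a * be + bform (intmx SU) w w.
  rewrite [in LHS]uE !bformE SU_xU yy xy yx wy wx.
  by rewrite (bformC xU w SUR) (bformC y w SUR) wy wx; ring.
(* The error b(u, xU) - b is multiplied by a, which grows like l. The flow has made that error of
   order 1 / l, so the product stays bounded. *)
have hq : `|q%:~R - a * c| <= Kq.
  have -> : q%:~R - a * c = - (a * (be - b) + bform (intmx SU) w w / 2) / N.
    have : - 2 * N * q%:~R = 2 * a * be + bform (intmx SU) w w by rewrite -uu -uu'.
    rewrite /b; set Z := q%:~R; set V := bform _ w w; set c' := c => hZ.
    have -> : V = - 2 * N * Z - 2 * a * be by rewrite hZ; ring.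
    by field; exact: N0.
  rewrite normrM normrN normfV ler_wpM2r ?invr_ge0// (le_trans (ler_normD _ _))// lerD//.
    rewrite normrM (le_trans (ler_pM _ _ aK hb'))//.
    by rewrite mulrACA divff// mulr1.
  rewrite normrM (ger0_norm (_ : 0 <= 2^-1))// ler_wpM2r//.
  by rewrite (le_trans (bform_norm _ _ _))// ler_pM// ?mulr_ge0// ler_wpM2l.
rewrite E scale1r {1}degenerate_dec.
have -> : fR + intmx u *m WR + q%:~R *: eR - a *: (c *: eR + xU *m WR) =
    fR + (be *: y + w) *m WR + (q%:~R - a * c) *: eR.
  have -> : be *: y + w = intmx u - a *: xU by rewrite uE; apply/rowP => i; rewrite !mxE; ring.
  rewrite mulmxBl -scalemxAl; apply/rowP => i; rewrite !mxE; ring.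
rewrite (le_trans (ler_normD _ _))// lerD//; last by rewrite normrZ ler_wpM2r.
rewrite (le_trans (ler_normD _ _))// lerD//.
rewrite (le_trans (mulmx_norm_le _ _))// ler_wpM2r// ler_wpM2l//.
rewrite (le_trans (ler_normD _ _))// lerD// normrZ ler_wpM2r//.
have -> : be = b + (be - b) by rewrite addrC subrK.
by rewrite (le_trans (ler_normD _ _))// lerD2l.
Qed.

End Degenerate.

Theorem isotropic_approximable n (S : 'M[int]_n) (v0 : 'rV[int]_n) (x : 'rV[R]_n) :
  S^T = S -> \det S != 0 -> v0 != 0 -> bform S v0 v0 = 0 ->
  x != 0 -> bform (intmx S) x x = 0 -> approximable S x.
Proof.
elim/ltn_ind: n => -[|[|k]] IH in S v0 x *.
- by move=> _ _ /eqP[]; apply/rowP => -[].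
- move=> _ dS v00; rewrite bform_sum !big_ord1 => /eqP.
  have S00 : S 0 0 != 0 by rewrite -det_mx11.
  rewrite !mulf_eq0 (negPf S00) orbF orbb.
  move=> /eqP h; case/eqP: v00; apply/rowP => i; rewrite ord1 mxE; exact: h.
move=> sS dS v00 vv0 x0 xx.
have [[e e0 [ee ex]]|H] := pselect (exists2 e : 'rV[int]_k.+2, e != 0 &
    bform S e e = 0 /\ bform (intmx S) (intmx e) x = 0); last first.
  apply: (approximable_regular sS dS v00 vv0 x0 xx) => v vn0 vv.
  by apply/negP => /eqP h; apply: H; exists v.
have sSR' : (intmx S : 'M[R]_k.+2)^T = intmx S by rewrite map_trmx sS.
have [f ff ef] := isotropic_partner sS dS (isT : (2 : int) != 0) e0 ee.
have [W [M wW]] := int_witt_split R sS ee ff ef.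
have xe : bform (intmx S) x (intmx e) = 0 by rewrite (bformC _ _ sSR').
have xd := degenerate_dec wW xe.
(* Here x spans the rational line of e, and multiples of e approximate it with error 0. *)
have [xU0|xU0] := eqVneq (x *m M) 0.
  move: xd; rewrite xU0 mul0mx addr0; set c := _ / _ => xd.
  have c0 : c != 0 by apply: contraNneq x0 => c0; rewrite xd c0 scale0r.
  exists 0 => T; pose j := Num.bound `|T * c|.
  exists (j%:Z *: e), (j%:R / c); split.
  - by rewrite !bformE ee !mulr0.
  - rewrite normrM normfV ler_pdivlMr ?normr_gt0//.
    rewrite (le_trans (ler_wpM2r (normr_ge0 c) (ler_norm T)))// -normrM.
    by rewrite (ger0_norm (ler0n _ _)) ltW// archi_boundP.
  - by rewrite [in X in _ - X]xd scalerA divfK// map_mxZ /= subrr normr0.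
have sSU := SU_sym (W := W) sS.
(* The induction hypothesis demands an integral isotropic vector in the quotient; without one the
   quotient is anisotropic over the integers. *)
have [[u u0 uu]|H] := pselect (exists2 u : 'rV[int]_k, u != 0 & bform (W *m S *m W^T) u u = 0).
  apply: (approximable_isotropic_quotient sS wW xe).
  apply: (IH k _ _ u) => //.
  - exact: SU_det dS wW.
  - by apply: SU_xU xe; eassumption.
apply: (approximable_anisotropic_quotient sS dS wW xx xe xU0 ff ef) => u uu.
by apply/eqP; apply/negPn/negP => u0; apply: H; exists u.
Qed.

End Dirichlet.

(** * Trees of cubes *)

Lemma uniq_flatten_disjoint (T T' : eqType) (f : T -> seq T') (s : seq T) :
  uniq s -> (forall c, c \in s -> uniq (f c)) ->
  (forall c c' x, c \in s -> c' \in s -> x \in f c -> x \in f c' -> c = c') ->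
  uniq (flatten [seq f c | c <- s]).
Proof.
elim: s => //= c s IH /andP[cs us] uf dis; rewrite cat_uniq uf ?mem_head// IH//; last 2 first.
- by move=> d ds; apply: uf; rewrite inE ds orbT.
- by move=> d d' x ds d's; apply: dis; rewrite inE ?ds ?d's orbT.
rewrite andbT /=; apply/hasPn => x /flattenP[_ /mapP[d ds ->] xd].
apply/negP => xc; move: cs; rewrite (dis c d x) ?mem_head ?ds//.
by rewrite inE ds orbT.
Qed.

Section Tree.
Context {R : realType} {T : eqType}.
Variables (ch : nat -> T -> seq T) (m : nat).
Hypothesis m_gt0 : (0 < m)%N.
Hypothesis size_ch : forall n q, size (ch n q) = m.
Hypothesis uniq_ch : forall n q, uniq (ch n q).
Hypothesis disj_ch : forall n q q' c, c \in ch n q -> c \in ch n q' -> q = q'.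

(* The probability that a random descent of l steps from the node q of level n ends in bad. *)
Fixpoint hit_prob (bad : pred T) (l n : nat) (q : T) : R :=
  if l is l'.+1 then (\sum_(c <- ch n q) hit_prob bad l' n.+1 c) / m%:R
  else (bad q)%:R.

Fixpoint descendants (l n : nat) (q : T) : seq T :=
  if l is l'.+1 then flatten [seq descendants l' n.+1 c | c <- ch n q] else [:: q].

Lemma mR0 : (m%:R : R) != 0.
Proof. by rewrite pnatr_eq0 -lt0n. Qed.

Lemma hit_probE bad l n q :
  hit_prob bad l n q = (count bad (descendants l n q))%:R / m%:R ^+ l.
Proof.
elim: l n q => [|l IH] n q /=; first by rewrite addn0 divr1.
rewrite (eq_bigr _ (fun c _ => IH n.+1 c)) -mulr_suml.
by rewrite count_flatten -map_comp sumnE big_map natr_sum exprSr invfM mulrA.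
Qed.

Lemma descendants_inj l n q q' x :
  x \in descendants l n q -> x \in descendants l n q' -> q = q'.
Proof.
elim: l n q q' => [|l IH] n q q' /=; first by rewrite !inE => /eqP <- /eqP.
move=> /flattenP[_ /mapP[c cq ->] xc] /flattenP[_ /mapP[c' cq' ->] xc'].
by have cc := IH _ _ _ xc xc'; rewrite -cc in cq'; exact: disj_ch cq cq'.
Qed.

Lemma descendants_uniq l n q : uniq (descendants l n q).
Proof.
elim: l n q => [//|l IH] n q /=; apply: uniq_flatten_disjoint => //.
by move=> c c' x _ _; exact: descendants_inj.
Qed.

Lemma hit_prob_ge0 bad l n q : 0 <= hit_prob bad l n q.
Proof. by rewrite hit_probE divr_ge0. Qed.

Variables (bad : nat -> pred T) (lvl : nat -> nat).

(** Bad events at levels above the current node count as 0: a descent that reached level n has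
    already passed them. *)
Let V n q j : \bar R :=
  (if (n <= lvl j)%N then hit_prob (bad j) (lvl j - n) n q else 0)%:E.

Let V0 n q j : (0 <= V n q j)%E.
Proof. by rewrite /V; case: ifP => _; rewrite lee_fin// hit_prob_ge0. Qed.

Let w n q : \bar R := (\sum_(0 <= j <oo) V n q j)%E.

Let w_bad n q j : (w n q < 1)%E -> lvl j = n -> ~~ bad j q.
Proof.
move=> wq lj; apply/negP => bq; move: wq; apply/negP; rewrite -leNgt.
apply: (@le_trans _ _ (\sum_(0 <= i < j.+1) V n q i)%E); last exact: nneseries_lim_ge.
rewrite big_nat_recr//= {2}/V lj leqnn subnn /= bq; apply: leeDr.
exact: sume_ge0.
Qed.

(** Each term of deeper level is the mean of its values at the m children, so w cannot be at least 1
    at all of them. *)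
Let w_child n q : (w n q < 1)%E -> exists2 c, c \in ch n q & (w n.+1 c < 1)%E.
Proof.
move=> wq; have [//|H] := pselect (exists2 c, c \in ch n q & (w n.+1 c < 1)%E).
exfalso; have hc c : c \in ch n q -> (1 <= w n.+1 c)%E.
  by move=> cq; rewrite leNgt; apply/negP => wc; apply: H; exists c.
have : (m%:R%:E <= \sum_(c <- ch n q) w n.+1 c)%E.
  rewrite -(size_ch n q) -sum1_size natr_sum -sumEFin.
  by rewrite !big_seq; apply: lee_sum => c cq; exact: hc.
apply/negP; rewrite -ltNge /w -nneseries_sum//.
apply: (@le_lt_trans _ _ (\sum_(0 <= j <oo) (m%:R%:E * V n q j))%E).
  apply: lee_nneseries => [j _ _|j _]; first exact: sume_ge0.
  rewrite /V; have [nj|nj] := ltnP n (lvl j); last first.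
    rewrite big1//.
    by rewrite mule_ge0// ?lee_fin//; case: ifP => _; rewrite ?lee_fin// hit_prob_ge0.
  rewrite (ltnW nj) -(subnSK nj) /= sumEFin -EFinM mulrC divfK//; exact: mR0.
rewrite nneseriesZl// -[ltRHS]mule1 lte_pmul2l// lte_fin ltr0n.
by [].
Qed.

Lemma tree_avoid (q0 : T) : (w 0%N q0 < 1)%E ->
  exists q : nat -> T, [/\ q 0%N = q0, forall n, q n.+1 \in ch n (q n) &
    forall j, ~~ bad j (q (lvl j))].
Proof.
move=> w0; have /choice[nx hnx] (nq : nat * T) : exists c, (w nq.1 nq.2 < 1)%E ->
    c \in ch nq.1 nq.2 /\ (w nq.1.+1 c < 1)%E.
  have [wq|wq] := pselect (w nq.1 nq.2 < 1)%E; last by exists nq.2.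
  by have [c c1 c2] := w_child wq; exists c.
pose q := fix q n := if n is n'.+1 then nx (n', q n') else q0.
have wn n : (w n (q n) < 1)%E by elim: n => //= n IH; have [] := hnx (n, q n) IH.
exists q; split => // [n|j]; first by have [] := hnx (n, q n) (wn n).
exact: w_bad (wn _) erefl.
Qed.

(** Among the m^(lvl j) equally likely descendants at most K are bad, whichever children the tree
    has kept. *)
Lemma tree_avoid_count (K : nat) (q0 : T) :
  (forall j s, uniq s -> (count (bad j) s <= K)%N) ->
  (\sum_(0 <= j <oo) (K%:R / m%:R ^+ lvl j)%:E < 1 :> \bar R)%E ->
  exists q : nat -> T, [/\ q 0%N = q0, forall n, q n.+1 \in ch n (q n) &
    forall j, ~~ bad j (q (lvl j))].
Proof.
move=> hK h; apply: tree_avoid; apply: le_lt_trans h; apply: lee_nneseries => // j _.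
rewrite /V leq0n subn0 hit_probE lee_fin ler_wpM2r ?invr_ge0 ?exprn_ge0//.
by rewrite ler_nat hK// descendants_uniq.
Qed.

End Tree.

(** * Cubes of base N: labels and counting *)

Section Cubes.
Context {k N : nat}.

(** A label q of level n stands for the cube with lower corner q / N^n, and c lists the next base N
    digits. *)
Definition child (q : {ffun 'I_k -> nat}) (c : {ffun 'I_k -> 'I_N}) : {ffun 'I_k -> nat} :=
  [ffun l => (N * q l + c l)%N].

Lemma child_inj q q' c c' : child q c = child q' c' -> q = q' /\ c = c'.
Proof.
move=> /ffunP h; have E l : q l = q' l /\ c l = c' l :> nat.
  have := h l; rewrite !ffunE => e; have N0 : (0 < N)%N := leq_ltn_trans (leq0n _) (ltn_ord (c l)).
  have e1 := congr1 (fun x => x %/ N)%N e; rewrite ![(N * _)%N]mulnC !divnMDl// in e1.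
  rewrite !divn_small// !addn0 in e1; split => //.
  by move: e; rewrite e1 => /addnI.
by split; apply/ffunP => l; [have [] := E l|apply/val_inj; have [] := E l].
Qed.

(** Labels within 2 of x in every coordinate differ by at most 4, so reduction modulo 5 is injective
    on them. *)
Lemma count_near_le (R : realType) (x : 'I_k -> R) (s : seq {ffun 'I_k -> nat}) :
  uniq s -> (count (fun q : {ffun 'I_k -> nat} => [forall l, (`|(q l)%:R - x l| <= 2)%R]) s <= 5 ^ k)%N.
Proof.
move=> us; rewrite -size_filter; set t := [seq q <- s | _].
pose h (q : {ffun 'I_k -> nat}) : {ffun 'I_k -> 'I_5} := [ffun l => inord (q l %% 5)].
have ut : uniq [seq h q | q <- t].
  rewrite map_inj_in_uniq ?filter_uniq// => q q'.
  rewrite !mem_filter => /andP[/forallP hq _] /andP[/forallP hq' _] /ffunP e.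
  apply/ffunP => l; have := e l; rewrite !ffunE => /(congr1 val) /=.
  rewrite !inordK ?ltn_mod// => {}e.
  have h1 : (q l <= q' l + 4)%N.
    rewrite -(ler_nat R) natrD; have := hq l; have := hq' l; rewrite !ler_norml; lra.
  have h2 : (q' l <= q l + 4)%N.
    rewrite -(ler_nat R) natrD; have := hq l; have := hq' l; rewrite !ler_norml; lra.
  by move: e h1 h2; set a := q l; set b := q' l; lia.
rewrite -(size_map h) -(card_uniqP ut) (leq_trans (max_card _))//.
by rewrite card_ffun !card_ord.
Qed.

(** Once the other digits are fixed, two values of the digit l0 in the slab differ by at most 2 (k +
    1), so its residue modulo 2k + 3 determines it. *)
Lemma slab_count (R : realType) (a : 'I_k -> R) (b : R) (l0 : 'I_k) : `|a l0| = 1 ->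
  (#|[set c : {ffun 'I_k -> 'I_N} | (`|(\sum_l a l * (c l)%:R) - b| <= k.+1%:R)%R]%SET|
   <= (k.*2).+3 * N ^ k.-1)%N.
Proof.
move=> a1; pose I := {l : 'I_k | l != l0}.
pose h (c : {ffun 'I_k -> 'I_N}) : {ffun I -> 'I_N} * 'I_(k.*2).+3 :=
  ([ffun l => c (val l)], inord (c l0 %% (k.*2).+3)).
rewrite -(@card_in_imset _ _ h).
  apply: leq_trans (max_card _) _; rewrite card_prod card_ffun !card_ord card_sig.
  by rewrite cardC1 card_ord mulnC.
move=> c c'; rewrite !inE => hc hc' [/ffunP e1 e2].
have e l : l != l0 -> c l = c' l by move=> ll; have := e1 (exist _ l ll); rewrite !ffunE.
suff e0 : c l0 = c' l0.
  by apply/ffunP => l; have [->|/e] := eqVneq l l0.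
apply/val_inj; move: e2 => /(congr1 val) /=; rewrite !inordK ?ltn_mod// => e2.
have : `|a l0 * ((c l0)%:R - (c' l0)%:R)| <= k.+1%:R + k.+1%:R.
  have -> : a l0 * ((c l0)%:R - (c' l0)%:R) =
      (\sum_l a l * (c l)%:R - b) - (\sum_l a l * (c' l)%:R - b).
    rewrite opprB addrA subrK -sumrB (bigD1 l0)//= mulrBr big1 ?addr0// => l ll.
    by rewrite e// subrr.
  by rewrite (le_trans (ler_normB _ _))// lerD.
rewrite normrM a1 mul1r ler_norml => /andP[h1 h2].
have h3 : (c l0 <= c' l0 + (k.+1 + k.+1))%N by rewrite -(ler_nat R) !natrD; lra.
have h4 : (c' l0 <= c l0 + (k.+1 + k.+1))%N by rewrite -(ler_nat R) !natrD; lra.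
have E x y : (y <= x)%N -> (x <= y + (k.+1 + k.+1))%N ->
    (x %% k.*2.+3 = y %% k.*2.+3)%N -> x = y.
  move=> yx xy /eqP; rewrite eqn_mod_dvd// /dvdn modn_small => [/eqP|]; lia.
by have [cc|/ltnW cc] := leqP (c' l0) (c l0); [exact: E|apply/esym/E].
Qed.

End Cubes.

(** * Hausdorff measure *)

Section Cantor.
Context {R : realType}.

Definition in_cube k (N n : nat) (q : {ffun 'I_k -> nat}) (u : 'rV[R]_k) :=
  forall l, (q l)%:R <= N%:R ^+ n * u 0 l <= (q l).+1%:R.

Lemma nested_cubes k (N : nat) (q : nat -> {ffun 'I_k -> nat}) : (0 < N)%N ->
  (forall n, exists c : {ffun 'I_k -> 'I_N}, q n.+1 = child (q n) c) ->
  exists u, forall n, in_cube N n (q n) u.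
Proof.
move=> N0 hq; have NR n : 0 < (N%:R : R) ^+ n by rewrite exprn_gt0// ltr0n.
pose lo l n : R := (q n l)%:R / N%:R ^+ n; pose hi l n : R := (q n l).+1%:R / N%:R ^+ n.
have lohi l n : lo l n <= lo l n.+1 /\ hi l n.+1 <= hi l n.
  have [c hc] := hq n; rewrite /lo /hi hc !ffunE exprS invfM.
  have NN : (N%:R : R) != 0 by rewrite pnatr_eq0 -lt0n.
  rewrite !mulrA; split; rewrite ler_wpM2r ?invr_ge0 ?(ltW (NR n))//.
    by rewrite ler_pdivlMr ?ltr0n// -natrM ler_nat mulnC leq_addr.
  by rewrite ler_pdivrMr ?ltr0n// -natrM ler_nat; have := ltn_ord (c l); nia.
have lo_mono l n p : lo l n <= lo l (n + p)%N.
  elim: p => [|p IH]; first by rewrite addn0.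
  by rewrite addnS (le_trans IH)//; have [] := lohi l (n + p)%N.
have hi_mono l n p : hi l (n + p)%N <= hi l n.
  elim: p => [|p IH]; first by rewrite addn0.
  by rewrite addnS (le_trans _ IH)//; have [] := lohi l (n + p)%N.
have lh l n : lo l n <= hi l n.
  by rewrite ler_wpM2r ?invr_ge0 ?(ltW (NR n))// ler_nat.
have lo_hi l n p : lo l n <= hi l p.
  by rewrite (le_trans (lo_mono l n p))// (le_trans (lh _ _))// addnC.
pose A l : set R := range (lo l).
exists (\row_l sup (A l)) => n l; rewrite mxE.
have hA : has_sup (A l).
  split; first by exists (lo l 0%N), 0%N.
  by exists (hi l 0%N) => _ [p _ <-]; exact: lo_hi.
rewrite [_ * sup _]mulrC; apply/andP; split.
  by rewrite -ler_pdivrMr ?NR//; apply: sup_ubound; [case: hA|exists n].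
rewrite -ler_pdivlMr ?NR//; apply: ge_sup; first by case: hA.
by move=> _ [p _ <-]; exact: lo_hi.
Qed.

Lemma inv_exp_lt (x : R) (p : nat) : (2 <= p)%N -> 0 < x -> exists n, (p%:R ^+ n)^-1 < x.
Proof.
move=> p2 x0; exists (Num.bound x^-1).
rewrite -[ltRHS]invrK ltf_pV2 ?posrE ?invr_gt0// ?exprn_gt0 ?ltr0n ?(leq_trans _ p2)//.
have x1 : 0 <= x^-1 by rewrite invr_ge0 ltW.
rewrite (lt_le_trans (archi_boundP x1))//.
by rewrite -natrX ler_nat; exact: ltnW (ltn_expl _ p2).
Qed.

(** Translates diam^s into the probability 1 / m^n of a cube of comparable side: m >= N^s gives m^-n
    <= N^s (N^-(n+1))^s. The slack [eta] serves D = 0, where no level is the last one. *)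
Lemma cube_scale (N m : nat) (s D eta : R) : (2 <= N)%N -> (2 <= m)%N -> 0 <= s ->
  N%:R `^ s <= m%:R -> 0 <= D <= 1 -> 0 < eta ->
  exists n, D <= (N%:R ^+ n)^-1 /\ (m%:R ^+ n)^-1 <= N%:R `^ s * D `^ s + eta.
Proof.
move=> N2 m2 s0 Nm /andP[D0 D1] eta0.
have NR n : 0 < (N%:R : R) ^+ n by rewrite exprn_gt0// ltr0n (leq_trans _ N2).
have mR n : 0 < (m%:R : R) ^+ n by rewrite exprn_gt0// ltr0n (leq_trans _ m2).
have [->|Dn0] := eqVneq D 0.
  have [n hn] := inv_exp_lt m2 eta0; exists n; split; first by rewrite invr_ge0 ltW.
  by rewrite (le_trans (ltW hn))// lerDr mulr_ge0// powR_ge0.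
have {}D0 : 0 < D by rewrite lt_def Dn0.
have ex : exists n, (N%:R ^+ n.+1)^-1 < D.
  have [n hn] := inv_exp_lt N2 D0; exists n; rewrite (le_lt_trans _ hn)//.
  rewrite lef_pV2 ?posrE// exprS ler_peMl ?(ltW (NR n))// ler1n.
  by rewrite (leq_trans _ N2).
(* The least n with N^-(n+1) < D still satisfies D <= N^-n; for n = 0 this is the hypothesis D <=
   1. *)
case: (ex_minnP ex) => n hn nmin; exists n; split.
  case: n hn nmin => [|n] hn nmin; first by rewrite expr0 invr1.
  by rewrite leNgt; apply/negP => /nmin; rewrite ltnn.
rewrite (@le_trans _ _ (N%:R `^ s * D `^ s))//; last by rewrite lerDl ltW.
apply: (@le_trans _ _ (N%:R `^ s * (N%:R ^+ n.+1)^-1 `^ s)); last first.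
  rewrite ler_wpM2l ?powR_ge0// ge0_ler_powR ?nnegrE ?invr_ge0 ?(ltW (NR _)) ?(ltW D0)//.
  exact: ltW.
rewrite -powRM ?invr_ge0 ?(ltW (NR _))//.
have -> : N%:R * (N%:R ^+ n.+1)^-1 = ((N%:R : R) ^+ n)^-1.
  by rewrite exprS invfM mulrA divff ?mul1r// pnatr_eq0 -lt0n (leq_trans _ N2).
have Ns : 0 < N%:R `^ s :> R by rewrite powR_gt0// ltr0n (leq_trans _ N2).
have -> : (N%:R ^+ n)^-1 `^ s = ((N%:R `^ s) ^+ n)^-1 :> R.
  elim: n {hn nmin} => [|n IH]; first by rewrite !expr0 !invr1 powR1.
  rewrite !exprS !invfM powRM ?invr_ge0 ?(ltW (NR _)) ?ler0n// IH; congr (_ * _).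
  by rewrite -(powR_inv1 (ler0n R N)) -powRrM mulN1r powRN.
by rewrite lef_pV2 ?posrE// ?exprn_gt0// lerXn2r ?nnegrE ?(ltW Ns).
Qed.

(** For N large against 2k + 3 at least half of the N^k children remain, and N^k / 2 >= N^s as soon
    as N^(k - s) >= 2; x solves x^(k - s) = 2. *)
Lemma big_base (k : nat) (s : R) : (0 < k)%N -> 0 <= s < k%:R ->
  exists N, [/\ (2 <= N)%N, (2 <= N ^ k - k.*2.+3 * N ^ k.-1)%N &
    N%:R `^ s <= (N ^ k - k.*2.+3 * N ^ k.-1)%N%:R].
Proof.
move=> k0 /andP[s0 sk]; have e0 : 0 < k%:R - s by rewrite subr_gt0.
pose x : R := 2 `^ (k%:R - s)^-1; have x0 : 0 <= x by exact: powR_ge0.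
pose N := (Num.bound x + 2 * k.*2.+3)%N; exists N.
have N2 : (2 * k.*2.+3 <= N)%N by rewrite leq_addl.
have Nk : (N ^ k = N * N ^ k.-1)%N by rewrite -expnS prednK.
have NP : (0 < N ^ k.-1)%N by rewrite expn_gt0; apply/orP; left; lia.
have half : (N ^ k <= 2 * (N ^ k - k.*2.+3 * N ^ k.-1))%N.
  by rewrite Nk -mulnBl mulnA leq_mul2r; apply/orP; right; lia.
split.
- lia.
- rewrite Nk -mulnBl (@leq_trans (2 * 1))//.
  by apply: leq_mul => //; lia.
have NR : 0 < N%:R :> R by rewrite ltr0n; lia.
have xN : x <= N%:R.
  by rewrite (le_trans (ltW (archi_boundP x0)))// ler_nat leq_addr.
have h2 : 2 <= N%:R `^ (k%:R - s).
  have <- : x `^ (k%:R - s) = 2 by rewrite -powRrM mulVf ?lt0r_neq0// powRr1.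
  by rewrite ge0_ler_powR ?nnegrE// ltW.
have h3 : 2 * N%:R `^ s <= N%:R `^ k%:R.
  have -> : N%:R `^ k%:R = N%:R `^ (k%:R - s) * N%:R `^ s :> R.
    by rewrite -powRD ?subrK// lt0r_neq0 ?implybT.
  by rewrite ler_wpM2r// powR_ge0.
rewrite -(@ler_pM2l _ 2)// (le_trans h3)// powR_mulrn ?ler0n//.
by rewrite -natrX -natrM ler_nat.
Qed.

End Cantor.

(** * Criteria for nonzero and for zero Hausdorff measure *)

Section HausdorffBounds.
Context {R : realType} {X : Type} (dist : X -> X -> R).
Hypothesis dist_ge0 : forall x y, 0 <= dist x y.

Lemma diam_ge (A : set X) x y : A x -> A y -> ((dist x y)%:E <= diam dist A)%E.
Proof. by move=> Ax Ay; apply: ereal_sup_ubound; exists (x, y). Qed.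

Lemma diam_pow_ge0 s (A : set X) : (0 <= diam_pow dist s A)%E.
Proof. by rewrite /diam_pow; case: pselect => // A0; exact: poweR_ge0. Qed.

Lemma diam_pow_le s (A : set X) (r : R) : 0 <= s -> 0 <= r ->
  (forall x y, A x -> A y -> dist x y <= r) -> (diam_pow dist s A <= (r `^ s)%:E)%E.
Proof.
move=> s0 r0 h; rewrite /diam_pow; case: pselect => A0; first by rewrite lee_fin powR_ge0.
have /eqP/set0P[x Ax] := A0.
have h1 : (diam dist A <= r%:E)%E.
  by apply: ge_ereal_sup => _ [[y z] [/= Ay Az] <-]; rewrite lee_fin h.
have h2 : (0 <= diam dist A)%E by rewrite (le_trans _ (diam_ge Ax Ax))// lee_fin.
by rewrite -poweR_EFin gt0_ler_poweR// in_itv /= ?lee_fin ?h2 ?r0 leey.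
Qed.

Lemma hausdorff_premeasure_ge0 s delta A : (0 <= hausdorff_premeasure dist s delta A)%E.
Proof.
apply: le_ereal_inf_tmp => _ [U _ <-].
by apply: nneseries_ge0 => n _ _; exact: diam_pow_ge0.
Qed.

Lemma hausdorff_measure_ge0 s A : (0 <= hausdorff_measure dist s A)%E.
Proof.
apply: le_trans (hausdorff_premeasure_ge0 s 1 A) _.
by apply: ereal_sup_ubound; exists 1 => //=.
Qed.

Lemma hausdorff_measure_eq0_cover s A : hausdorff_measure dist s A = 0 ->
  forall delta eta : R, 0 < delta -> 0 < eta -> exists U : nat -> set X,
  [/\ A `<=` \bigcup_j U j, forall j, (diam dist (U j) <= delta%:E)%E &
     (\sum_(0 <= j <oo) diam_pow dist s (U j) < eta%:E)%E].
Proof.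
move=> hA delta eta d0 e0; have : (hausdorff_premeasure dist s delta A < eta%:E)%E.
  apply: (@le_lt_trans _ _ 0%E); last by rewrite lte_fin.
  by rewrite -hA; apply: ereal_sup_ubound; exists delta.
by move=> /ereal_inf_lt[_ [U [AU dU] <-] h]; exists U.
Qed.

Lemma hausdorff_measure_set0 s : hausdorff_measure dist s set0 = 0.
Proof.
apply/le_anti; rewrite hausdorff_measure_ge0 andbT.
apply: ge_ereal_sup => _ [delta /= d0 <-].
apply: ereal_inf_lbound; exists (fun=> set0); last first.
  by rewrite eseries0// => j _ _; rewrite /diam_pow; case: pselect.
by split => // j; apply: ge_ereal_sup => _ [z [[]]].
Qed.

Lemma hausdorff_measure_mono s A B : A `<=` B ->
  (hausdorff_measure dist s A <= hausdorff_measure dist s B)%E.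
Proof.
move=> AB; apply: ge_ereal_sup => _ [delta /= d0 <-].
apply: (@le_trans _ _ (hausdorff_premeasure dist s delta B)); last first.
  by apply: ereal_sup_ubound; exists delta.
apply: le_ereal_inf => _ [U [BU dU] <-]; exists U => //; split => //.
exact: subset_trans BU.
Qed.

(* Each cube has at least N^s children missing the slab of the hyperplane a . u = b attached to it, so the cubes meeting a cover of small total diam^s cannot exhaust this tree. *)
Lemma hausdorff_measure_neq0 (k : nat) (B : set X) (Phi : 'rV[R]_k -> X) (C s : R) :
  (0 < k)%N -> 0 < C ->
  (forall u u' : 'rV[R]_k, (forall l, 0 <= u 0 l <= 1) -> (forall l, 0 <= u' 0 l <= 1) ->
     `|u - u'| <= C * dist (Phi u) (Phi u')) ->
  (forall N, (2 <= N)%N -> exists (a : nat -> {ffun 'I_k -> nat} -> 'I_k -> R)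
     (b : nat -> {ffun 'I_k -> nat} -> R),
     (forall n q, (exists l0, `|a n q l0| = 1) /\ forall l, `|a n q l| <= 1) /\
     forall (u : 'rV[R]_k) q, q 0%N = [ffun=> 0%N] -> (forall n, in_cube N n (q n) u) ->
       (forall n, (N%:R ^+ n.+1)^-1 < `|\sum_l a n (q n) l * u 0 l - b n (q n)|) ->
       B (Phi u)) ->
  0 <= s < k%:R -> hausdorff_measure dist s B != 0.
Proof.
move=> k0 C0 hPhi hB sk; apply/eqP => HB; have /andP[s0 _] := sk.
have [N [N2 m2 Nm]] := big_base k0 sk; set m := (_ - _)%N in m2 Nm.
have [a [b [hab hu]]] := hB N N2.
have NR n : 0 < (N%:R : R) ^+ n by rewrite exprn_gt0// ltr0n (leq_trans _ N2).
(* The hyperplane a . u = b in the digit coordinates of the cube q, scaled by N^(n+1). *)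
pose b' n (q : {ffun 'I_k -> nat}) := N%:R ^+ n.+1 * b n q - \sum_l a n q l * (N * q l)%:R.
pose G n (q : {ffun 'I_k -> nat}) : {set {ffun 'I_k -> 'I_N}} :=
  ~: [set c : {ffun 'I_k -> 'I_N} | (`|(\sum_l a n q l * (c l)%:R) - b' n q| <= k.+1%:R)%R].
have mG n q : (m <= #|G n q|)%N.
  rewrite cardsCs finset.setCK card_ffun !card_ord leq_sub2l//.
  by have [[l0 al0] _] := hab n q; exact: slab_count al0.
(* Exactly m good children are kept, since the tree argument wants a regular tree. *)
pose ch n q := [seq child q c | c <- take m (enum (G n q))].
have chP n q c' : c' \in ch n q -> exists2 c, c \in G n q & c' = child q c.
  by move=> /mapP[c /mem_take]; rewrite mem_enum => cG ->; exists c.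
have size_ch n q : size (ch n q) = m.
  rewrite size_map size_take -cardE; case: ltnP => // h.
  by apply/eqP; rewrite eqn_leq h mG.
have uniq_ch n q : uniq (ch n q).
  rewrite map_inj_uniq ?take_uniq ?enum_uniq// => c c' /child_inj[] //.
have disj_ch n q q' c : c \in ch n q -> c \in ch n q' -> q = q'.
  by move=> /chP[d _ ->] /chP[d' _ /child_inj[]].
pose Ns : R := N%:R `^ s; have Ns0 : 0 <= Ns by exact: powR_ge0.
pose Cs : R := C `^ s; have Cs0 : 0 <= Cs by exact: powR_ge0.
pose K : R := (5 ^ k)%:R; have K0 : 0 < K by rewrite ltr0n expn_gt0.
pose E : R := Ns * Cs; have E0 : 0 <= E by exact: mulr_ge0.
(* Chosen so that E eta' <= eta / 2, which bounds the total probability by K eta = 1/2. *)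
pose eta : R := (2 * K)^-1; have eta0 : 0 < eta by rewrite invr_gt0 mulr_gt0.
pose eta' : R := eta / (2 * (E + 1)).
have eta'0 : 0 < eta' by rewrite divr_gt0// mulr_gt0// ltr_wpDl.
(* Diameters at most C^-1 ensure C diam <= 1, the range of [cube_scale]. *)
have [|U [BU dU sU]] := hausdorff_measure_eq0_cover HB _ eta'0 (delta := C^-1).
  by rewrite invr_gt0.
(* To each covering set belong a level and a centre such that its parameters lie within one cube
   side of the centre. A set missing the chart gets a level deep enough to cost almost nothing. *)
have /choice[nu hnu] j : exists nu : nat * 'rV[R]_k,
    ((m%:R ^+ nu.1)^-1%:E <= E%:E * diam_pow dist s (U j) + (eta / 2 / (2 ^ j.+1)%:R)%:E)%E /\
    forall u : 'rV[R]_k, (forall l, 0 <= u 0 l <= 1) -> U j (Phi u) -> `|u - nu.2| <= (N%:R ^+ nu.1)^-1.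
  have e2 : 0 < eta / 2 / (2 ^ j.+1)%:R by rewrite !divr_gt0// ltr0n expn_gt0.
  have [[u1 hu1 Uu1]|H] := pselect (exists2 u1 : 'rV[R]_k,
      (forall l, 0 <= u1 0 l <= 1) & U j (Phi u1)); last first.
    have [n hn] := inv_exp_lt m2 e2.
    exists (n, 0); split => [|u hu1 Uu]; last by case: H; exists u.
    rewrite -[leLHS]add0e leeD ?lee_fin ?(ltW hn)//.
    by rewrite mule_ge0 ?lee_fin// diam_pow_ge0.
  have dd : (0 <= diam dist (U j))%E.
    by rewrite (le_trans _ (diam_ge Uu1 Uu1))// lee_fin.
  have dfin : diam dist (U j) \is a fin_num.
    by rewrite ge0_fin_numE// (le_lt_trans (dU j))// ltry.
  pose r := fine (diam dist (U j)); have r0 : 0 <= r by exact: fine_ge0.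
  have rE : diam dist (U j) = r%:E by rewrite /r fineK.
  have rC : r <= C^-1 by have := dU j; rewrite rE lee_fin.
  have [|n [Dn hn]] := @cube_scale R N m s (C * r) _ N2 m2 s0 Nm _ e2.
    by rewrite mulr_ge0 ?(ltW C0)//= mulrC -ler_pdivlMr// div1r.
  exists (n, u1); split => [|u hu' Uu].
    have -> : diam_pow dist s (U j) = (r `^ s)%:E.
      rewrite /diam_pow rE poweR_EFin; case: pselect => // U0.
      by have : (set0 : set X) (Phi u1) by rewrite -U0.
    rewrite -EFinM -EFinD lee_fin (le_trans hn)// lerD2r.
    by rewrite powRM ?(ltW C0)// mulrA.
  rewrite (le_trans (hPhi _ _ hu' hu1))// (le_trans _ Dn)// ler_wpM2l ?(ltW C0)//.
  by rewrite -lee_fin -rE; exact: diam_ge.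
pose bad j (q : {ffun 'I_k -> nat}) :=
  [forall l, (`|(q l)%:R - N%:R ^+ (nu j).1 * (nu j).2 0 l| <= 2)%R].
have [||q [q0 qch qbad]] := @tree_avoid_count R _ ch m (ltnW m2) size_ch uniq_ch disj_ch
    bad (fun j => (nu j).1) (5 ^ k) [ffun=> 0%N].
- by move=> j t ut; exact: count_near_le.
- apply: (@le_lt_trans _ _ (\sum_(0 <= j <oo) (K%:E * (E%:E * diam_pow dist s (U j)
      + (eta / 2 / (2 ^ j.+1)%:R)%:E)))%E).
    apply: lee_nneseries => [j _ _|j _].
      by rewrite lee_fin divr_ge0 ?exprn_ge0.
    by rewrite EFinM lee_pmul2l ?lte_fin//; have [] := hnu j.
  rewrite nneseriesZl; last first.
    move=> j _; rewrite adde_ge0 ?mule_ge0 ?lee_fin ?diam_pow_ge0//.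
    by rewrite !divr_ge0 ?(ltW eta0).
  apply: (@le_lt_trans _ _ (K%:E * (E%:E * eta'%:E + (eta / 2)%:E))%E).
    rewrite lee_pmul2l ?lte_fin//; apply: le_trans (epsilon_trick _ _ _) _.
    - by move=> j; rewrite mule_ge0 ?lee_fin ?diam_pow_ge0.
    - by rewrite divr_ge0 ?(ltW eta0).
    rewrite leeD2r// nneseriesZl; last by move=> j _; exact: diam_pow_ge0.
    by rewrite lee_wpmul2l ?lee_fin// ltW.
  have -> : (K%:E * (E%:E * eta'%:E + (eta / 2)%:E) = (K * (E * eta' + eta / 2))%:E)%E by [].
  rewrite lte_fin.
  have hE : E * eta' <= eta / 2.
    rewrite /eta' mulrCA ler_wpM2l ?(ltW eta0)//.
    rewrite ler_pdivrMr ?mulr_gt0 ?ltr_wpDl// mulrA mulVf ?pnatr_eq0// mul1r.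
    by rewrite lerDl.
  have K1 : K * (2 * eta) = 1 by rewrite /eta; field; exact: lt0r_neq0.
  rewrite -[ltRHS]K1 ltr_pM2l//; lra.
have hq n : exists c : {ffun 'I_k -> 'I_N}, q n.+1 = child (q n) c.
  by have [c _ ->] := chP _ _ _ (qch n); exists c.
have [u ucube] := @nested_cubes R k N q (ltnW N2) hq.
have u01 l : 0 <= u 0 l <= 1.
  by have := ucube 0%N l; rewrite q0 ffunE expr0 mul1r.
have Bu : B (Phi u).
  apply: (hu u q q0 ucube) => n.
  have [c cG qE] := chP _ _ _ (qch n).
  rewrite ltNge; apply/negP => h; move: cG; rewrite !inE => /negP; apply.
  have [_ a1] := hab n (q n).
  have E1 : \sum_l a n (q n) l * (c l)%:R - b' n (q n) =
      N%:R ^+ n.+1 * (\sum_l a n (q n) l * u 0 l - b n (q n))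
      - \sum_l a n (q n) l * (N%:R ^+ n.+1 * u 0 l - (q n.+1 l)%:R).
    have -> : \sum_l a n (q n) l * (N%:R ^+ n.+1 * u 0 l - (q n.+1 l)%:R) =
        N%:R ^+ n.+1 * (\sum_l a n (q n) l * u 0 l)
        - \sum_l a n (q n) l * (N * q n l)%:R - \sum_l a n (q n) l * (c l)%:R.
      rewrite mulr_sumr -!sumrB; apply: eq_bigr => l _.
      by rewrite qE ffunE natrD; ring.
    rewrite /b'; ring.
  (* The slab width k + 1 splits into 1, were u too close to the hyperplane, and k for the position
     of u inside its cube. *)
  rewrite E1 -nat1r (le_trans (ler_normB _ _))// lerD//.
    by rewrite normrM (gtr0_norm (NR _)) mulrC -ler_pdivlMr// div1r.
  rewrite (le_trans (ler_norm_sum _ _ _))//.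
  rewrite (@le_trans _ _ (\sum_(l < k) 1))//; last by rewrite sumr_const card_ord.
  apply: ler_sum => l _; rewrite normrM -[leRHS]mulr1 ler_pM//.
  have /andP[] := ucube n.+1 l; rewrite -natr1 ler_norml => ? ?.
  by apply/andP; split; lra.
have [j _ Uj] := BU _ Bu.
have [_ /(_ u u01 Uj) h] := hnu j.
move/negP: (qbad j); apply; apply/forallP => l.
have /andP[h1 h2] := ucube (nu j).1 l.
have h3 : `|N%:R ^+ (nu j).1 * (u 0 l - (nu j).2 0 l)| <= 1.
  rewrite normrM (gtr0_norm (NR _)) mulrC -ler_pdivlMr// div1r (le_trans _ h)//.
  by have := mx_coord_le (u - (nu j).2) 0 l; rewrite !mxE.
move: h1 h2 h3; rewrite -natr1 mulrBr !ler_norml => h1 h2 /andP[h3 h4].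
by apply/andP; split; lra.
Qed.

Lemma hausdorff_measure_eq0 (k P0 : nat) (A : set X) (c C s : R) : 0 <= c -> 0 < C ->
  (forall P, (P0 <= P)%N -> exists (T : finType) (U : T -> set X),
    [/\ A `<=` \bigcup_t U t, #|T|%:R <= c * P%:R ^+ k &
        forall t x y, U t x -> U t y -> dist x y <= C / P%:R]) ->
  k%:R < s -> hausdorff_measure dist s A = 0.
Proof.
move=> c0 C0 hA ks; apply/le_anti/andP; split; last exact: hausdorff_measure_ge0.
have s0 : 0 < s by exact: le_lt_trans ks.
apply: ge_ereal_sup => _ [delta /= d0 <-]; apply/lee_addgt0Pr => e e0; rewrite add0e.
pose r := s - k%:R; have r0 : 0 < r by rewrite subr_gt0.
pose b : R := c * C `^ s / e.
have b0 : 0 <= b by rewrite divr_ge0 ?(ltW e0)// mulr_ge0 ?powR_ge0.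
(* P >= y makes the total c C^s P^(k - s) at most e. *)
pose y : R := b `^ r^-1; have y0 : 0 <= y by exact: powR_ge0.
pose P := (P0 + (Num.bound (C / delta) + Num.bound y)).+1.
have [PP PC Py] : [/\ (P0 <= P)%N, (Num.bound (C / delta) <= P)%N & (Num.bound y <= P)%N].
  by rewrite /P; move: (Num.bound (C / delta)) (Num.bound y) => n1 n2; split; lia.
have PR : 0 < P%:R :> R by rewrite ltr0n.
have Cd : C / P%:R <= delta.
  rewrite ler_pdivrMr// mulrC -ler_pdivrMr//.
  rewrite (le_trans (ltW (archi_boundP _)))// ?divr_ge0 ?(ltW C0) ?(ltW d0)//.
  by rewrite ler_nat.
have yP : y <= P%:R by rewrite (le_trans (ltW (archi_boundP y0)))// ler_nat.
have bP : b <= P%:R `^ r.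
  have <- : y `^ r = b by rewrite -powRrM mulVf ?lt0r_neq0// powRr1.
  by rewrite ge0_ler_powR ?nnegrE ?(ltW r0).
have [T [U [AU cT dU]]] := hA P PP.
have CP0 : 0 <= C / P%:R by rewrite divr_ge0 ?(ltW C0).
pose U' i := if insub i : option 'I_#|T| is Some j then U (enum_val j) else set0.
have dU' i x z : U' i x -> U' i z -> dist x z <= C / P%:R.
  by rewrite /U'; case: insubP => // j _ _; exact: dU.
apply: (@le_trans _ _ (\sum_(0 <= i <oo) diam_pow dist s (U' i))%E).
  apply: ereal_inf_lbound; exists U' => //; split.
    move=> x /AU[t _ Ut]; exists (enum_rank t) => //.
    rewrite /U'; case: insubP => [j _ jt|]; last by rewrite ltn_ord.
    by rewrite (_ : j = enum_rank t) ?enum_rankK//; exact/val_inj.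
  move=> i; apply: ge_ereal_sup => _ [[x z] [/= Ux Uz] <-].
  by rewrite lee_fin (le_trans (dU' _ _ _ Ux Uz)).
rewrite (@nneseries_split _ _ 0 #|T|) => [|i _]; last exact: diam_pow_ge0.
rewrite add0n eseries0 ?adde0; last first.
  move=> i iT _; rewrite /U' insubN ?ltnNge ?iT// /diam_pow.
  by case: pselect.
apply: (@le_trans _ _ (\sum_(0 <= i < #|T|) ((C / P%:R) `^ s)%:E)%E).
  by apply: lee_sum => i _; apply: diam_pow_le; rewrite ?(ltW s0)//; exact: dU'.
rewrite sumEFin lee_fin sumr_const_nat subn0 -[leLHS]mulr_natl.
apply: (@le_trans _ _ (c * P%:R ^+ k * (C / P%:R) `^ s)).
  by rewrite ler_wpM2r// powR_ge0.
have E : c * P%:R ^+ k * (C / P%:R) `^ s = c * C `^ s / P%:R `^ r.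
  rewrite powRM ?invr_ge0 ?(ltW C0)// /r powRB ?lt0r_neq0 ?implybT//.
  rewrite powR_mulrn// -(powR_inv1 (ltW PR)) -powRrM mulN1r powRN.
  have : P%:R `^ s != 0 :> R by rewrite powR_eq0 negb_and lt0r_neq0.
  have : P%:R ^+ k != 0 :> R by rewrite expf_neq0// lt0r_neq0.
  by move=> ? ?; field; exact/andP.
by rewrite E ler_pdivrMr ?powR_gt0// [leRHS]mulrC -ler_pdivrMr.
Qed.

End HausdorffBounds.

(** * Stereographic charts of the quadric *)

Lemma bform_row_sum (F : comNzRingType) n k (S : 'M[F]_n) (z : 'rV[F]_n) (w : 'rV[F]_k)
    (W : 'M[F]_(k, n)) :
  bform S z (w *m W) = \sum_l w 0 l * bform S z (row l W).
Proof.
rewrite /bform trmx_mul mulmxA mxE; apply: eq_bigr => l _.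
rewrite [w^T _ _]mxE mulrC; congr (_ * _).
by rewrite tr_row colE mulmxA -colE [RHS]mxE.
Qed.

Section QuadricChart.
Context {R : realType} {k : nat} {S : 'M[R]_k.+2} {e f : 'rV[R]_k.+2}.
Context {W : 'M[R]_(k, k.+2)} {M : 'M[R]_(k.+2, k)}.
Hypothesis sS : S^T = S.
Hypothesis dS : \det S != 0.
Hypothesis wW : witt_split S e f W M.
Local Notation N := (bform S e f).
Local Notation F u := (bform S (u *m W) (u *m W)).

(** Inverse stereographic projection from [e]: the isotropic vector with coordinate 1 along f and
    coordinates u along W. *)
Definition qchart (u : 'rV[R]_k) : 'rV[R]_k.+2 :=
  f + u *m W - (F u / (2 * N)) *: e.

Let N0 : N != 0. Proof. exact: ws_ef wW. Qed.

Lemma ws_eW (u : 'rV[R]_k) : bform S e (u *m W) = 0.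
Proof. by rewrite (bformC _ _ sS) (ws_We wW). Qed.

Lemma ws_fW (u : 'rV[R]_k) : bform S f (u *m W) = 0.
Proof. by rewrite (bformC _ _ sS) (ws_Wf wW). Qed.

Lemma ws_fe : bform S f e = N. Proof. exact: bformC. Qed.

Definition ws_bform :=
  (ws_eW, ws_fW, ws_fe, ws_We wW, ws_Wf wW, ws_e wW, ws_f wW).

Lemma qchart_isotropic u : bform S (qchart u) (qchart u) = 0.
Proof. by rewrite /qchart !bformE !ws_bform; field. Qed.

Lemma qchart_e u : bform S (qchart u) e = N.
Proof. by rewrite /qchart !bformE !ws_bform; ring. Qed.

Lemma qchart_neq0 u : qchart u != 0.
Proof. by apply: contra_neq N0 => h; rewrite -(qchart_e u) h bform0l. Qed.

Lemma eM : e *m M = 0.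
Proof.
have h : e *m M *m W = 0.
  have := ws_dec wW e; rewrite (ws_e wW) divff// scale1r mul0r scale0r addr0.
  by move=> /eqP; rewrite -subr_eq0 opprD addNKr oppr_eq0 => /eqP.
by rewrite -[e *m M]mulmx1 -(ws_WM wW) mulmxA h mul0mx.
Qed.

Lemma fM : f *m M = 0.
Proof.
have h : f *m M *m W = 0.
  have := ws_dec wW f; rewrite (ws_f wW) ws_fe divff// scale1r mul0r scale0r add0r.
  by move=> /eqP; rewrite -subr_eq0 opprD addNKr oppr_eq0 => /eqP.
by rewrite -[f *m M]mulmx1 -(ws_WM wW) mulmxA h mul0mx.
Qed.

Lemma qchartM u : qchart u *m M = u.
Proof.
rewrite /qchart mulmxBl mulmxDl fM add0r -scalemxAl eM scaler0 subr0.
by rewrite -mulmxA (ws_WM wW) mulmx1.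
Qed.

Lemma qchart_repr x : bform S x x = 0 -> bform S x e != 0 ->
  x = (bform S x e / N) *: qchart ((N / bform S x e) *: (x *m M)).
Proof.
move=> xx xe; set p := bform S x e in xe *; set q := bform S x f.
have xE : x = (q / N) *: e + (p / N) *: f + x *m M *m W := ws_dec wW x.
have h : F (x *m M) = - 2 * p * q / N.
  have := xx; rewrite {1 2}xE !bformE !ws_bform => h.
  transitivity (F (x *m M) - 0); first by rewrite subr0.
  by rewrite -h; field.
rewrite /qchart -scalemxAl !bformE h [LHS]xE.
move: (x *m M *m W) => z; apply/rowP => i; rewrite !mxE.
by field; exact/andP.
Qed.

(** Shows that orthogonality of two isotropic vectors is a condition on the difference of their
    chart coordinates alone. *)
Lemma qchart_bform u u' : bform S (qchart u) (qchart u') = - F (u - u') / 2.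
Proof.
rewrite /qchart mulmxBl !bformE !ws_bform.
by rewrite (bformC (u' *m W) (u *m W) sS); field.
Qed.

Lemma qchart_lipschitz (r : R) : 0 <= r -> exists2 L, 0 < L & forall u u' : 'rV[R]_k,
  `|u| <= r -> `|u'| <= r -> `|qchart u - qchart u'| <= L * `|u - u'|.
Proof.
move=> r0; pose B : R := k.+2%:R ^+ 2 * `|S|.
have B0 : 0 <= B by rewrite mulr_ge0 ?sqr_ge0.
pose w : R := k%:R * `|W|; have w0 : 0 <= w by rewrite mulr_ge0.
have hw (z : 'rV[R]_k) : `|z *m W| <= w * `|z|.
  by rewrite (le_trans (mulmx_norm_le _ _))// mulrAC.
pose c : R := `|2 * N|^-1; have c0 : 0 <= c by rewrite invr_ge0.
exists (1 + w + B * w * (w * (2 * r)) * c * `|e|).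
  by rewrite -addrA ltr_pwDl// addr_ge0// !mulr_ge0.
move=> u u' ur ur'.
have FE : F u - F u' = bform S ((u - u') *m W) ((u + u') *m W).
  by rewrite mulmxBl mulmxDl !bformE (bformC (u' *m W) (u *m W) sS); ring.
have -> : qchart u - qchart u' = (u - u') *m W - ((F u - F u') / (2 * N)) *: e.
  rewrite /qchart mulmxBl; apply/rowP => i; rewrite !mxE; ring.
rewrite (le_trans (ler_normB _ _))// [leRHS]mulrDl lerD//.
  by rewrite (le_trans (hw _))// ler_wpM2r// lerDr.
rewrite normrZ mulrAC ler_wpM2r// normrM normfV -/c mulrAC ler_wpM2r//.
rewrite FE (le_trans (bform_norm _ _ _))// -/B.
have -> : B * w * (w * (2 * r)) * `|u - u'| = B * (w * `|u - u'|) * (w * (2 * r)) by ring.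
apply: ler_pM; rewrite ?mulr_ge0//; first by rewrite ler_wpM2l.
rewrite (le_trans (hw _))// ler_wpM2l// (le_trans (ler_normD _ _))//; lra.
Qed.

Lemma qchart_norm_ge : exists2 c, 0 < c & forall u, c <= `|qchart u|.
Proof.
pose B : R := k.+2%:R ^+ 2 * `|S|.
have h u : `|N| <= `|qchart u| * (B * `|e|).
  rewrite -(qchart_e u) (le_trans (bform_norm _ _ _))// -/B; lra.
have B0 : 0 < B * `|e|.
  rewrite lt_def !mulr_ge0 ?sqr_ge0// andbT; apply/eqP => h0.
  by have := h 0; rewrite h0 mulr0 normr_le0; apply/negP.
exists (`|N| / (B * `|e|)); first by rewrite divr_gt0 ?normr_gt0.
by move=> u; rewrite ler_pdivrMr.
Qed.

Lemma qchart_norm_le (r : R) : 0 <= r -> exists2 C, 0 < C & forall u : 'rV[R]_k,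
  `|u| <= r -> `|qchart u| <= C.
Proof.
move=> r0; have [L L0 hL] := qchart_lipschitz r0.
exists (L * r + `|qchart 0| + 1) => [|u ur]; first by rewrite ltr_wpDl// addr_ge0// mulr_ge0// ltW.
rewrite -[qchart u](subrK (qchart 0)) (le_trans (ler_normD _ _))//.
have := hL u 0 ur; rewrite normr0 subr0 => /(_ r0) h.
have : L * `|u| <= L * r by rewrite ler_wpM2l// ltW.
lra.
Qed.

(* By polarization the difference of two distinct points of D is orthogonal to all differences of points of D, and nondegeneracy turns it into a nonzero linear form. *)
Lemma isotropic_hyperplane (D : set 'rV[R]_k) : (0 < k)%N ->
  (forall w w', D w -> D w' -> F (w - w') = 0) ->
  exists (a : 'I_k -> R) (b : R), [/\ exists l0, `|a l0| = 1, forall l, `|a l| <= 1 &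
    forall w, D w -> \sum_l a l * w 0 l = b].
Proof.
move=> k0 hD; have [l1 _] : exists l1 : 'I_k, true by exists (Ordinal k0).
(* With fewer than two points in D, any normalised hyperplane through the point, if there is one,
   will do. *)
have [[w0 [w1 [D0 D1 w01]]]|H] := pselect (exists w0 w1, [/\ D w0, D w1 & w0 != w1]); last first.
  have [->|/set0P[w0 D0]] := eqVneq D set0.
    exists (fun=> 1), 0; split => //; first by exists l1; rewrite normr1.
    by move=> l; rewrite normr1.
  exists (fun l => (l == l1)%:R), (w0 0 l1); split.
  - by exists l1; rewrite /= eqxx normr1.
  - by move=> l /=; case: eqP => _; rewrite ?normr1 ?normr0.
  move=> w Dw; have -> : w = w0.
    by apply/eqP/negPn/negP => ww; apply: H; exists w, w0.
  rewrite (bigD1 l1)//= eqxx mul1r big1 ?addr0// => l /negPf ->; exact: mul0r.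
pose z := (w1 - w0) *m W; pose a l := bform S z (row l W).
have aE (w : 'rV[R]_k) : \sum_l a l * w 0 l = bform S z (w *m W).
  by rewrite bform_row_sum; apply: eq_bigr => l _; rewrite mulrC.
have [l0 _ l0max] := @Order.TotalTheory.arg_maxP _ _ 'I_k l1 predT (fun l => `|a l|) isT.
have a0 : 0 < `|a l0|.
  rewrite normr_gt0; apply: contraNneq w01 => al0.
  have a0 l : a l = 0.
    by apply/eqP; rewrite -normr_le0 (le_trans (l0max l _))// al0 normr0.
  have zW (w : 'rV[R]_k) : bform S z (w *m W) = 0 by rewrite -aE big1// => l _; rewrite a0 mul0r.
  have z0 : z = 0.
    apply/eqP/negPn/negP => /(bform_det_nondeg dS)[y /eqP]; apply.
    by rewrite (ws_dec wW y) !bformE zW /z !ws_bform; ring.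
  by rewrite eq_sym -subr_eq0 -[w1 - w0]mulmx1 -(ws_WM wW) mulmxA -/z z0 mul0mx.
exists (fun l => a l / a l0), (bform S z (w0 *m W) / a l0); split.
- by exists l0; rewrite divff ?normr1// -normr_gt0.
- by move=> l; rewrite normrM normfV ler_pdivrMr// mul1r; exact: l0max.
move=> w Dw; under eq_bigr do rewrite mulrAC.
rewrite -mulr_suml aE; congr (_ / _); apply/eqP; rewrite -subr_eq0 -bformNr -bformDr -mulmxBl.
have h1 := hD _ _ D1 D0; have h2 := hD _ _ Dw D0; have h3 := hD _ _ D1 Dw.
have key (p q : 'rV[R]_k) : F (p - q) = F p + F q - 2 * bform S (p *m W) (q *m W).
  by rewrite mulmxBl !bformE (bformC (q *m W) (p *m W) sS); ring.
have E : w1 - w = (w1 - w0) - (w - w0) by rewrite opprB addrA subrK.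
by move: h3; rewrite E key h1 h2 -/z => h3; apply/eqP; lra.
Qed.

End QuadricChart.

(** * Badly approximable points *)

Section BadlyApproximable.
Context {R : realType} {k : nat} {S : 'M[int]_k.+2}.
Local Notation SR := (intmx S : 'M[R]_k.+2).

(* For rational points r = [v] this is dist(r, [x]) >= C / H(r). *)
Definition lattice_ba (x : 'rV[R]_k.+2) := exists2 delta : R, 0 < delta &
  forall (v : 'rV[int]_k.+2) (a : R), v != 0 -> bform S v v = 0 ->
    delta <= `|intmx v - a *: x|.

Context {e f : 'rV[R]_k.+2} {W : 'M[R]_(k, k.+2)} {M : 'M[R]_(k.+2, k)}.
Hypothesis sS : S^T = S.
Hypothesis dS : \det S != 0.
Hypothesis wW : witt_split SR e f W M.
Local Notation Ne := (bform SR e f).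
Local Notation chart := (@qchart R k SR e f W).

Let sSR : SR^T = SR. Proof. by rewrite map_trmx sS. Qed.
Let dSR : \det SR != 0. Proof. by rewrite det_map_mx intr_eq0. Qed.

(** The chart coordinate of [v], with value 0 when b(v, e) = 0, that is, outside the chart. *)
Definition chart_point (v : 'rV[int]_k.+2) : 'rV[R]_k :=
  (Ne / bform SR (intmx v) e) *: (intmx v *m M).

Lemma int_norm_ge1 (v : 'rV[int]_k.+2) : v != 0 -> 1 <= `|intmx v : 'rV[R]_k.+2|.
Proof.
move=> v0; have [i vi] : exists i, v 0 i != 0.
  apply/existsP; apply: contraNT v0 => /existsPn h; apply/eqP/rowP => i.
  by have := h i; rewrite negbK mxE => /eqP.
apply: le_trans (mx_coord_le _ 0 i); rewrite mxE -intr_norm ler1z.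
by rewrite -gtz0_ge1 normr_gt0.
Qed.

Lemma itv1_dist (x y q : R) : q <= x <= q + 1 -> q <= y <= q + 1 -> `|x - y| <= 1.
Proof.
by move=> /andP[? ?] /andP[? ?]; rewrite ler_norml; apply/andP; split; lra.
Qed.

(** Pairing with e shows that the scale al of v differs from a by O(delta); [C * delta <= a] then
    gives al >= a / 2, so dividing by it is harmless. *)
Lemma chart_point_near : exists2 C, 0 < C & forall (v : 'rV[int]_k.+2) (u : 'rV[R]_k) (a delta : R),
  (forall l, 0 <= u 0 l <= 1) -> C * delta <= a -> 0 < a -> `|intmx v - a *: chart u| < delta ->
  bform SR (intmx v) e != 0 /\ `|chart_point v - u| <= C * delta / a.
Proof.
have Ne0 : Ne != 0 := ws_ef wW.
pose c1 : R := k.+2%:R ^+ 2 * `|SR| * `|e| / `|Ne|.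
have c10 : 0 <= c1 by rewrite divr_ge0// mulr_ge0// mulr_ge0 ?sqr_ge0.
pose c2 : R := k.+2%:R * `|M| + c1.
have c20 : 0 <= c2 by rewrite addr_ge0// mulr_ge0.
exists (2 * (c1 + c2) + 1); first by rewrite ltr_wpDl// mulr_ge0// addr_ge0.
move=> v u a delta u01 da a0 hv; set eta := intmx v - a *: chart u in hv.
have d0 : 0 < delta by exact: le_lt_trans hv.
have vE : intmx v = a *: chart u + eta by rewrite addrC subrK.
clearbody eta.
pose al := bform SR (intmx v) e / Ne.
have alE : al - a = bform SR eta e / Ne.
  by rewrite /al vE bformDl bformZl (qchart_e sSR wW); field.
have al_a : `|al - a| <= c1 * delta.
  rewrite alE normrM normfV /c1 mulrAC ler_wpM2r ?invr_ge0//.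
  rewrite (le_trans (bform_norm _ _ _))// mulrAC ler_wpM2l ?mulr_ge0 ?sqr_ge0//.
  exact: ltW.
have hda : 2 * (c1 * delta) <= a.
  rewrite (le_trans _ da)// mulrA ler_wpM2r ?(ltW d0)//.
  by rewrite mulrDr -addrA lerDl addr_ge0// mulr_ge0.
have al2 : a / 2 <= al by move: al_a; rewrite ler_norml => /andP[+ _]; lra.
have al0 : 0 < al by rewrite (lt_le_trans _ al2)// divr_gt0.
have be0 : bform SR (intmx v) e != 0.
  by apply: contra_neq (lt0r_neq0 al0) => h; rewrite /al h mul0r.
split => //.
have -> : chart_point v - u = al^-1 *: (eta *m M - (al - a) *: u).
  have -> : chart_point v = al^-1 *: (intmx v *m M) by rewrite /chart_point /al invf_div.
  rewrite vE mulmxDl -scalemxAl (qchartM sSR wW).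
  move: (eta *m M) => z; apply/rowP => i; rewrite !mxE; field; exact: lt0r_neq0.
have nu : `|u| <= 1.
  by apply: mx_norm_le => // i l; rewrite ord1 ger0_norm; have /andP[] := u01 l.
have h1 : `|eta *m M - (al - a) *: u| <= c2 * delta.
  rewrite (le_trans (ler_normB _ _))// /c2 mulrDl lerD//.
    by rewrite (le_trans (mulmx_norm_le _ _))// mulrAC ler_wpM2l ?mulr_ge0// ltW.
  by rewrite normrZ -[leRHS]mulr1 ler_pM.
rewrite normrZ normfV (gtr0_norm al0) mulrC ler_pdivrMr//.
rewrite (le_trans h1)// mulrAC -ler_pdivrMr ?invr_gt0// invrK.
apply: (@le_trans _ _ (2 * c2 * delta * (a / 2))); first by lra.
rewrite ler_pM ?mulr_ge0 ?divr_ge0 ?(ltW a0) ?(ltW d0)// ler_wpM2r ?(ltW d0)//.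
lra.
Qed.

(* Isotropic integer vectors v, v' within delta of a x(u), a' x(u'), with u, u' in one cube of side N^-n and
   a, a' in [A N^n, A N^(n+1)[, satisfy |b(v, v')| = a a' |b(v/a - v'/a', v/a - v'/a')| / 2 < 1 when A and delta = tau A
   are small.  So they are orthogonal, and their chart points lie on one hyperplane. *)
Lemma ba_tree (N : nat) : (0 < k)%N -> (2 <= N)%N ->
  exists (a : nat -> {ffun 'I_k -> nat} -> 'I_k -> R) (b : nat -> {ffun 'I_k -> nat} -> R),
  (forall n q, (exists l0, `|a n q l0| = 1) /\ forall l, `|a n q l| <= 1) /\
  forall (u : 'rV[R]_k) q, q 0%N = [ffun=> 0%N] -> (forall n, in_cube N n (q n) u) ->
    (forall n, (N%:R ^+ n.+1)^-1 < `|\sum_l a n (q n) l * u 0 l - b n (q n)|) ->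
    lattice_ba (chart u).
Proof.
move=> k0 N2; have NR n : 0 < (N%:R : R) ^+ n by rewrite exprn_gt0// ltr0n (leq_trans _ N2).
have N0 := NR 1%N; rewrite expr1 in N0.
have [C C0 hC] := chart_point_near.
have [L L0 hL] := @qchart_lipschitz R k SR e f W sSR 1 ler01.
have [X X0 hX] := @qchart_norm_le R k SR e f W sSR 1 ler01.
pose B : R := k.+2%:R ^+ 2 * `|SR|.
have B0 : 0 <= B by rewrite mulr_ge0 ?sqr_ge0.
(* The summands of 1 / tau serve [hCd] and [hkCd]. In D below, X + tau serves [hbig], while 1 + Y
   serves [hsmall]. *)
pose tau : R := (1 + C + k%:R * C * N%:R)^-1.
have tau0 : 0 < tau by rewrite invr_gt0 -addrA ltr_pwDl// addr_ge0// ?mulr_ge0// ltW.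
pose Y : R := B * N%:R ^+ 2 * (L + 2 * tau) ^+ 2.
have Y0 : 0 <= Y by rewrite mulr_ge0 ?sqr_ge0// mulr_ge0 ?sqr_ge0.
pose D : R := 1 + X + tau + Y.
have D1 : 1 <= D by rewrite /D; lra.
have D0 : 0 < D by exact: lt_le_trans D1.
pose A : R := D^-1; have A0 : 0 < A by rewrite invr_gt0.
have A1 : A <= 1 by rewrite invf_le1.
pose delta : R := tau * A; have delta0 : 0 < delta by exact: mulr_gt0.
have kCN0 : 0 <= k%:R * C * N%:R by rewrite mulr_ge0 ?mulr_ge0 ?(ltW C0) ?(ltW N0).
have tauE : tau * (1 + C + k%:R * C * N%:R) = 1.
  by rewrite mulVf// lt0r_neq0// -addrA ltr_pwDl// addr_ge0// ltW.
have AE : A * D = 1 by rewrite mulVf// lt0r_neq0.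
have hCd : C * delta <= A.
  rewrite mulrA ler_piMl ?(ltW A0)// -[leRHS]tauE mulrC ler_wpM2l ?(ltW tau0)//; lra.
have hkCd : k%:R * (C * delta) * N%:R <= A.
  have -> : k%:R * (C * delta) * N%:R = (tau * (k%:R * C * N%:R)) * A by rewrite /delta; ring.
  rewrite ler_piMl ?(ltW A0)// -[leRHS]tauE ler_wpM2l ?(ltW tau0)//; lra.
have hsmall : B * N%:R ^+ 2 * (A * L + 2 * delta) ^+ 2 < 2.
  have -> : B * N%:R ^+ 2 * (A * L + 2 * delta) ^+ 2 = A * (A * Y) by rewrite /delta /Y; ring.
  have h1 : A * Y <= 1 by rewrite -[leRHS]AE ler_wpM2l ?(ltW A0)// /D; lra.
  have h2 : A * (A * Y) <= 1 * 1 by rewrite ler_pM ?(ltW A0)// mulr_ge0// ltW.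
  lra.
(* A nonzero integer vector has norm at least 1, so sizes below A do not occur and level 0 is the
   first one. *)
have hbig (v : 'rV[int]_k.+2) (u : 'rV[R]_k) a : (forall l, 0 <= u 0 l <= 1) -> v != 0 ->
    0 <= a -> `|intmx v - a *: chart u| < delta -> A <= a.
  move=> u01 v0 a0 hv; have h1 := int_norm_ge1 v0.
  have h2 : `|intmx v : 'rV[R]_k.+2| <= a * X + delta.
    rewrite -[intmx v](subrK (a *: chart u)) addrC (le_trans (ler_normD _ _))//.
    rewrite lerD ?(ltW hv)// normrZ (ger0_norm a0) ler_wpM2l// hX//.
    by apply: mx_norm_le => // i l; rewrite ord1 ger0_norm; have /andP[] := u01 l.
  have h3 : A * X + delta <= 1.
    rewrite /delta [tau * A]mulrC -mulrDr -[leRHS]AE ler_wpM2l ?(ltW A0)// /D; lra.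
  have : A * X <= a * X by lra.
  by rewrite ler_pM2r.
pose unit_cube (u : 'rV[R]_k) := forall l, 0 <= u 0 l <= 1.
(* Defined from the cube and not from a point of it, so that the hyperplane depends on the label q
   alone. *)
pose close n (q : {ffun 'I_k -> nat}) : set 'rV[R]_k :=
  [set w | exists (v : 'rV[int]_k.+2) (a : R) (u : 'rV[R]_k),
    [/\ bform S v v = 0, A * N%:R ^+ n <= a < A * N%:R ^+ n.+1,
       unit_cube u /\ in_cube N n q u, `|intmx v - a *: chart u| < delta & w = chart_point v]].
have NA n a : A * N%:R ^+ n <= a -> A <= a.
  apply: le_trans; rewrite ler_peMr ?(ltW A0)// exprn_ege1// ler1n.
  exact: leq_trans N2.
have hclose n q w w' : close n q w -> close n q w' ->
    bform SR ((w - w') *m W) ((w - w') *m W) = 0.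
  move=> [v [a [u [vv /andP[a1 a2] [u01 uc] hv ->]]]].
  move=> [v' [a' [u' [vv' /andP[a1' a2'] [u01' uc'] hv' ->]]]].
  have ap : 0 < a by rewrite (lt_le_trans A0)// (NA _ _ a1).
  have ap' : 0 < a' by rewrite (lt_le_trans A0)// (NA _ _ a1').
  have [ve _] := hC v u a delta u01 (le_trans hCd (NA _ _ a1)) ap hv.
  have [ve' _] := hC v' u' a' delta u01' (le_trans hCd (NA _ _ a1')) ap' hv'.
  have vvR (z : 'rV[int]_k.+2) : bform S z z = 0 -> bform SR (intmx z) (intmx z) = 0.
    by move=> zz; rewrite bform_intmx zz.
  have t0 : bform S v v' = 0.
    apply: (@intr_lt1_eq0 R); rewrite -bform_intmx; set t := bform _ _ _.
    pose p := a^-1 *: intmx v - a'^-1 *: (intmx v' : 'rV[R]_k.+2).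
    have pp : bform SR p p = - 2 * t / (a * a').
      rewrite /p !bformE !vvR// (bformC (intmx v') (intmx v) sSR) -/t.
      by field; rewrite !lt0r_neq0.
    have np : `|p| <= (A * N%:R ^+ n)^-1 * (A * L + 2 * delta).
      have pE : p = a^-1 *: (intmx v - a *: chart u) - a'^-1 *: (intmx v' - a' *: chart u')
          + (chart u - chart u').
        rewrite /p !scalerBr !scalerA !mulVf ?lt0r_neq0// !scale1r.
        by apply/rowP => i; rewrite !mxE; ring.
      have u1 (z : 'rV[R]_k) : unit_cube z -> `|z| <= 1.
        by move=> z01; apply: mx_norm_le => // i l; rewrite ord1 ger0_norm; have /andP[] := z01 l.
      have An0 : 0 < A * N%:R ^+ n by rewrite mulr_gt0.
      have hq (z : 'rV[R]_k.+2) (c : R) : A * N%:R ^+ n <= c -> `|z| < delta ->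
          `|c^-1 *: z| <= (A * N%:R ^+ n)^-1 * delta.
        move=> hc hz; have c0 : 0 < c := lt_le_trans An0 hc.
        rewrite normrZ normfV (gtr0_norm c0) ler_pM ?invr_ge0 ?(ltW c0) ?(ltW hz)//.
        by rewrite lef_pV2 ?posrE.
      have huu : `|chart u - chart u'| <= (A * N%:R ^+ n)^-1 * (A * L).
        rewrite (le_trans (hL _ _ (u1 _ u01) (u1 _ u01')))//.
        have -> : (A * N%:R ^+ n)^-1 * (A * L) = L * (N%:R ^+ n)^-1.
          by field; rewrite !lt0r_neq0.
        rewrite ler_wpM2l ?(ltW L0)//; apply: mx_norm_le => [|i l]; first by rewrite invr_ge0 ltW.
        rewrite ord1 -[leRHS]mul1r ler_pdivlMr// -(gtr0_norm (NR n)) -normrM.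
        have -> : (u - u') 0 l * N%:R ^+ n = N%:R ^+ n * u 0 l - N%:R ^+ n * u' 0 l.
          by rewrite !mxE; ring.
        by apply: (@itv1_dist _ _ (q l)%:R); rewrite natr1.
      have -> : (A * N%:R ^+ n)^-1 * (A * L + 2 * delta) = (A * N%:R ^+ n)^-1 * delta
        + (A * N%:R ^+ n)^-1 * delta + (A * N%:R ^+ n)^-1 * (A * L) by ring.
      rewrite pE (le_trans (ler_normD _ _))// lerD// (le_trans (ler_normB _ _))// lerD//.
        exact: hq a1 hv.
      exact: hq a1' hv'.
    have aa0 : 0 < a * a' by exact: mulr_gt0.
    have -> : t = - (bform SR p p * (a * a')) / 2 by rewrite pp; field; rewrite !lt0r_neq0.
    rewrite normrM normrN (ger0_norm (_ : 0 <= 2^-1))// ltr_pdivrMr// mul1r.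
    apply: le_lt_trans hsmall.
    have s0 : 0 <= A * L + 2 * delta.
      by apply: addr_ge0; apply: mulr_ge0 => //; exact: ltW.
    set s := A * L + 2 * delta in np s0 *.
    rewrite normrM (gtr0_norm aa0).
    have -> : B * N%:R ^+ 2 * s ^+ 2 = (B * ((A * N%:R ^+ n)^-1 * s) * ((A * N%:R ^+ n)^-1 * s))
        * ((A * N%:R ^+ n.+1) * (A * N%:R ^+ n.+1)).
      rewrite [N%:R ^+ n.+1]exprS; move: (lt0r_neq0 (NR n)); move: (N%:R ^+ n) => y y0.
      by field; rewrite y0 lt0r_neq0.
    apply: ler_pM => //; [exact: ltW| |exact: (ler_pM (ltW ap) (ltW ap') (ltW a2) (ltW a2'))].
    rewrite (le_trans (bform_norm _ _ _))// -/B.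
    by apply: ler_pM; rewrite ?mulr_ge0// ler_wpM2l.
  have := @bform_intmx R _ S v v'; rewrite t0 (qchart_repr sSR wW (vvR _ vv) ve).
  rewrite (qchart_repr sSR wW (vvR _ vv') ve') bformZl bformZr (qchart_bform sSR wW).
  rewrite -/(chart_point v) -/(chart_point v') => /eqP.
  have Ne0 : Ne != 0 := ws_ef wW.
  rewrite !mulf_eq0 oppr_eq0 !invr_eq0 (negPf ve) (negPf ve') (negPf Ne0) /= pnatr_eq0 orbF.
  by move=> /eqP.
have /choice[ab hab] (nq : nat * {ffun 'I_k -> nat}) : exists ab : ('I_k -> R) * R,
    [/\ exists l0, `|ab.1 l0| = 1, forall l, `|ab.1 l| <= 1 &
    forall w, close nq.1 nq.2 w -> \sum_l ab.1 l * w 0 l = ab.2].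
  have [a [b [h1 h2 h3]]] := isotropic_hyperplane sSR dSR wW k0 (@hclose nq.1 nq.2).
  by exists (a, b).
exists (fun n q => (ab (n, q)).1), (fun n q => (ab (n, q)).2); split.
  by move=> n q; have [] := hab (n, q).
move=> u q q0 uc hu; exists delta => // v a v0 vv.
have u01 : unit_cube u.
  by move=> l; have := uc 0%N l; rewrite q0 ffunE expr0 mul1r.
wlog a0 : v a v0 vv / 0 <= a.
  move=> hw; have [|/ltW a0] := leP 0 a; first exact: hw.
  have := hw (- v) (- a); rewrite oppr_eq0 bformNl bformNr opprK oppr_ge0.
  move=> /(_ v0 vv a0); rewrite scaleNr opprK map_mxN.
  by rewrite addrC -opprB normrN.
rewrite leNgt; apply/negP => hv.
have aA := hbig v u a u01 v0 a0 hv.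
have [n /andP[n1 n2]] : exists n, A * N%:R ^+ n <= a < A * N%:R ^+ n.+1.
  have ap : 0 < a by exact: lt_le_trans aA.
  have ex : exists n, a < A * N%:R ^+ n.+1.
    have [n hn] := inv_exp_lt N2 (divr_gt0 A0 ap); exists n.
    have : a < A * N%:R ^+ n.
      by rewrite -ltr_pdivrMl// mulrC -[ltRHS]invrK -ltf_pV2 ?posrE ?invr_gt0 ?divr_gt0// invf_div invrK.
    by move=> /lt_le_trans; apply; rewrite ler_pM2l// exprS ler_peMl ?(ltW (NR _))// ler1n ltnW.
  case: (ex_minnP ex) => n hn nmin; exists n; rewrite hn andbT.
  case: n hn nmin => [|n] hn nmin; first by rewrite expr0 mulr1.
  by rewrite leNgt; apply/negP => /nmin; rewrite ltnn.
have cl : close n (q n) (chart_point v) by exists v, a, u; rewrite n1 n2.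
have [_ ab1 /(_ _ cl) E] := hab (n, q n).
have ap : 0 < a by exact: lt_le_trans aA.
have [_ near] := hC v u a delta u01 (le_trans hCd aA) ap hv.
(* The chart point is on the hyperplane and within C delta / a of u; summed over k coordinates this
   is at most N^-(n+1) by [hkCd], contrary to the avoided slab. *)
have := hu n; rewrite -E; apply/negP; rewrite -leNgt -sumrB.
rewrite (le_trans (ler_norm_sum _ _ _))//.
apply: (@le_trans _ _ (\sum_(l < k) (C * delta / a))).
  apply: ler_sum => l _; rewrite -mulrBr normrM -[leRHS]mul1r ler_pM//.
  rewrite (le_trans _ near)//.
  by have := mx_coord_le (chart_point v - u) 0 l; rewrite mxE [X in _ + X]mxE distrC.
rewrite sumr_const card_ord -[leLHS]mulr_natl -[leRHS]mul1r ler_pdivlMr ?NR//.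
have -> : k%:R * (C * delta / a) * N%:R ^+ n.+1 = (k%:R * (C * delta) * N%:R) * N%:R ^+ n / a.
  rewrite exprS; move: (N%:R ^+ n) => y; field; exact: lt0r_neq0.
by rewrite ler_pdivrMr// mul1r (le_trans _ n1)// ler_wpM2r// ltW.
Qed.

End BadlyApproximable.

(** * Covers of the quadric *)

Section GridCovers.
Context {R : realType} {X : Type} (dist : X -> X -> R) (k : nat).

(** Upper box dimension at most k, in the quantitative form of [hausdorff_measure_eq0]. *)
Definition grid_covered (A : set X) := exists (P0 : nat) (c C : R), [/\ 0 <= c, 0 < C &
  forall P, (P0 <= P)%N -> exists (T : finType) (U : T -> set X),
    [/\ A `<=` \bigcup_t U t, #|T|%:R <= c * P%:R ^+ k &
        forall t x y, U t x -> U t y -> dist x y <= C / P%:R]].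

Lemma grid_coveredU (A B : set X) : grid_covered A -> grid_covered B -> grid_covered (A `|` B).
Proof.
move=> [P1 [c1 [C1 [c10 C10 h1]]]] [P2 [c2 [C2 [c20 C20 h2]]]].
exists (maxn P1 P2), (c1 + c2), (C1 + C2); split; [exact: addr_ge0|exact: addr_gt0|].
move=> P; rewrite geq_max => /andP[/h1[T1 [U1 [AU1 T1c dU1]]] /h2[T2 [U2 [AU2 T2c dU2]]]].
exists (T1 + T2)%type, (fun t => match t with inl t => U1 t | inr t => U2 t end); split.
- by move=> x [/AU1[t _ Ut]|/AU2[t _ Ut]]; [exists (inl t)|exists (inr t)].
- by rewrite card_sum natrD mulrDl lerD.
move=> [t|t] x y Ux Uy; rewrite mulrDl.
  by rewrite (le_trans (dU1 t x y Ux Uy))// lerDl divr_ge0// ltW.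
by rewrite (le_trans (dU2 t x y Ux Uy))// lerDr divr_ge0// ltW.
Qed.

Lemma grid_covered_sub (A B : set X) : A `<=` B -> grid_covered B -> grid_covered A.
Proof.
move=> AB [P0 [c [C [c0 C0 h]]]]; exists P0, c, C; split => // P /h[T [U [BU Tc dU]]].
by exists T, U; split => //; exact: subset_trans BU.
Qed.

Lemma grid_covered_bigcup (I : finType) (A : I -> set X) :
  (forall i, grid_covered (A i)) -> grid_covered (\bigcup_i A i).
Proof.
move=> hA; suff H (s : seq I) : grid_covered (\bigcup_(i in [set` s]) A i).
  apply: grid_covered_sub (H (enum I)) => x [i _ Ai]; exists i => //=.
  by rewrite mem_enum.
elim: s => [|i s IH].
  exists 0%N, 0, 1; split => // P _; exists void, (fun=> set0); split => //.
  - by move=> x [i].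
  - by rewrite card_void mul0r.
apply: grid_covered_sub (grid_coveredU (hA i) IH) => x [j] /=.
by rewrite inE => /orP[/eqP ->|js] Aj; [left|right; exists j].
Qed.

(** The Lipschitz bound is required at distances up to [eps] only, as the Riemannian upper bound is
    local; grids of step at most [eps] suffice. *)
Lemma grid_covered_image (Phi : 'rV[R]_k -> X) (r L eps : R) : 0 < L -> 0 < eps ->
  (forall u u' : 'rV[R]_k, `|u| <= r -> `|u'| <= r -> `|u - u'| <= eps ->
     dist (Phi u) (Phi u') <= L * `|u - u'|) ->
  grid_covered [set Phi u | u in [set u | `|u| <= r]].
Proof.
move=> L0 eps0 hL; pose B := (Num.bound r).+1.
exists (Num.bound eps^-1).+1, ((3 * B)%:R ^+ k), L; split => //.
move=> P hP; have P0 : (0 < P)%N by exact: leq_trans hP.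
have PR : 0 < P%:R :> R by rewrite ltr0n.
(* Cells of side 1 / P cover [-B, B], with one more for the right end; m + 1 <= 3 B P. *)
pose m := (2 * B * P)%N.
pose cell (i : {ffun 'I_k -> 'I_m.+1}) : set X :=
  [set Phi u | u in [set u : 'rV[R]_k | `|u| <= r /\
     forall l, (i l)%:R <= (u 0 l + B%:R) * P%:R <= (i l)%:R + 1]].
exists {ffun 'I_k -> 'I_m.+1}, cell; split.
- move=> x [u /= ur <-].
  have uB l : 0 <= (u 0 l + B%:R) * P%:R < m.+1%:R.
    have rB : r <= B%:R.
      have [r0|/ltW r0] := leP 0 r; last by rewrite (le_trans r0).
      by rewrite (le_trans (ltW (archi_boundP r0)))// ler_nat.
    have := mx_coord_le u 0 l; rewrite ler_norml => /andP[h1 h2].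
    rewrite mulr_ge0 ?(ltW PR)//=; last by lra.
    rewrite (@le_lt_trans _ _ m%:R)// ?ltr_nat// /m !natrM ler_wpM2r// ?(ltW PR)//; lra.
  pose i : {ffun 'I_k -> 'I_m.+1} := [ffun l => inord (Num.truncn ((u 0 l + B%:R) * P%:R))].
  exists i => //; exists u => //; split => // l; rewrite ffunE inordK; last first.
    rewrite -(ltr_nat R); have /andP[h1 h2] := uB l; apply: le_lt_trans h2.
    by have /andP[] := truncn_itv h1.
  have /andP[h1 h2] := uB l; have /andP[h3 h4] := truncn_itv h1.
  by rewrite h3 natr1 ltW.
- rewrite card_ffun !card_ord natrX -exprMn lerXn2r ?nnegrE ?mulr_ge0//.
  rewrite -natrM ler_nat /m; have : (1 <= B * P)%N by rewrite muln_gt0 P0.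
  by rewrite -!mulnA; move: (B * P)%N => z; lia.
move=> i x y [u [ur hu] <-] [u' [ur' hu'] <-].
have uu : `|u - u'| <= P%:R^-1.
  apply: mx_norm_le => [|j l]; first by rewrite invr_ge0 ltW.
  rewrite ord1 !mxE -[leRHS]mul1r ler_pdivlMr// -(gtr0_norm PR) -normrM.
  have /andP[h1 h2] := hu l; have /andP[h3 h4] := hu' l.
  rewrite (_ : (u 0 l - u' 0 l) * _ = (u 0 l + B%:R) * P%:R - (u' 0 l + B%:R) * P%:R); last first.
    ring.
  by rewrite ler_norml; apply/andP; split; lra.
rewrite (le_trans (hL _ _ ur ur' _))//.
  rewrite (le_trans uu)// -[leRHS]invrK lef_pV2 ?posrE ?invr_gt0//.
  have e1 : 0 <= eps^-1 by rewrite invr_ge0 ltW.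
  by rewrite (le_trans (ltW (archi_boundP e1)))// ler_nat ltnW.
by rewrite ler_wpM2l// ltW.
Qed.

End GridCovers.

Section IsotropicSpan.
Context {R : realType} {k : nat} {S : 'M[R]_k.+2}.
Hypothesis sS : S^T = S.
Hypothesis dS : \det S != 0.

(** One chart misses the points orthogonal to its centre. The vectors e, f and e + w_i - q_i f are
    isotropic and span, so every x pairs substantially with one of them, and finitely many bounded
    charts cover the quadric. *)
Lemma isotropic_span (e : 'rV[R]_k.+2) : e != 0 -> bform S e e = 0 ->
  exists (J : finType) (E : J -> 'rV[R]_k.+2) (c : R), [/\ 0 < c,
    forall j, E j != 0 /\ bform S (E j) (E j) = 0 &
    forall x, x != 0 -> exists j, c * `|x| <= `|bform S x (E j)|].
Proof.
move=> e0 ee; have F2 : (2 : R) != 0 by rewrite pnatr_eq0.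
have [f ff ef] := isotropic_partner sS dS F2 e0 ee.
have [W [M wW]] := witt_split_ex sS ee ff ef.
have fe : bform S f e = bform S e f by exact: bformC.
have N0 : bform S e f != 0 := ef; set N := bform S e f in fe N0 *.
pose w i := row i W; pose q i := bform S (w i) (w i) / (2 * N).
have we i : bform S (w i) e = 0 by rewrite /w rowE (ws_We wW).
have wf i : bform S (w i) f = 0 by rewrite /w rowE (ws_Wf wW).
have ew i : bform S e (w i) = 0 by rewrite (bformC _ _ sS).
have fw i : bform S f (w i) = 0 by rewrite (bformC _ _ sS).
pose J : finType := option (option 'I_k).
pose E (j : J) : 'rV[R]_k.+2 := match j with
  None => e | Some None => f | Some (Some i) => e + w i - q i *: f end.
pose Q : R := 2 + \sum_i `|q i|.
have qQ i : 2 + `|q i| <= Q by rewrite lerD2l (bigD1 i)//= lerDl sumr_ge0.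
pose dl i : 'rV[R]_k.+2 := delta_mx 0 i.
pose kap i : R := `|bform S (dl i) f / N| + `|bform S (dl i) e / N|
  + \sum_l `|(dl i *m M) 0 l| * Q.
have Q0 : 0 <= Q by rewrite addr_ge0// sumr_ge0.
have kap0 i : 0 <= kap i.
  by rewrite addr_ge0 ?addr_ge0// sumr_ge0// => l _; rewrite mulr_ge0.
pose K : R := 1 + k.+2%:R * (\sum_i kap i) * `|invmx S|.
have K0 : 0 < K by rewrite ltr_pwDl// mulr_ge0// mulr_ge0// sumr_ge0.
exists J, E, K^-1; split; first by rewrite invr_gt0.
  move=> [[i|]|]; split => //=.
  - apply: contra_neq N0 => Ei0; have : bform S (e + w i - q i *: f) f = 0 by rewrite Ei0 bform0l.
    by rewrite !bformE ff (wf i) => <-; rewrite -/N; ring.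
  - by rewrite !bformE ee ff (we i) (wf i) (ew i) (fw i) fe -/N /q; field.
  - by apply: contra_neq N0 => f0; rewrite /N f0 bform0r.
move=> x x0.
have [jm _ jmax] := @Order.TotalTheory.arg_maxP _ _ J None predT (fun j => `|bform S x (E j)|) isT.
exists jm; set t := `|bform S x (E jm)| in jmax *; have t0 : 0 <= t by exact: normr_ge0.
have hE j : `|bform S x (E j)| <= t by exact: jmax.
have hw i : `|bform S x (w i)| <= t * Q.
  have -> : bform S x (w i) = bform S x (E (Some (Some i))) - bform S x (E None)
      + q i * bform S x (E (Some None)).
    by rewrite /= !bformE; ring.
  rewrite (le_trans (ler_normD _ _))// (le_trans (lerD (ler_normB _ _) (lexx _)))//.
  rewrite (@le_trans _ _ (t * (2 + `|q i|)))//; last by rewrite ler_wpM2l.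
  have -> : t * (2 + `|q i|) = t + t + `|q i| * t by ring.
  by rewrite normrM lerD ?lerD ?ler_wpM2l.
have hx : `|x *m S| <= t * \sum_i kap i.
  apply: mx_norm_le => [|a i]; first by rewrite mulr_ge0// sumr_ge0.
  rewrite ord1; have -> : (x *m S) 0 i = bform S x (dl i).
    by rewrite /bform /dl trmx_delta -colE [RHS]mxE.
  rewrite (@le_trans _ _ (t * kap i))//; last first.
    by rewrite ler_wpM2l// (bigD1 i)//= lerDl sumr_ge0.
  rewrite {1}(ws_dec wW (dl i)) -/N !bformDr !bformZr bform_row_sum.
  rewrite /kap !mulrDr (le_trans (ler_normD _ _))// lerD//.
    rewrite (le_trans (ler_normD _ _))//.
    by apply: lerD; rewrite normrM [leRHS]mulrC ler_wpM2l//; [exact: (hE None)|exact: (hE (Some None))].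
  rewrite (le_trans (ler_norm_sum _ _ _))// mulr_sumr; apply: ler_sum => l _.
  by rewrite normrM [leRHS]mulrCA ler_wpM2l//; exact: hw.
have uS : S \in unitmx by rewrite unitmxE unitfE.
rewrite ler_pdivrMl// -{1}(mulmxK uS x) (le_trans (mulmx_norm_le _ _))//.
rewrite /K [leRHS]mulrDl mul1r (@le_trans _ _ (k.+2%:R * (t * \sum_i kap i) * `|invmx S|))//.
  by rewrite ler_wpM2r// ler_wpM2l.
have -> : k.+2%:R * (t * \sum_i kap i) * `|invmx S| = k.+2%:R * (\sum_i kap i) * `|invmx S| * t by ring.
by rewrite lerDr.
Qed.

End IsotropicSpan.

(** * Heights *)

Section Heights.
Context {R : realType} {d : nat}.
Implicit Types p : projective_space R d.

Lemma primitive_multiple (B : 'rV[int]_d.+1) : B != 0 ->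
  exists (v : 'rV[int]_d.+1) (m : int), [/\ primitive_vec v, m != 0 & B = m *: v].
Proof.
move=> B0; pose G := (\big[gcdn/0%N]_(i < d.+1) `|B 0%R i|%N)%N.
have GB i : (G %| `|B 0%R i|)%N by exact: (biggcdn_inf i).
have G0 : (0 < G)%N.
  rewrite lt0n; apply: contraNneq B0 => G0; apply/eqP/rowP => i; rewrite mxE.
  by have := GB i; rewrite G0 dvd0n absz_eq0 => /eqP.
pose v : 'rV[int]_d.+1 := \row_i (B 0%R i %/ G%:Z)%Z.
have BE : B = G%:Z *: v.
  by apply/rowP => i; rewrite !mxE mulrC divzK//; exact: GB.
exists v, G%:Z; split => //; last by rewrite eqz_nat -lt0n.
rewrite /primitive_vec; set G' := \big[_/_]_(_ < _) _.
have : (G * G' %| G)%N.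
  apply/dvdn_biggcdP => i _; rewrite BE mxE abszM absz_nat dvdn_pmul2l//.
  exact: (biggcdn_inf i).
by rewrite -{2}[G]muln1 dvdn_pmul2l// dvdn1.
Qed.

Lemma primitive_neq0 (v : 'rV[int]_d.+1) : primitive_vec v -> v != 0.
Proof.
move=> pv; apply/eqP => v0; have : (2 %| \big[gcdn/0%N]_(i < d.+1) `|v 0%R i|%N)%N.
  by apply/dvdn_biggcdP => i _; rewrite v0 mxE.
by rewrite (eqP pv).
Qed.

(** For a nonzero coordinate t of v and the matching s of w, t w_j = s v_j for all j; as v is
    primitive, t divides s, so the ratio has absolute value at least 1. *)
Lemma primitive_norm_le p (v w : 'rV[int]_d.+1) : primitive_vec v ->
  homog p (intmx v) -> homog p (intmx w) -> `|intmx v : 'rV[R]_d.+1| <= `|intmx w : 'rV[R]_d.+1|.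
Proof.
move=> pv hv hw; have [c c0 wE] := homog_inj hv hw.
have [i vi] : exists i, v 0 i != 0.
  apply/existsP; apply: contraNT (primitive_neq0 pv) => /existsPn h; apply/eqP/rowP => i.
  by have := h i; rewrite negbK mxE => /eqP.
have wEi j : (w 0 j)%:~R = c * (v 0 j)%:~R :> R.
  by have /rowP/(_ j) := wE; rewrite !mxE.
set s := w 0 i; set t := v 0 i in vi.
have cross j : t * w 0 j = s * v 0 j.
  by apply: (@intr_inj R); rewrite !intrM !wEi; ring.
have s0 : s != 0 by rewrite -(intr_eq0 R) /s wEi mulf_neq0// intr_eq0.
have ts : (`|t| %| `|s|)%N.
  have g0 : (0 < gcdn `|t| `|s|)%N by rewrite gcdn_gt0 absz_gt0 vi.
  have tE : `|t|%N = (`|t| %/ gcdn `|t| `|s| * gcdn `|t| `|s|)%N by rewrite divnK// dvdn_gcdl.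
  have sE : `|s|%N = (`|s| %/ gcdn `|t| `|s| * gcdn `|t| `|s|)%N by rewrite divnK// dvdn_gcdr.
  have cop : coprime (`|t| %/ gcdn `|t| `|s|) (`|s| %/ gcdn `|t| `|s|).
    rewrite /coprime -(eqn_pmul2r g0) mul1n muln_gcdl.
    by rewrite -tE -sE.
  have : (`|t| %/ gcdn `|t| `|s| %| 1)%N.
    rewrite -(eqP pv); apply/dvdn_biggcdP => j _.
    rewrite -(Gauss_dvdr _ cop) -(dvdn_pmul2r g0) -tE.
    rewrite mulnAC -sE -abszM -cross abszM.
    exact: dvdn_mulr.
  by rewrite dvdn1 => /eqP h; rewrite tE h mul1n dvdn_gcdr.
have c1 : 1 <= `|c|.
  have : (`|t| <= `|s|)%N by apply: dvdn_leq => //; rewrite absz_gt0.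
  rewrite -(ler_nat R) !natr_absz !intr_norm /s wEi normrM => h.
  by rewrite -(@ler_pM2r _ `|t%:~R|) ?mul1r// normr_gt0 intr_eq0.
by rewrite wE normrZ ler_peMl.
Qed.

Lemma rational_primitive p : rational_points p ->
  exists2 v : 'rV[int]_d.+1, primitive_vec v & homog p (intmx v).
Proof.
move=> [w hw]; have [D D0 [B hB]] := rat_mx_denom w.
have w0 : w != 0.
  by case: hw => + _; apply: contraNneq => ->; rewrite raddf0.
have B0 : B != 0.
  rewrite -(int_mx_neq0 rat) hB; apply: contraNneq w0 => h.
  have : (D%:~R)^-1 *: (D%:~R *: w) = 0 by rewrite h scaler0.
  by rewrite scalerA mulVf ?intr_eq0// scale1r => /eqP.
have [v [m [pv m0 BE]]] := primitive_multiple B0.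
exists v => //.
have -> : intmx v = (m%:~R)^-1 * D%:~R *: map_mx ratr w :> 'rV[R]_d.+1.
  have h : intmx B = D%:~R *: map_mx ratr w :> 'rV[R]_d.+1.
    apply/rowP => i; have /rowP/(_ i)/(congr1 (ratr : rat -> R)) := hB.
    by rewrite !mxE rmorphM /= !ratr_int.
  by rewrite -scalerA -h BE map_mxZ scalerA mulVf ?intr_eq0// scale1r.
by apply: homog_scale => //; rewrite mulf_neq0 ?invr_eq0 ?intr_eq0.
Qed.

Lemma Hstd_ex p : rational_points p -> exists v : 'rV[int]_d.+1,
  [/\ primitive_vec v, homog p (intmx v) & Hstd p = `|intmx v : 'rV[R]_d.+1| ].
Proof.
move=> /rational_primitive[v pv hv].
by apply: (@xgetPex _ 0 [set h | exists v : 'rV[int]_d.+1,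
  [/\ primitive_vec v, homog p (intmx v) & h = `|intmx v : 'rV[R]_d.+1| ] ]); exists `|intmx v : 'rV[R]_d.+1|, v.
Qed.

Lemma homog_int_rational p (v : 'rV[int]_d.+1) : homog p (intmx v) -> rational_points p.
Proof.
move=> hv; exists (intmx v).
rewrite (_ : map_mx ratr _ = intmx v)//.
by apply/matrixP => i j; rewrite !mxE ratr_int.
Qed.

End Heights.

Section Quadric.
Context {R : realType} {d : nat} {Q : 'rV[R]_d.+1 -> R}.
Hypothesis hQ : integral_quadratic_form Q.
Hypothesis hns : nonsingular Q.

(** Twice the polar form is used, because the polar form itself has half-integral off-diagonal
    entries in general. *)
Lemma integral_polar_matrix : exists S : 'M[int]_d.+1,
  [/\ S^T = S, \det S != 0 & forall x, bform (intmx S) x x = 2 * Q x].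
Proof.
have [a hQa] := hQ; pose U : 'M[int]_d.+1 := \matrix_(i, j) if (i <= j)%N then a i j else 0.
exists (U + U^T); have QE x : Q x = bform (intmx U) x x.
  rewrite hQa bform_sum; apply: eq_bigr => i _; rewrite big_mkcond; apply: eq_bigr => j _.
  by rewrite !mxE; case: ifP => _; ring.
have bE x : bform (intmx (U + U^T)) x x = 2 * Q x.
  rewrite map_mxD /bform mulmxDr mulmxDl mxE -!/(bform _ _ _) QE.
  suff -> : bform (intmx U^T) x x = bform (intmx U) x x by ring.
  rewrite !bform_sum exchange_big; apply: eq_bigr => i _; apply: eq_bigr => j _.
  by rewrite !mxE; ring.
have sS : (U + U^T)^T = U + U^T by rewrite linearD /= trmxK addrC.
have sSR : (intmx (U + U^T) : 'M[R]_d.+1)^T = intmx (U + U^T) by rewrite map_trmx sS.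
split => //.
suff : (intmx (U + U^T) : 'M[R]_d.+1) \in unitmx.
  by rewrite unitmxE unitfE det_map_mx intr_eq0.
rewrite -row_free_unit; apply: inj_row_free => x hx; apply: hns => y.
rewrite /polar_form; have h : bform (intmx (U + U^T)) x y = 0.
  by rewrite /bform hx mul0mx mxE.
have := bE (x + y); rewrite !bformE !bE (bformC y x sSR) h => h'.
by lra.
Qed.

End Quadric.

(** Nothing is assumed at the exponent k itself, so the infimum is compared up to e. *)
Lemma hausdorff_dim_eq (R : realType) (X : Type) (dist : X -> X -> R) (A B : set X) (k : nat) :
  A `<=` B ->
  (forall s, 0 <= s < k%:R -> hausdorff_measure dist s A != 0) ->
  (forall s, k%:R < s -> hausdorff_measure dist s B = 0) ->
  hausdorff_dim dist A = hausdorff_dim dist B.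
Proof.
move=> AB hA hB; apply/le_anti/andP; split.
  apply: le_ereal_inf => _ [s [s0 Bs] <-]; exists s => //; split => //.
  apply/le_anti; rewrite hausdorff_measure_ge0 andbT -Bs.
  exact: hausdorff_measure_mono.
apply: le_ereal_inf_tmp => _ [s [s0 As] <-].
have ks : k%:R <= s.
  by rewrite leNgt; apply/negP => sk; have := hA s; rewrite s0 sk As eqxx => /(_ isT).
apply/lee_addgt0Pr => e e0; rewrite -EFinD.
apply: ereal_inf_lbound; exists (s + e) => //; split; first by rewrite addr_ge0// ltW.
by apply: hB; rewrite (le_lt_trans ks)// ltrDl.
Qed.

(** * The quadric with its Riemannian distance *)

Section QuadricMetric.
Context {R : realType} {k : nat} {g : 'rV[R]_k.+2 -> 'M[R]_k.+2}.
Hypothesis hg : riemannian_metric g.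
Context {Q : 'rV[R]_k.+2 -> R} {S : 'M[int]_k.+2}.
Hypothesis sS : S^T = S.
Hypothesis dS : \det S != 0.
Hypothesis SQ : forall x, bform (intmx S) x x = 2 * Q x.
Local Notation SR := (intmx S : 'M[R]_k.+2).
Local Notation rd := (riemannian_dist g).
Local Notation P := (projective_space R k.+1).

Let sSR : SR^T = SR. Proof. by rewrite map_trmx sS. Qed.
Let dSR : \det SR != 0. Proof. by rewrite det_map_mx intr_eq0. Qed.

Lemma quadric_homog (p : P) x : homog p x -> quadric Q p <-> bform SR x x = 0.
Proof.
move=> px; split=> [[y py Qy]|xx]; last by exists x => //; have := SQ x; lra.
by have [c _ ->] := homog_inj py px; rewrite !bformE SQ Qy; ring.
Qed.

Definition chart_proj (e f : 'rV[R]_k.+2) (W : 'M[R]_(k, k.+2)) M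
  (wW : witt_split SR e f W M) (u : 'rV[R]_k) : P := proj_point (qchart_neq0 sSR wW u).

(** The quadric is cut into the parts that pair substantially with one [E j]; stereographic
    projection from [E j] has bounded coordinates on its part. *)
Lemma quadric_grid_covered (e0 : 'rV[R]_k.+2) : e0 != 0 -> bform SR e0 e0 = 0 ->
  grid_covered rd k (quadric Q).
Proof.
move=> e00 ee0; have [J [E [c [c0 hE hc]]]] := isotropic_span sSR dSR e00 ee0.
pose A j : set P := [set p | exists x, [/\ homog p x, bform SR x x = 0 & c * `|x| <= `|bform SR x (E j)|]].
apply: (@grid_covered_sub _ _ _ _ _ (\bigcup_j A j)).
  move=> p Qp; have [x px] := homog_ex p; have [j hj] := hc x (proj1 px).
  by exists j => //; exists x; split => //; exact/(quadric_homog px).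
apply: grid_covered_bigcup => j; have [Ej0 EE] := hE j.
have F2 : (2 : R) != 0 by rewrite pnatr_eq0.
have [f ff ef] := isotropic_partner sSR dSR F2 Ej0 EE.
have [W [M wW]] := witt_split_ex sSR EE ff ef.
have Ne0 := ws_ef wW; set Ne := bform SR (E j) f in Ne0.
pose r := `|Ne| * (k.+2%:R * `|M|) / c.
have r0 : 0 <= r by rewrite divr_ge0 ?(ltW c0)// !mulr_ge0.
have [L L0 hL] := @qchart_lipschitz R k SR (E j) f W sSR r r0.
have [m m0 hm] := qchart_norm_ge sSR wW.
have [C C0 hC] := riemannian_dist_upper hg.
apply: (@grid_covered_sub _ _ _ _ _ [set chart_proj wW u | u in [set u | `|u| <= r]]).
  move=> p [x [px xx hx]]; have x0 : 0 < `|x| by rewrite normr_gt0; case: px.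
  have xe : bform SR x (E j) != 0.
    by rewrite -normr_gt0 (lt_le_trans _ hx)// mulr_gt0.
  exists ((Ne / bform SR x (E j)) *: (x *m M)) => /=.
    rewrite normrZ normrM normfV /r -!mulrA ler_wpM2l// mulrC ler_pdivrMr ?normr_gt0//.
    rewrite (le_trans (mulmx_norm_le _ _))//.
    have -> : k.+2%:R * (`|M| * c^-1) * `|bform SR x (E j)| =
      k.+2%:R * `|M| * (`|bform SR x (E j)| / c) by ring.
    rewrite mulrAC ler_wpM2l ?mulr_ge0// ler_pdivlMr// mulrC; exact: hx.
  apply: (@homog_uniq _ _ _ _ x) => //.
  rewrite [x in homog _ x](qchart_repr sSR wW xx xe).
  by apply: homog_scale; [rewrite mulf_neq0 ?invr_eq0|exact: homog_point].
(* The radius m / (2 L) keeps two chart vectors within half their norm, as [riemannian_dist_upper]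
   requires. *)
apply: (@grid_covered_image _ _ _ _ _ r (C * L / m) (m / (2 * L))).
- by rewrite divr_gt0// mulr_gt0.
- by rewrite divr_gt0// mulr_gt0.
move=> u u' ur ur' uu.
have h := hL _ _ ur' ur; rewrite (distrC u') in h.
have LM : L * `|u - u'| <= m / 2.
  by rewrite -ler_pdivlMl// (_ : L^-1 * (m / 2) = m / (2 * L))//; field; exact: lt0r_neq0.
rewrite (le_trans (hC _ _ _ _ (homog_point _) (homog_point _) _))//.
  by rewrite (le_trans h)// (le_trans LM)// ler_wpM2r.
have x0 : 0 < `|@qchart R k SR (E j) f W u| by exact: lt_le_trans (hm u).
rewrite -!mulrA ler_wpM2l ?(ltW C0)// mulrA mulrAC.
by rewrite ler_pM ?invr_ge0 ?(ltW x0)// lef_pV2 ?posrE.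
Qed.

Section Chart.
Context {e f : 'rV[R]_k.+2} {W : 'M[R]_(k, k.+2)} {M : 'M[R]_(k.+2, k)}.
Hypothesis wW : witt_split SR e f W M.

(** The distance controls x(u) - a x(u') for some a. Pairing with e bounds 1 - a, and applying M
    then bounds u - u'. *)
Lemma chart_proj_dist : exists2 C, 0 < C & forall u u' : 'rV[R]_k,
  (forall l, 0 <= u 0 l <= 1) -> (forall l, 0 <= u' 0 l <= 1) ->
  `|u - u'| <= C * rd (chart_proj wW u) (chart_proj wW u').
Proof.
have Ne0 := ws_ef wW; set Ne := bform SR e f in Ne0.
have [C C0 hC] := riemannian_dist_lower hg.
have [X X0 hX] := @qchart_norm_le R k SR e f W sSR 1 ler01.
pose c1 : R := k.+2%:R * `|M|; pose c2 : R := k.+2%:R ^+ 2 * `|SR| * `|e| / `|Ne|.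
have c10 : 0 <= c1 by exact: mulr_ge0.
have c20 : 0 <= c2 by rewrite divr_ge0 ?mulr_ge0 ?sqr_ge0.
exists ((c1 + c2 + 1) * (C * X)); first by rewrite mulr_gt0 ?mulr_gt0// ltr_wpDl// addr_ge0.
move=> u u' u01 u01'.
have n1 (z : 'rV[R]_k) : (forall l, 0 <= z 0 l <= 1) -> `|z| <= 1.
  by move=> z01; apply: mx_norm_le => // i l; rewrite ord1 ger0_norm; have /andP[] := z01 l.
have [a ha] := hC _ _ _ _ (homog_point (qchart_neq0 sSR wW u)) (homog_point (qchart_neq0 sSR wW u')).
rewrite -!/(chart_proj wW _) in ha.
set eta := _ - _ in ha; set D := rd _ _ in ha *.
have D0 : 0 <= D by exact: riemannian_dist_ge0.
have etaD : `|eta| <= C * X * D.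
  rewrite (le_trans ha)// [leRHS]mulrAC ler_wpM2l ?mulr_ge0 ?(ltW C0)//.
  exact: hX (n1 _ u01).
have ae : 1 - a = bform SR eta e / Ne.
  rewrite /eta bformDl bformNl bformZl !(qchart_e sSR wW) -/Ne; field; exact: Ne0.
have ha1 : `|1 - a| <= c2 * `|eta|.
  rewrite ae normrM normfV /c2 mulrAC ler_wpM2r ?invr_ge0//.
  by rewrite (le_trans (bform_norm _ _ _))// mulrAC.
have -> : u - u' = eta *m M - (1 - a) *: u'.
  rewrite /eta mulmxBl -scalemxAl !(qchartM sSR wW).
  by apply/rowP => i; rewrite !mxE; ring.
rewrite (le_trans (ler_normB _ _))//.
apply: (@le_trans _ _ ((c1 + c2 + 1) * `|eta|)); last first.
  by rewrite -mulrA ler_wpM2l// addr_ge0// addr_ge0.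
rewrite mulrDl mul1r mulrDl.
have h1 : `|eta *m M| <= c1 * `|eta| by rewrite (le_trans (mulmx_norm_le _ _))// mulrAC.
have h2 : `|(1 - a) *: u'| <= c2 * `|eta|.
  by rewrite normrZ (le_trans _ ha1)// ler_piMr// n1.
by rewrite (le_trans (lerD h1 h2))// lerDl.
Qed.

Lemma lattice_ba_BA (p : P) x : homog p x -> bform SR x x = 0 ->
  @lattice_ba R k S x -> BA rd (quadric Q) (psi_ 1) p.
Proof.
move=> px xx [delta delta0 hd]; split; first exact/(quadric_homog px).
have [C C0 hC] := riemannian_dist_lower hg.
exists (delta / C); first exact: divr_gt0.
move=> r [rr rQ]; have [v [pv rv ->]] := Hstd_ex rr.
have vv : bform S v v = 0.
  apply: (@intr_inj R); rewrite -bform_intmx; exact/(quadric_homog rv).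
have v0 := primitive_neq0 pv.
have nv : 0 < `|intmx v : 'rV[R]_k.+2| by rewrite normr_gt0; case: rv.
rewrite /psi_ powR_inv1 ?(ltW nv)// ler_pdivrMr// ler_pdivrMr//.
have [a ha] := hC _ _ _ _ rv px.
have -> : rd r p * `|intmx v : 'rV[R]_k.+2| * C = C * rd r p * `|intmx v : 'rV[R]_k.+2| by ring.
by rewrite (le_trans (hd v a v0 vv)).
Qed.

Lemma BA_hausdorff_neq0 s : (0 < k)%N -> 0 <= s < k%:R ->
  hausdorff_measure rd s (BA rd (quadric Q) (psi_ 1)) != 0.
Proof.
move=> k0 sk; have [C C0 hC] := chart_proj_dist.
apply: (@hausdorff_measure_neq0 R P rd (@riemannian_dist_ge0 _ _ g) k _ (chart_proj wW) C s) => //.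
move=> N N2; have [a [b [h1 h2]]] := ba_tree sS dS wW k0 N2.
exists a, b; split => // u q q0 uq hu.
apply: (lattice_ba_BA (homog_point _) (qchart_isotropic sSR wW u)).
exact: h2 q0 uq hu.
Qed.

End Chart.

Lemma quadric_dirichlet (v0 : 'rV[int]_k.+2) : v0 != 0 -> bform S v0 v0 = 0 ->
  dirichlet rd (quadric Q) (psi_ 1).
Proof.
move=> v00 vv0 p Qp; have [x px] := homog_ex p.
have xx : bform SR x x = 0 by exact/(quadric_homog px).
have x0 : 0 < `|x| by rewrite normr_gt0; case: px.
have [K hK] := isotropic_approximable sS dS v00 vv0 (proj1 px) xx.
have K0 : 0 <= K by have [v [a [_ _ h]]] := hK 0; exact: le_trans h.
have [C C0 hC] := riemannian_dist_upper hg.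
(* The margin 3 K leaves |v| >= n + 1 + 2 K, so the error K is at most |v| / 2. *)
have /choice[va hva] (n : nat) : exists va : 'rV[int]_k.+2 * R,
    [/\ bform S va.1 va.1 = 0, n.+1%:R + 3 * K <= `|va.2 *: x| & `|intmx va.1 - va.2 *: x| <= K].
  have [v [a [vv aT va]]] := hK ((n.+1%:R + 3 * K) / `|x|); exists (v, a); split => //=.
  by rewrite normrZ -ler_pdivrMr.
pose v n := (va n).1; pose a n := (va n).2.
have vn n : n.+1%:R + 2 * K <= `|intmx (v n) : 'rV[R]_k.+2|.
  have [_ h1 h2] := hva n; have := ler_distD (intmx (v n)) (a n *: x) 0.
  rewrite !subr0 distrC -/(a n) in h1 h2 *; rewrite -/(v n) in h2 *; move: h1 h2.
  by rewrite -/(a n); lra.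
have nn n : 0 < n.+1%:R :> R by rewrite ltr0n.
have vpos n : 0 < `|intmx (v n) : 'rV[R]_k.+2|.
  by apply: lt_le_trans (vn n); rewrite ltr_wpDr// mulr_ge0.
have vneq0 n : (intmx (v n) : 'rV[R]_k.+2) != 0 by rewrite -normr_gt0.
pose r n : P := proj_point (vneq0 n).
have an n : a n != 0.
  have [_ h1 _] := hva n; apply: contraTneq h1; rewrite -/(a n) => ->.
  by rewrite scale0r normr0 -ltNge ltr_wpDr// mulr_ge0.
have rdr n : rd (r n) p <= C * K / `|intmx (v n) : 'rV[R]_k.+2|.
  have [_ _ h2] := hva n; rewrite distrC -/(v n) -/(a n) in h2.
  rewrite (le_trans (hC _ _ _ (a n *: x) (homog_point (vneq0 n)) _ _))//.
  - exact: homog_scale.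
  - by rewrite (le_trans h2)//; have := vn n; have := nn n; lra.
  - by rewrite ler_wpM2r ?invr_ge0// ler_wpM2l// ltW.
exists (C * K + 1); first by rewrite ltr_wpDl// mulr_ge0// ltW.
exists r; split.
- move=> n; split; first exact: homog_int_rational (homog_point (vneq0 n)).
  apply/(quadric_homog (homog_point (vneq0 n))).
  by rewrite bform_intmx; have [-> _ _] := hva n.
- apply: (@squeeze_cvgr _ _ _ _ (fun=> 0) (fun n => C * K * n.+1%:R^-1)).
  + near=> n; rewrite riemannian_dist_ge0 /= (le_trans (rdr n))// ler_wpM2l ?mulr_ge0 ?(ltW C0)//.
    by rewrite lef_pV2 ?posrE// (le_trans _ (vn n))// lerDl mulr_ge0.
  + exact: cvg_cst.
  + by rewrite -(mulr0 (C * K)); apply: cvgMl_tmp; exact: cvg_harmonic.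
move=> n; rewrite (le_trans (rdr n))//.
have rn : rational_points (r n) by exact: homog_int_rational (homog_point (vneq0 n)).
have [w [pw hw ->]] := Hstd_ex rn.
have w0 : 0 < `|intmx w : 'rV[R]_k.+2| by rewrite normr_gt0; case: hw.
rewrite /psi_ powR_inv1 ?(ltW w0)//.
apply: ler_pM; rewrite ?invr_ge0 ?mulr_ge0 ?(ltW C0)//; first by rewrite lerDl.
(* The vectors v n need not be primitive; their norm bounds the height from above, which is the
   favourable direction. *)
by rewrite lef_pV2 ?posrE//; exact: primitive_norm_le pw hw (homog_point _).
Unshelve. all: by end_near.
Qed.

End QuadricMetric.

(** At p, e / H <= dist <= C phi(H) along the approximants. The first inequality with dist -> 0
    makes H large, where H phi(H) < e / C, a contradiction. *)
Lemma optimal_of_BA (R : realType) d (dist : projective_space R d -> projective_space R d -> R)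
    (M : set (projective_space R d)) (p : projective_space R d) :
  dirichlet dist M (psi_ 1) -> BA dist M (psi_ 1) p -> optimal_dirichlet dist M (psi_ 1).
Proof.
move=> hd [Mp [e e0 he]]; split => // -[phi hphi lim].
have [C C0 [r [rM rp rphi]]] := hphi p Mp.
have eC : 0 < e / C by rewrite divr_gt0.
have : \forall t \near +oo, `|phi t / psi_ 1 t| < e / C.
  move/cvgrPdist_lt : lim => /(_ _ eC); apply: filterS => t; by rewrite sub0r normrN.
move=> [T [_ hT]].
pose T' := 1 + `|T|; have T'0 : 0 < T' by rewrite ltr_pwDl.
have eT : 0 < e / T' by rewrite divr_gt0.
have [n hn] : exists n, dist (r n) p < e / T'.
  move/cvgrPdist_lt : rp => /(_ _ eT)[n0 _ /(_ n0 (leqnn _))]; rewrite sub0r normrN => h.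
  by exists n0; rewrite (le_lt_trans (ler_norm _) h).
set t := Hstd (r n).
have t0 : 0 < t.
  by rewrite /t; have [v [_ hv ->]] := Hstd_ex (proj1 (rM n)); rewrite normr_gt0; case: hv.
have psit : psi_ 1 t = t^-1 by rewrite /psi_ powR_inv1// ltW.
have h1 := he _ (rM n); rewrite -/t psit in h1.
have tT : T < t.
  have : e / t < e / T' by exact: le_lt_trans hn.
  rewrite ltr_pM2l// ltf_pV2 ?posrE// => /(le_lt_trans _); apply.
  by rewrite /T'; have := ler_norm T; lra.
have := hT t tT; rewrite psit invrK => h2.
have := rphi n; rewrite -/t => h3.
have : e / t <= C * phi t by exact: le_trans h1 h3.
rewrite ler_pdivrMr// -mulrA => h4.
have : `|phi t * t| * C < e by rewrite -ltr_pdivlMr.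
have : phi t * t <= `|phi t * t| by exact: ler_norm.
rewrite -(ler_pM2r C0); lra.
Qed.

Unset Implicit Arguments.

Theorem theorem2p8 (R : realType) (d : nat) (hd : (2 <= d)%N)
    (g : 'rV[R]_d.+1 -> 'M[R]_d.+1) (hg : riemannian_metric g)
    (Q : 'rV[R]_d.+1 -> R)
    (hQ : integral_quadratic_form Q) (hns : nonsingular Q)
    (hrat : (@rational_points R d `&` quadric Q) !=set0) :
  hausdorff_dim (riemannian_dist g)
      (BA (riemannian_dist g) (quadric Q) (psi_ 1))
    = hausdorff_dim (riemannian_dist g) (quadric Q)
  /\ optimal_dirichlet (riemannian_dist g) (quadric Q) (psi_ 1).
Proof.
case: d hd g hg Q hQ hns hrat => [//|k] k0 g hg Q hQ hns [p [rp Qp]].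
have {}k0 : (0 < k)%N by [].
have [S [sS dS SQ]] := integral_polar_matrix hQ hns.
have [v pv hv] := rational_primitive rp.
have v0 := primitive_neq0 pv.
have ee : bform (intmx S : 'M[R]_k.+2) (intmx v) (intmx v) = 0.
  exact/(quadric_homog SQ hv).
have vv : bform S v v = 0 by apply: (@intr_inj R); rewrite -bform_intmx.
have sSR : (intmx S : 'M[R]_k.+2)^T = intmx S by rewrite map_trmx sS.
have e0 : (intmx v : 'rV[R]_k.+2) != 0 by rewrite int_mx_neq0.
have F2 : (2 : R) != 0 by rewrite pnatr_eq0.
have [f ff ef] := isotropic_partner sSR (@int_det_neq0 R _ _ dS) F2 e0 ee.
have [W [M wW]] := witt_split_ex sSR ee ff ef.
have BAn s := BA_hausdorff_neq0 hg sS dS SQ wW (s := s) k0.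
split.
  apply: (@hausdorff_dim_eq _ _ _ _ _ k) => // [x []//|s ks].
  have [P0 [c [C [c0 C0 h]]]] := quadric_grid_covered hg sS dS SQ e0 ee.
  exact: (@hausdorff_measure_eq0 R _ _ (@riemannian_dist_ge0 _ _ g) k P0 _ c C s c0 C0 h ks).
(* Nonvanishing of the measure at exponent 0 says that the set is not empty. *)
have /set0P[x BAx] : BA (riemannian_dist g) (quadric Q) (psi_ 1) != set0.
  apply/eqP => B0; have := BAn 0; rewrite lexx ltr0n k0 B0 hausdorff_measure_set0 eqxx.
  by move=> /(_ isT).
apply: optimal_of_BA BAx.
exact: (quadric_dirichlet hg sS dS SQ v0 vv).
Qed.
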